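(* Let $\varepsilon>0$. For every fixed $x\in\mathbb{T}$, $$T_{N,x}(u_\varepsilon)\xrightarrow[N\to\infty]{L^1(\Omega)}\frac{3}{\pi}\,\varepsilon^{-1}(A_2-A_1).$$
   Context: Fix $T>0$. $\mathbb{T}=\mathbb{R}/\mathbb{Z}$ is the one-dimensional flat torus, identified with $[0,1)$ with periodic boundary conditions. $p_t(x)=\sum_{k\in\mathbb{Z}}\frac{1}{\sqrt{4\pi t}}e^{-(x-k)^2/(4t)}$ is the periodic heat kernel. $W$ is a space-time Gaussian white noise on $[0,T]\times\mathbb{T}$, i.e. a centered Gaussian family with $\mathbf{E}[W(A)W(B)]=\lambda(A\cap B)$ for Borel $A,B\subset[0,T]\times\mathbb{T}$, $\lambda$ being Lebesgue measure. Let $f(u)=u-u^3$. For $\varepsilon>0$, $u_\varepsilon$ is the unique mild solution, with zero initial condition, of the stochastic Allen--Cahn equation $\partial_tu_\varepsilon=\varepsilon\,\partial_x^2u_\varepsilon+f(u_\varepsilon)+\dot W$ on $[0,T]\times\mathbb{T}$, i.e. $$u_\varepsilon(t,x)=\int_0^t\!\int_{\mathbb{T}}p_{\varepsilon(t-s)}(x-y)f(u_\varepsilon(s,y))\,dy\,ds+\int_0^t\!\int_{\mathbb{T}}p_{\varepsilon(t-s)}(x-y)\,W(ds,dy);$$ it satisfies $\sup_{t\in[0,T],x\in\mathbb{T}}\mathbf{E}|u_\varepsilon(t,x)|^q<\infty$ for all $q\ge2$. Let $0<A_1<A_2\le T$, and for $N\ge1$ let $t_i=A_1+i\frac{A_2-A_1}{N}$,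 $i=0,\dots,N$. The temporal quartic variation of a random field $Z$ at the point $x$ is $$T_{N,x}(Z)=\sum_{i=0}^{N-1}\bigl(Z(t_{i+1},x)-Z(t_i,x)\bigr)^4 .$$ *)

(* Defs.v *)
From HB Require Import structures.
From mathcomp Require Import all_boot all_order all_algebra.
From mathcomp Require Import all_classical all_reals all_analysis.
Set Implicit Arguments.
Unset Strict Implicit.
Unset Printing Implicit Defensive.
Import Order.TTheory GRing.Theory Num.Theory.
Import numFieldNormedType.Exports.
Local Open Scope classical_set_scope.
Local Open Scope ring_scope.

(* The torus R/Z is identified with [0, 1[; only the heat kernel, which is
   1-periodic, sees the periodic boundary conditions. *)
Definition torus (R : realType) : set R := `[0, 1[%classic.

Definition spacetime (R : realType) (T : R) : set (R * R) :=
  `[0, T]%classic `*` @torus R.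

Definition lebesgue2 (R : realType) : set (R * R) -> \bar R :=
  (@lebesgue_measure R \x @lebesgue_measure R)%E.

Definition heat_kernel (R : realType) (t x : R) : R :=
  fine (\esum_(k in [set: int])
    (expR (- (x - k%:~R) ^+ 2 / (4 * t)) / Num.sqrt (4 * pi * t))%:E).

(* [normal_prob 0 0] is not the Dirac mass at 0 in the library, hence the
   separate treatment of the degenerate case. *)
Definition centered_gaussian_law (R : realType) (s : R) (A : set R) : \bar R :=
  if s == 0 then \d_(0 : R) A else normal_prob 0 s A.

Definition centered_gaussian (d : measure_display) (Omega : measurableType d)
    (R : realType) (P : probability Omega R) (X : Omega -> R) : Prop :=
  exists s : R, forall A : set R, measurable A ->
    P (X @^-1` A) = centered_gaussian_law s A.

(* Joint Gaussianity is expressed through finite linear combinations. The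
   values of W outside the Borel subsets of [0, T] x torus are irrelevant. *)
Definition white_noise (d : measure_display) (Omega : measurableType d)
    (R : realType) (P : probability Omega R) (T : R)
    (W : set (R * R) -> {RV P >-> R}) : Prop :=
  (forall (n : nat) (c : 'I_n -> R) (A : 'I_n -> set (R * R)),
     (forall i, measurable (A i) /\ A i `<=` spacetime T) ->
     centered_gaussian P (fun w => \sum_(i < n) c i * W (A i) w)) /\
  (forall A B : set (R * R),
     measurable A -> A `<=` spacetime T ->
     measurable B -> B `<=` spacetime T ->
     ('E_P[fun w => (W A w * W B w)%R] = lebesgue2 (A `&` B))%E).

(* X is (a version of) the Wiener integral of the deterministic h in
   L^2([0, T] x torus): the simple functions
   sum_(i < n m) c m i * 1_(A m i) tend to h in L^2 and the random variables
   sum_(i < n m) c m i * W (A m i) tend to X in L^2(Omega). *)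
Definition wiener_integral (d : measure_display) (Omega : measurableType d)
    (R : realType) (P : probability Omega R) (T : R)
    (W : set (R * R) -> {RV P >-> R}) (h : R * R -> R) (X : {RV P >-> R})
    : Prop :=
  measurable_fun (spacetime T) h /\
  exists (n : nat -> nat) (c : nat -> nat -> R)
         (A : nat -> nat -> set (R * R)),
    [/\ forall m i, measurable (A m i) /\ A m i `<=` spacetime T,
        (fun m => \int[@lebesgue2 R]_(z in spacetime T)
           ((h z - \sum_(i < n m) c m i * \1_(A m i) z) ^+ 2)%:E)%E
          @ \oo --> (0 : \bar R)%E
      & (fun m => 'E_P[fun w =>
           ((X w - \sum_(i < n m) c m i * W (A m i) w) ^+ 2)%R])%E
          @ \oo --> (0 : \bar R)%E].

Definition allen_cahn (R : realType) (v : R) : R := v - v ^+ 3.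

(* u is a jointly measurable random field on [0, T] x torus such that, for all
   (t, x), the mild equation with zero initial condition holds almost surely.
   Since the kernel is deterministic, the stochastic integral is a Wiener
   integral. *)
Definition mild_solution (d : measure_display) (Omega : measurableType d)
    (R : realType) (P : probability Omega R) (T eps : R)
    (W : set (R * R) -> {RV P >-> R}) (u : R -> R -> Omega -> R) : Prop :=
  measurable_fun (spacetime T `*` [set: Omega])
    (fun z : (R * R) * Omega => u z.1.1 z.1.2 z.2) /\
  forall t x : R, spacetime T (t, x) ->
    exists2 X : {RV P >-> R},
      wiener_integral T W
        (fun z => if z.1 < t then heat_kernel (eps * (t - z.1)) (x - z.2)
                  else 0) X
      & {ae P, forall w,
          (u t x w)%:E =
          ((\int[@lebesgue_measure R]_(s in `[0%R, t])
              \int[@lebesgue_measure R]_(y in @torus R)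
                (heat_kernel (eps * (t - s)) (x - y)
                   * allen_cahn (u s y w))%:E)
           + (X w)%:E)%E}.

Definition bounded_moments (d : measure_display) (Omega : measurableType d)
    (R : realType) (P : probability Omega R) (T : R)
    (u : R -> R -> Omega -> R) : Prop :=
  forall q : R, 2 <= q ->
    (ereal_sup [set 'E_P[fun w => (`|u z.1 z.2 w| `^ q)%R]
               | z in spacetime T] < +oo)%E.

Definition time_grid (R : realType) (A1 A2 : R) (N i : nat) : R :=
  A1 + i%:R * ((A2 - A1) / N%:R).

Definition quartic_variation (Omega : Type) (R : realType) (A1 A2 : R)
    (N : nat) (x : R) (Z : R -> R -> Omega -> R) (w : Omega) : R :=
  \sum_(0 <= i < N)
    (Z (time_grid A1 A2 N i.+1) x w - Z (time_grid A1 A2 N i) x w) ^+ 4.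

Definition cvg_L1 (d : measure_display) (Omega : measurableType d)
    (R : realType) (P : probability Omega R)
    (Y_ : nat -> Omega -> R) (Y : Omega -> R) : Prop :=
  (fun N => 'E_P[fun w => `|Y_ N w - Y w|%R])%E @ \oo --> (0 : \bar R)%E.

(* Main.v *)
Require Import Defs.
From HB Require Import structures.
From mathcomp Require Import all_boot all_order all_algebra.
From mathcomp Require Import all_classical all_reals all_analysis.
From mathcomp Require Import measurable_realfun ftc.
From mathcomp Require Import ring lra zify.
Set Implicit Arguments.
Unset Strict Implicit.
Unset Printing Implicit Defensive.
Import Order.TTheory GRing.Theory Num.Theory.
Import numFieldNormedType.Exports.
Local Open Scope classical_set_scope.
Local Open Scope ring_scope.

(** At a fixed point [x] of the torus write [u t x = X t + V t], where [X t] is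
    the stochastic convolution, the Wiener integral of the kernel [h t], and
    [V t] is the drift.

    The process [X] is Gaussian.  By the semigroup property of the heat kernel,
    the covariance of [X t] and [X s] is half the integral of [p_{eps tau}(0)]
    over [t - s <= tau <= t + s], and
    [p_{eps tau}(0) = 1 / sqrt (4 pi eps tau) + O(1)].  Hence the covariance is
    [G (t + s) - G |t - s|] with [G a = sqrt a / kappa + S a],
    [kappa = sqrt (4 pi eps)] and [S] Lipschitz ([overlap]).  On a grid of mesh
    [delta] in [A1, A2], away from time zero, the increments of [X] therefore
    have variance [2 sqrt delta / kappa + O(delta)], so that the expected fourth
    powers [3 (2 sqrt delta / kappa)^2 = 3 delta / (pi eps)] add up to the claimed
    limit.  The covariance of two distinct increments is, up to [O(delta)],
    [sqrt delta / kappa] times a second difference of the square root; these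
    second differences are summable because they telescope, so that the variance of
    the quartic sum is [O(sqrt delta)] ([cov_incr_approx], [grid_sums],
    [noise_quartic_variation]).

    The only Gaussian input is moments of order two, four and eight.  They are
    computed for normal laws, hold for linear combinations of the noise, and pass
    to [L^2] limits.  The mixed moment [E (X^4 Z^4)] needed for the variance is
    obtained by polarising eighth moments of [X + b Z] ([wint_mixed_moment]).

    The drift is smoother: the [L^1] distance of [h t] and [h s] is
    [O(sqrt (t - s))] ([noise_kernel_modulus]), and Jensen's inequality with the
    moment bounds on [u] gives [E (V t - V s)^4 = O((t - s)^2)]
    ([drift_increment]).  The fourth powers of the drift increments then sum to
    [O(delta)], and [perturbed_quartic_sum] shows that they do not affect the
    limit. *)

(** * Integrals with a finite value *)

(** Integrability and value are kept together, so that integrals are combined by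
    real arithmetic, without any discussion of infinite values. *)
Definition has_int d (T : measurableType d) (R : realType)
    (mu : {measure set T -> \bar R}) (D : set T) (f : T -> R) (v : R) : Prop :=
  mu.-integrable D (EFin \o f) /\ (\int[mu]_(x in D) (f x)%:E)%E = v%:E.

Section has_int.
Context d (T : measurableType d) (R : realType).
Variables (mu : {measure set T -> \bar R}) (D : set T).
Hypothesis mD : measurable D.
Implicit Types (f g : T -> R) (v w k : R).

Lemma has_int_uniq f v w : has_int mu D f v -> has_int mu D f w -> v = w.
Proof. by move=> [_ h1] [_ h2]; move: h2; rewrite h1 => -[]. Qed.

Lemma has_int_eq f g v : (forall x, D x -> f x = g x) ->
  has_int mu D f v -> has_int mu D g v.
Proof.
move=> fg [i1 h1]; split.
  by apply: eq_integrable i1 => // x /[!inE] Dx /=; rewrite fg.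
rewrite -h1; by apply: eq_integral => x /[!inE] Dx /=; rewrite fg.
Qed.

Lemma has_intD f g v w : has_int mu D f v -> has_int mu D g w ->
  has_int mu D (fun x => f x + g x) (v + w).
Proof.
move=> [i1 h1] [i2 h2]; split.
  by apply: eq_integrable (integrableD mD i1 i2).
by rewrite (integralD_EFin mD i1 i2) /= h1 h2.
Qed.

Lemma has_intZ k f v : has_int mu D f v -> has_int mu D (fun x => k * f x) (k * v).
Proof.
move=> [i1 h1]; split.
  by apply: eq_integrable (integrableZl mD k i1).
by under eq_integral do rewrite EFinM; rewrite integralZl // h1.
Qed.

Lemma has_intB f g v w : has_int mu D f v -> has_int mu D g w ->
  has_int mu D (fun x => f x - g x) (v - w).
Proof.
move=> h1 /(has_intZ (-1)) h2; have := has_intD h1 h2.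
by rewrite mulN1r; apply: has_int_eq => x _; rewrite mulN1r.
Qed.

Lemma has_int0 : has_int mu D (fun=> 0) 0.
Proof. by split; [exact: integrable0|rewrite integral0]. Qed.

Lemma has_int_sum I (s : seq I) (F : I -> T -> R) (v : I -> R) :
  (forall i, has_int mu D (F i) (v i)) ->
  has_int mu D (fun x => \sum_(i <- s) F i x) (\sum_(i <- s) v i).
Proof.
move=> h; elim: s => [|i s ih].
  by rewrite big_nil; apply: has_int_eq has_int0 => x _; rewrite big_nil.
rewrite big_cons; apply: has_int_eq (has_intD (h i) ih) => x _.
by rewrite big_cons.
Qed.

Lemma has_int_le f g v w : (forall x, D x -> f x <= g x) ->
  has_int mu D f v -> has_int mu D g w -> v <= w.
Proof.
move=> fg [i1 h1] [i2 h2]; rewrite -lee_fin -h1 -h2.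
by apply: le_integral => // x /[!inE] Dx; rewrite lee_fin fg.
Qed.

Lemma has_int_ge0 f v : (forall x, D x -> 0 <= f x) -> has_int mu D f v -> 0 <= v.
Proof. by move=> f0 h; exact: has_int_le f0 has_int0 h. Qed.

Lemma integrable_has_int f : mu.-integrable D (EFin \o f) ->
  exists v, has_int mu D f v.
Proof.
move=> h; exists (fine (\int[mu]_(x in D) (f x)%:E)%E); split=> //.
by rewrite fineK //; exact: integrable_fin_num.
Qed.

Lemma has_int_measurable f v : has_int mu D f v -> measurable_fun D f.
Proof. by move=> [/measurable_int/measurable_EFinP]. Qed.

Lemma ge0_has_int f v : measurable_fun D f -> (forall x, D x -> 0 <= f x) ->
  (\int[mu]_(x in D) (f x)%:E)%E = v%:E -> has_int mu D f v.
Proof.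
move=> mf f0 h; split=> //; apply/integrableP; split; first exact/measurable_EFinP.
rewrite (eq_integral (EFin \o f)) /= ?h ?ltry// => x /[!inE] Dx.
by rewrite ger0_norm ?f0.
Qed.

Lemma ge0_has_int_ub f b : measurable_fun D f -> (forall x, D x -> 0 <= f x) ->
  (\int[mu]_(x in D) (f x)%:E <= b%:E)%E ->
  exists v, has_int mu D f v /\ 0 <= v <= b.
Proof.
move=> mf f0 h; have i0 : (0 <= \int[mu]_(x in D) (f x)%:E)%E.
  by apply: integral_ge0 => x Dx; rewrite lee_fin f0.
have ff : (\int[mu]_(x in D) (f x)%:E)%E \is a fin_num.
  by rewrite ge0_fin_numE // (le_lt_trans h) ?ltry.
exists (fine (\int[mu]_(x in D) (f x)%:E)%E); split.
  by apply: ge0_has_int; rewrite ?fineK.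
by rewrite -!lee_fin fineK ?i0.
Qed.

Lemma has_int_dom f g w : measurable_fun D f ->
  (forall x, D x -> `|f x| <= g x) -> has_int mu D g w ->
  exists v, has_int mu D f v /\ `|v| <= w.
Proof.
move=> mf fg hg; have [i2 h2] := hg.
have /integrable_has_int[v hv] : mu.-integrable D (EFin \o f).
  apply: le_integrable i2 => //; first exact/measurable_EFinP.
  move=> x Dx /=; rewrite lee_fin (le_trans (fg x Dx)) ?ler_norm //.
exists v; split=> //; rewrite ler_norml; apply/andP; split.
  have hNg : has_int mu D (fun x => - g x) (- w).
    by rewrite -mulN1r; apply: has_int_eq (has_intZ (-1) hg) => x _; rewrite mulN1r.
  apply: has_int_le hNg hv => x Dx.
  by have := fg x Dx; rewrite ler_norml => /andP[].
apply: has_int_le hv hg => x Dx.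
by have := fg x Dx; rewrite ler_norml => /andP[].
Qed.

End has_int.

(** * Perturbed powers and convergence in the mean *)

Section powers.
Context (R : realType).
Implicit Types a b t e : R.

Lemma pow1D_le n t : 0 <= t <= 1 -> (1 + t) ^+ n <= 1 + (2 ^+ n - 1) * t.
Proof.
move=> /andP[t0 t1]; elim: n => [|n ih]; first by rewrite !expr0; lra.
have p1 : 1 <= 2 ^+ n :> R by rewrite exprn_ege1 // ler1n.
rewrite exprS [2 ^+ n.+1]exprS; set p := 2 ^+ n in ih p1 *; set q := (1 + t) ^+ n in ih *.
have : (1 + t) * q <= (1 + t) * (1 + (p - 1) * t) by rewrite ler_pM2l //; lra.
move=> /le_trans; apply; suff : 0 <= (p - 1) * (t * (1 - t)) by nra.
by rewrite !mulr_ge0 //; lra.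
Qed.

Lemma powB_le n a b : `|(a + b) ^+ n - a ^+ n| <= (`|a| + `|b|) ^+ n - `|a| ^+ n.
Proof.
elim: n => [|n ih]; first by rewrite !expr0 !subrr normr0.
have -> : (a + b) ^+ n.+1 - a ^+ n.+1 = (a + b) * ((a + b) ^+ n - a ^+ n) + b * a ^+ n.
  by rewrite !exprS; ring.
apply: (le_trans (ler_normD _ _)); rewrite !normrM normrX.
have -> : (`|a| + `|b|) ^+ n.+1 - `|a| ^+ n.+1 =
  (`|a| + `|b|) * ((`|a| + `|b|) ^+ n - `|a| ^+ n) + `|b| * `|a| ^+ n.
  by rewrite !exprS; ring.
by rewrite lerD2r ler_pM // ?ler_normD.
Qed.

(** A substitute for Minkowski's inequality, for a threshold [t] such that
    [(1 + t)^n <= 1 + e]: if [|b| <= t |a|] the first term suffices, and otherwise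
    [b] dominates [a]. *)
Lemma pow_perturb n e : 0 < e -> exists C : R, 0 <= C /\
  forall a b, `|(a + b) ^+ n - a ^+ n| <= e * `|a| ^+ n + C * `|b| ^+ n.
Proof.
move=> e0; have p2 : 0 < 2 ^+ n :> R by rewrite exprn_gt0.
pose t := Num.min 1 (e / 2 ^+ n); have t0 : 0 < t by rewrite lt_min ltr01 divr_gt0.
have t1 : 0 <= t <= 1 by rewrite ltW //= ge_min lexx.
have te : t * 2 ^+ n <= e by rewrite -ler_pdivlMr // ge_min lexx orbT.
have ht : (1 + t) ^+ n - 1 <= e.
  by rewrite lerBlDl (le_trans (pow1D_le n t1)) // lerD2l; nra.
exists ((t^-1 + 1) ^+ n); split; first by rewrite exprn_ge0 // addr_ge0 // invr_ge0 ltW.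
move=> a b; apply: (le_trans (powB_le _ _ _)).
have [ba|ba] := leP `|b| (t * `|a|).
  have : (`|a| + `|b|) ^+ n <= (1 + t) ^+ n * `|a| ^+ n.
    by rewrite -exprMn lerXn2r ?nnegrE ?addr_ge0 ?mulr_ge0 //; nra.
  have a0 : 0 <= `|a| ^+ n by rewrite exprn_ge0.
  have c0 : 0 <= (t^-1 + 1) ^+ n * `|b| ^+ n.
    by rewrite mulr_ge0 ?exprn_ge0 ?addr_ge0 ?invr_ge0 // ltW.
  nra.
have ab : `|a| <= t^-1 * `|b| by rewrite ler_pdivlMl // ltW.
have h : (`|a| + `|b|) ^+ n <= (t^-1 + 1) ^+ n * `|b| ^+ n.
  by rewrite -exprMn lerXn2r ?nnegrE ?addr_ge0 ?mulr_ge0 ?addr_ge0 ?invr_ge0 ?(ltW t0) //; lra.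
have a0 : 0 <= `|a| ^+ n by rewrite exprn_ge0.
have : 0 <= e * `|a| ^+ n by rewrite mulr_ge0 // ltW.
lra.
Qed.

End powers.

Section nneseries.
Context d (T : measurableType d) (R : realType).

Lemma emeasurable_nneseries (D : set T) (h : nat -> T -> \bar R) :
  (forall k x, D x -> (0 <= h k x)%E) -> (forall k, measurable_fun D (h k)) ->
  measurable_fun D (fun x => \sum_(k <oo) h k x)%E.
Proof.
move=> h0 mh.
by apply: (ge0_emeasurable_sum (P := xpredT)) => // k x Dx _; exact: h0.
Qed.

Lemma measurable_fun_limn_einf (D : set T) (f : nat -> T -> \bar R) :
  (forall n, measurable_fun D (f n)) ->
  measurable_fun D (fun x => limn_einf (f ^~ x)).
Proof.
move=> mf; rewrite (_ : (fun x => _) =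
    (fun x => - limn_esup ((fun n x => - f n x) ^~ x))%E); last first.
  by apply/funext => x; rewrite -limn_einfN; congr limn_einf; apply/funext => n /=; rewrite oppeK.
apply: measurableT_comp => //; apply: measurable_fun_limn_esup => n.
exact: measurableT_comp.
Qed.

Lemma nneseries_fin_cvg0 (r : nat -> R) : (forall k, 0 <= r k) ->
  (\sum_(k <oo) (r k)%:E)%E \is a fin_num -> r @ \oo --> (0 : R).
Proof.
move=> r0 fS; apply: cvg_series_cvg_0; apply/cvg_ex.
exists (fine (\sum_(k <oo) (r k)%:E)%E).
have h : (fun n => \sum_(0 <= k < n) (r k)%:E)%E @ \oo --> (\sum_(k <oo) (r k)%:E)%E.
  by apply: is_cvg_nneseries => k _ _; rewrite lee_fin.
rewrite -(fineK fS) in h; have /fine_cvgP[_] := h; apply: cvg_trans.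
by apply: near_eq_cvg; apply: nearW => n /=; rewrite /series /= sumEFin.
Qed.

End nneseries.

Section Lp.
Context d (T : measurableType d) (R : realType).
Variables (mu : {measure set T -> \bar R}) (D : set T).
Hypothesis mD : measurable D.

(** Even powers are nonnegative, so that the perturbation inequality transports
    integrability and the values of the integrals along [L^n] convergence. *)
Lemma Lp_limit (n : nat) (f_ : nat -> T -> R) (f : T -> R) (L_ e_ : nat -> R) :
  ~~ odd n -> measurable_fun D f ->
  (forall m, has_int mu D (fun x => f_ m x ^+ n) (L_ m)) ->
  (forall m, has_int mu D (fun x => (f x - f_ m x) ^+ n) (e_ m)) ->
  e_ @ \oo --> (0 : R) ->
  exists L, has_int mu D (fun x => f x ^+ n) L /\ L_ @ \oo --> L.
Proof.
move=> en mf hf he ce.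
have mfn : measurable_fun D (fun x => f x ^+ n) by exact: measurable_funX.
have fn0 g x : 0 <= (g : T -> R) x ^+ n by rewrite exprn_even_ge0.
have [I hI] : exists I, has_int mu D (fun x => f x ^+ n) I.
  have [C [C0 hC]] := pow_perturb n (ltr01 : 0 < (1 : R)).
  have h x : `|f x ^+ n - f_ 0%N x ^+ n| <= 1 * f_ 0%N x ^+ n + C * (f x - f_ 0%N x) ^+ n.
    have := hC (f_ 0%N x) (f x - f_ 0%N x); rewrite [_ + (_ - _)]addrC subrK.
    by rewrite -!normrX (ger0_norm (fn0 _ _)) (@ger0_norm _ (_ ^+ n)) // exprn_even_ge0.
  have hg := has_intD mD (has_intZ mD 1 (hf 0%N)) (has_intZ mD C (he 0%N)).
  have [|v [hv _]] := has_int_dom mD _ (fun x _ => h x) hg.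
    exact: measurable_funB mfn (has_int_measurable (hf 0%N)).
  exists (v + L_ 0%N).
  by apply: (has_int_eq mD) (has_intD mD hv (hf 0%N)) => x _; rewrite subrK.
exists I; split=> //; apply/cvgrPdist_le => /= eps eps0.
have I0 : 0 <= I by apply: (has_int_ge0 mD) hI => x _.
have I1 : 0 < I + 1 by rewrite ltr_wpDl.
pose eta := eps / 2 / (I + 1).
have eta0 : 0 < eta by rewrite !divr_gt0.
have [C [C0 hC]] := pow_perturb n eta0.
have hd m : `|I - L_ m| <= eta * I + C * e_ m.
  have hx x : `|f x ^+ n - f_ m x ^+ n| <= eta * f x ^+ n + C * (f x - f_ m x) ^+ n.
    have := hC (f x) (- (f x - f_ m x)); rewrite opprB [_ + (_ - _)]addrC subrK distrC.
    rewrite -!normrX (ger0_norm (fn0 _ _)) -[f_ m x - f x]opprB exprNn.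
    by rewrite -signr_odd (negbTE en) mul1r (@ger0_norm _ (_ ^+ n)) // exprn_even_ge0.
  have hg := has_intD mD (has_intZ mD eta hI) (has_intZ mD C (he m)).
  have [|v [hv vb]] := has_int_dom mD _ (fun x _ => hx x) hg.
    exact: measurable_funB mfn (has_int_measurable (hf m)).
  by rewrite (has_int_uniq (has_intB mD hI (hf m)) hv).
have : (fun m => eta * I + C * e_ m) @ \oo --> eta * I + C * 0.
  by apply: cvgD; [exact: cvg_cst|apply: cvgM => //; exact: cvg_cst].
have lt1 : eta * I + C * 0 < eps.
  rewrite mulr0 addr0; apply: (@le_lt_trans _ _ (eps / 2)); last by lra.
  by rewrite /eta mulrAC ler_pdivrMr // ler_pM2l ?divr_gt0 // lerDl.
move=> /cvgr_lt /(_ _ lt1); apply: filterS => m /ltW; exact: le_trans (hd m).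
Qed.

(** A sequence converging in [L^2] converges almost everywhere along a
    subsequence, so that Fatou's lemma transfers moment bounds to the limit. *)
Lemma fatou_L2 (n : nat) (f_ : nat -> T -> R) (f : T -> R) (e_ : nat -> R) (B : R) :
  ~~ odd n -> measurable_fun D f -> (forall m, measurable_fun D (f_ m)) ->
  (forall m, has_int mu D (fun x => (f_ m x - f x) ^+ 2) (e_ m)) ->
  e_ @ \oo --> (0 : R) ->
  (forall m, \int[mu]_(x in D) (f_ m x ^+ n)%:E <= B%:E)%E ->
  (\int[mu]_(x in D) (f x ^+ n)%:E <= B%:E)%E.
Proof.
move=> en mf mf_ he ce hB.
have /choice[p hp] : forall k, exists m, e_ m <= 1 / (2 ^ k.+1)%:R.
  move=> k; have : 0 < (1 / (2 ^ k.+1)%:R : R) by rewrite divr_gt0 // ltr0n expn_gt0.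
  move=> /(cvgr_lt _ ce) [N _ hN]; exists N; apply/ltW/hN => /=; exact: leqnn.
pose a k x := ((f_ (p k) x - f x) ^+ 2)%:E.
have ma k : measurable_fun D (a k).
  by apply/measurable_EFinP/measurable_funX/measurable_funB.
have a0 k x : D x -> (0 <= a k x)%E by move=> _; rewrite lee_fin sqr_ge0.
have intS : mu.-integrable D (fun x => \sum_(k <oo) a k x)%E.
  apply/integrableP; split; first exact: emeasurable_nneseries.
  rewrite (eq_integral (fun x => \sum_(k <oo) a k x)%E); last first.
    by move=> x /[!inE] Dx; rewrite gee0_abs //; apply: nneseries_ge0 => *; exact: a0.
  rewrite integral_nneseries //.
  apply: (@le_lt_trans _ _ (\sum_(k <oo) (1 / (2 ^ k.+1)%:R)%:E)%E).
    apply: lee_nneseries => [k _ _|k _]; first exact: integral_ge0 (a0 k).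
    by rewrite (he (p k)).2 lee_fin.
  by apply: le_lt_trans (epsilon_trick0 _ ler01) _; exact: ltry.
have cvgae : {ae mu, forall x, D x -> (fun k => f_ (p k) x) @ \oo --> f x}.
  have := integrable_ae mD intS; apply: filterS => x h Dx.
  have r0 k : 0 <= (f_ (p k) x - f x) ^+ 2 by rewrite sqr_ge0.
  have := nneseries_fin_cvg0 r0 (h Dx) => sq0.
  apply/cvgrPdist_le => /= eps eps0; have e2 : 0 < eps ^+ 2 by rewrite exprn_gt0.
  have : \forall k \near \oo, (f_ (p k) x - f x) ^+ 2 < eps ^+ 2.
    exact: cvgr_lt sq0 _ e2.
  apply: filterS => k hk.
  rewrite distrC -(@ler_pXn2r _ 2) ?nnegrE // ?(ltW eps0) // -normrX ger0_norm ?sqr_ge0 //.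
  exact: ltW.
have mfk k : measurable_fun D (fun x => (f_ (p k) x ^+ n)%:E).
  by apply/measurable_EFinP/measurable_funX.
have p0 (r : R) : (0 <= (r ^+ n)%:E)%E by rewrite lee_fin exprn_even_ge0.
have bd : (limn_einf (fun k => \int[mu]_(x in D) (f_ (p k) x ^+ n)%:E) <= B%:E)%E.
  rewrite limn_einf_lim; apply: lime_le; first exact: is_cvg_einfs.
  apply: nearW => k; apply: le_trans (hB (p k)).
  by apply: ereal_inf_lbound; exists k => //=.
apply: le_trans bd; apply: le_trans (fatou mu mD mfk _) => //.
apply: ae_ge0_le_integral => //.
- exact/measurable_EFinP/measurable_funX.
- move=> x _; rewrite limn_einf_lim; apply: lime_ge; first exact: is_cvg_einfs.
  by apply: nearW => k; apply: le_ereal_inf_tmp => _ [j _ <-].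
- exact: measurable_fun_limn_einf.
- apply: filterS cvgae => x h Dx; have {}h := h Dx.
  have : (fun k => (f_ (p k) x ^+ n)%:E) @ \oo --> (f x ^+ n)%:E.
    apply: cvg_EFin; first by apply: nearW.
    by apply: (cvg_comp (fun k => f_ (p k) x) (fun z => z ^+ n)) h _; exact: exprn_continuous.
  by move=> hc; have := cvg_limn_einf_sup hc => -[-> _].
Qed.

End Lp.

(** * Moments of the normal law *)

Section density.
Context d (T : measurableType d) (R : realType).
Variables (mu nu : {measure set T -> \bar R}) (rho : T -> R).
Hypotheses (mrho : measurable_fun setT rho) (rho0 : forall x, 0 <= rho x).
Hypothesis nuE : forall A, measurable A -> nu A = (\int[mu]_(x in A) (rho x)%:E)%E.

Import HBNNSimple.

Lemma integral_density (f : T -> \bar R) : measurable_fun setT f ->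
  (forall x, 0 <= f x)%E -> (\int[nu]_x f x = \int[mu]_x (f x * (rho x)%:E))%E.
Proof.
move=> mf f0; pose h := nnsfun_approx measurableT mf.
have mg : measurable_fun setT (EFin \o rho) by exact/measurable_EFinP.
transitivity (limn (fun n => \int[nu]_x (EFin \o h n) x)%E).
  rewrite -monotone_convergence //.
  - by apply: eq_integral => x _; apply/esym/cvg_lim => //; exact: cvg_nnsfun_approx.
  - by move=> n; apply/measurable_EFinP.
  - by move=> n x Ex //=; rewrite lee_fin.
  - by move=> x Ex a b ab; rewrite lee_fin; exact/lefP/nd_nnsfun_approx.
transitivity (limn (fun n => \int[mu]_x ((EFin \o h n) x * (rho x)%:E))%E); last first.
  rewrite -monotone_convergence //.
  - apply: eq_integral => x _; apply/cvg_lim => //; apply: cvgeZr => //.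
    exact: cvg_nnsfun_approx.
  - by move=> n; apply: emeasurable_funM => //; exact/measurable_EFinP.
  - by move=> n x Ex //=; rewrite mule_ge0 ?lee_fin.
  - by move=> x Ex a b ab /=; rewrite lee_wpmul2r ?lee_fin//; exact/lefP/nd_nnsfun_approx.
congr (limn _); apply/funext => n.
have indich m r : measurable_fun setT (fun x => (r * \1_(h m @^-1` [set r]) x)%:E).
  by apply/measurable_EFinP; exact: measurable_funM.
transitivity (\int[nu]_x
   (\sum_(y \in range (h n)) (y * \1_(h n @^-1` [set y]) x)%:E))%E.
  by apply: eq_integral => t tE; rewrite /= fimfunE -fsumEFin.
rewrite ge0_integral_fsum//; last by move=> m y Ey; exact: nnfun_muleindic_ge0.
transitivity (\int[mu]_x (\sum_(y \in range (h n))
    (y * \1_(h n @^-1` [set y]) x)%:E * (rho x)%:E))%E; last first.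
  apply: eq_integral => x _ /=.
  rewrite [in RHS]fimfunE -fsumEFin // ge0_mule_fsuml // => y.
  exact: nnfun_muleindic_ge0.
rewrite ge0_integral_fsum//; last 2 first.
  - by move=> y; apply: emeasurable_funM.
  - by move=> m y Ey; rewrite mule_ge0 ?lee_fin ?rho0// -lee_fin nnfun_muleindic_ge0.
apply: eq_fsbigr => r rhn.
under eq_integral do rewrite EFinM.
rewrite integralZl_indic_nnsfun => //.
under [RHS]eq_integral do rewrite EFinM -muleA.
rewrite ge0_integralZl//.
- congr (_ * _)%E; rewrite integral_indic// setIT nuE //.
  rewrite integral_mkcond; apply: eq_integral => x _.
  by rewrite patchE indicE; case: ifP => _; rewrite ?mul1e ?mul0e.
- by apply: emeasurable_funM => //; apply/measurable_EFinP.
- by move=> y _; rewrite mule_ge0 ?lee_fin.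
- by move: rhn; rewrite inE => -[t _ <-]; rewrite lee_fin.
Qed.

End density.

Section FTC.
Context (R : realType).
Implicit Types (F f : R -> R) (a b : R).

Lemma FTC_is_derive F f a b : a < b ->
  (forall x, a <= x <= b -> is_derive x 1 F (f x)) ->
  {within `[a, b], continuous f} ->
  (\int[lebesgue_measure]_(x in `[a, b]) (f x)%:E)%E = (F b - F a)%:E.
Proof.
move=> ab dF cf; rewrite EFinB; apply: continuous_FTC2 => //.
- have cF x : a <= x <= b -> {for x, continuous F}.
    by move=> /dF [h _]; apply/differentiable_continuous/derivable1_diffP.
  split.
  + by move=> x; rewrite in_itv /= => /andP[ax xb]; have [] := dF x; rewrite ?(ltW ax) ?ltW.
  + by apply: cvg_at_right_filter; apply: cF; rewrite lexx ltW.
  + by apply: cvg_at_left_filter; apply: cF; rewrite lexx ltW.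
- move=> x; rewrite in_itv /= => /andP[ax xb].
  by rewrite derive1E; have [] := dF x; rewrite ?(ltW ax) ?ltW.
Qed.

End FTC.

Section normal_moments.
Context (R : realType) (s : R).
Hypothesis s0 : s != 0.
Local Notation g := (normal_pdf (0 : R) s).
Local Notation mu := (@lebesgue_measure R).

Lemma is_derive_normal_pdf (x : R) : is_derive x 1 g (- (x / s ^+ 2) * g x).
Proof.
have -> : g = cst (normal_peak s) * (expR \o (cst (- (s ^+ 2 *+ 2)^-1) * id ^+ 2)).
  rewrite normal_pdfE //; apply/funext => y; rewrite /normal_fun !fctE /= subr0.
  by congr (_ * expR _); rewrite mulrC mulNr mulrN mulrC.
apply: is_derive_eq; rewrite !fctE /=.
have scE (a b : R) : a *: (b : R^o) = a * b by [].
rewrite !scaler0 !addr0 !scE expr1 mulr1 -[_ *+ 2]mulr_natr.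
by set e := expR _; field; rewrite s0.
Qed.

Lemma continuous_normal_pow k : continuous (fun x : R => x ^+ k * g x).
Proof.
move=> x; apply: cvgM; first exact: exprn_continuous.
exact: continuous_normal_pdf.
Qed.

(** Polynomial decay of all orders, from [e^{-y} <= (k / y)^k]. *)
Lemma normal_pdf_pow_cvg0 k : (fun M : nat => M%:R ^+ k * g M%:R) @ \oo --> (0 : R).
Proof.
pose C := normal_peak s * (s ^+ 2 *+ 2 * k.+1%:R) ^+ k.+1.
have s2 : 0 < s ^+ 2 *+ 2 by rewrite mulrn_wgt0 // exprn_even_gt0.
have C0 : 0 <= C by rewrite mulr_ge0 ?normal_peak_ge0 // exprn_ge0 // mulr_ge0 // ltW.
have h (M : nat) : 0 <= M.+1%:R ^+ k * g M.+1%:R <= C * M.+1%:R^-1.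
  have M0 : 0 < M.+1%:R :> R by rewrite ltr0n.
  rewrite mulr_ge0 ?normal_pdf_ge0 ?exprn_ge0 //=.
  rewrite normal_pdfE // /normal_fun subr0 mulNr expRN /C.
  set m := M.+1%:R in M0 *; set c := s ^+ 2 *+ 2 in s2 *.
  have k0 : 0 < k.+1%:R :> R by rewrite ltr0n.
  have e1 : (m ^+ 2 / (c * k.+1%:R)) ^+ k.+1 <= expR (m ^+ 2 / c).
    rewrite -[X in _ <= expR X](_ : (m ^+ 2 / (c * k.+1%:R)) * k.+1%:R = _); last first.
      by rewrite invfM mulrA mulrVK // unitfE gt_eqF.
    rewrite expRM_natr lerXn2r ?nnegrE ?expR_ge0 //.
      by rewrite divr_ge0 // ?sqr_ge0 // mulr_ge0 // ltW.
    by apply: le_trans (expR_ge1Dx _); rewrite lerDr.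
  have p0 : 0 < (m ^+ 2 / (c * k.+1%:R)) ^+ k.+1.
    by rewrite exprn_gt0 // divr_gt0 ?mulr_gt0 // exprn_gt0.
  have e2 : (expR (m ^+ 2 / c))^-1 <= ((m ^+ 2 / (c * k.+1%:R)) ^+ k.+1)^-1.
    by rewrite lef_pV2 ?posrE ?expR_gt0.
  have m1 : 1 <= m by rewrite ler1n.
  apply: (@le_trans _ _ (m ^+ k * (normal_peak s * ((m ^+ 2 / (c * k.+1%:R)) ^+ k.+1)^-1))).
    by rewrite ler_wpM2l ?exprn_ge0 ?(ltW M0) // ler_wpM2l ?normal_peak_ge0.
  rewrite -exprVn invf_div expr_div_n -exprM mul2n -addnn exprD.
  rewrite [m ^+ k.+1]exprS; have mk : m ^+ k != 0 by rewrite expf_neq0 ?gt_eqF.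
  have -> : m ^+ k * (normal_peak s * ((c * k.+1%:R) ^+ k.+1 / (m * m ^+ k * (m * m ^+ k)))) =
      normal_peak s * (c * k.+1%:R) ^+ k.+1 / m * (m * m ^+ k)^-1.
    by field; rewrite mk gt_eqF.
  rewrite ler_piMr //.
    rewrite !mulr_ge0 ?normal_peak_ge0 ?invr_ge0 ?(ltW M0) // exprn_ge0 //.
    by rewrite mulr_ge0 // ltW.
  by rewrite -exprS invf_le1 ?exprn_gt0 // exprn_ege1.
rewrite -cvg_shiftS /=.
apply: (@squeeze_cvgr _ _ _ _ (fun=> 0) (fun M : nat => C * M.+1%:R^-1)).
- by apply: nearW => M; exact: h.
- exact: cvg_cst.
- rewrite -[X in _ --> X](mulr0 C); apply: cvgM; first exact: cvg_cst.
  exact: cvg_harmonic.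
Qed.

(** Integration by parts on [[- M, M]], whose boundary terms vanish as [M]
    grows. *)
Lemma normal_moment_step n v : ~~ odd n ->
  has_int mu setT (fun x => x ^+ n * g x) v ->
  has_int mu setT (fun x => x ^+ n.+2 * g x) (s ^+ 2 * n.+1%:R * v).
Proof.
move=> en hv.
have mk k (A : set R) : measurable_fun A (fun x => (x ^+ k * g x)%:E).
  apply/measurable_EFinP/measurable_funTS/measurable_funM => //.
  exact: measurable_normal_pdf.
have en2 : ~~ odd n.+2 by rewrite /= negbK.
have pos k (x : R) : ~~ odd k -> (0 <= (x ^+ k * g x)%:E)%E.
  by move=> ek; rewrite lee_fin mulr_ge0 ?normal_pdf_ge0 // exprn_even_ge0.
pose I (M : nat) : set R := `[- M%:R, M%:R]%classic.
have UI : \bigcup_M I M = setT.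
  apply/seteqP; split=> // x _; exists (Num.bound x) => //=.
  rewrite /I /= in_itv /=; have := ltW (archi_boundP (normr_ge0 x)).
  have -> : Num.bound `|x| = Num.bound x by rewrite /Num.bound normr_id.
  by rewrite ler_norml.
have ndI : nondecreasing_seq I.
  move=> M N MN; apply/subsetPset => x /=; rewrite /I /= !in_itv /= => /andP[h1 h2].
  have : M%:R <= N%:R :> R by rewrite ler_nat.
  by move=> h; apply/andP; split; lra.
have lim k : ~~ odd k -> (fun M => \int[mu]_(x in I M) (x ^+ k * g x)%:E)%E @ \oo
    --> (\int[mu]_x (x ^+ k * g x)%:E)%E.
  move=> ek; rewrite -UI; apply: ge0_nondecreasing_set_cvg_integral => //.
  - by move=> i; exact: measurable_itv.
  - by move=> i; exact: mk.
  - by move=> i x _; exact: pos.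
have step M : (0 < M)%N -> (\int[mu]_(x in I M) (x ^+ n.+2 * g x)%:E =
    (s ^+ 2 * n.+1%:R)%:E * \int[mu]_(x in I M) (x ^+ n * g x)%:E
     - (2 * s ^+ 2 * (M%:R ^+ n.+1 * g M%:R))%:E)%E.
  move=> M0.
  have cI k : exists w, has_int mu (I M) (fun x => x ^+ k * g x) w.
    apply: integrable_has_int; first exact: measurable_itv.
    apply: continuous_compact_integrable.
      exact: segment_compact.
    exact/continuous_subspaceT/continuous_normal_pow.
  have [wn [i1 h1]] := cI n; have [w2 [i2 h2]] := cI n.+2.
  pose f (x : R) := n.+1%:R * (x ^+ n * g x) - (s ^+ 2)^-1 * (x ^+ n.+2 * g x).
  have hf : has_int mu (I M) f (n.+1%:R * wn - (s ^+ 2)^-1 * w2).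
    by apply: has_intB; rewrite ?/I //; apply: has_intZ; rewrite ?/I.
  have [_ hf2] := hf.
  have : (\int[mu]_(x in I M) (f x)%:E)%E =
      (M%:R ^+ n.+1 * g M%:R - (- M%:R) ^+ n.+1 * g (- M%:R))%:E.
    apply: (@FTC_is_derive R (fun x => x ^+ n.+1 * g x)).
    - have : 0 < M%:R :> R by rewrite ltr0n.
      lra.
    - move=> x _; have := is_derive_normal_pdf x => dg.
      have -> : (fun x => x ^+ n.+1 * g x) = (id ^+ n.+1 : R -> R) * g by apply/funext => y; rewrite !fctE.
      apply: is_derive_eq.
      have scE (a b : R) : a *: (b : R^o) = a * b by [].
      rewrite !scE mulr1 !fctE /= /f [x ^+ n.+2]exprS.
      by ring.
    - apply: continuous_subspaceT => x; apply: cvgB; apply: cvgM;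
        try exact: cvg_cst; exact: continuous_normal_pow.
  rewrite hf2 => -[]; rewrite exprNn -signr_odd /= en expr1.
  have -> : g (- M%:R) = g M%:R.
    by rewrite normal_pdfE // /normal_fun !subr0 sqrrN.
  move=> e; rewrite h1 h2 -EFinM -EFinB; congr EFin.
  have -> : w2 = s ^+ 2 * ((s ^+ 2)^-1 * w2) by rewrite mulVKf // expf_neq0.
  have -> : (s ^+ 2)^-1 * w2 = n.+1%:R * wn - 2 * (M%:R ^+ n.+1 * g M%:R) by lra.
  by ring.
have [_ hv2] := hv.
apply: ge0_has_int => //.
- by apply/measurable_EFinP; exact: mk.
- by move=> x _; rewrite -lee_fin; exact: pos.
apply: (cvg_unique _ (lim _ en2)) => //.
have : (fun M => (s ^+ 2 * n.+1%:R)%:E * \int[mu]_(x in I M) (x ^+ n * g x)%:E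
     - (2 * s ^+ 2 * (M%:R ^+ n.+1 * g M%:R))%:E)%E @ \oo -->
    ((s ^+ 2 * n.+1%:R)%:E * v%:E - (2 * s ^+ 2 * 0)%:E)%E.
  apply: cvgeB => //.
  - by apply: cvgeZl => //; rewrite -hv2; exact: lim.
  - apply: cvg_EFin; first by apply: nearW.
    by apply: cvgM; [exact: cvg_cst|exact: normal_pdf_pow_cvg0].
rewrite mulr0 sube0 -EFinM; apply: cvg_trans; apply: near_eq_cvg.
near=> M; rewrite step //; near: M.
by exists 1%N.
Unshelve. all: by end_near. Qed.

Lemma normal_moments :
  [/\ has_int mu setT (fun x => x ^+ 2 * g x) (s ^+ 2),
     has_int mu setT (fun x => x ^+ 4 * g x) (3 * s ^+ 4)
   & has_int mu setT (fun x => x ^+ 8 * g x) (105 * s ^+ 8)].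
Proof.
have h0 : has_int mu setT (fun x => x ^+ 0 * g x) 1.
  rewrite (_ : (fun x => _) = g); last by apply/funext => x; rewrite expr0 mul1r.
  by split; [exact: integrable_normal_pdf|exact: integral_normal_pdf].
have h2 := normal_moment_step (n := 0) isT h0.
have h4 := normal_moment_step (n := 2) isT h2.
have h6 := normal_moment_step (n := 4) isT h4.
have h8 := normal_moment_step (n := 6) isT h6.
have -> : 3 * s ^+ 4 = s ^+ 2 * 3%:R * (s ^+ 2 * 1%:R * 1) by ring.
have -> : 105 * s ^+ 8 = s ^+ 2 * 7%:R * (s ^+ 2 * 5%:R *
  (s ^+ 2 * 3%:R * (s ^+ 2 * 1%:R * 1))) by ring.
by split=> //; rewrite -[s ^+ 2]mulr1 -[s ^+ 2 * 1]mulr1.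
Qed.

End normal_moments.

(** * Moments of Wiener integrals *)

Section gaussian_moments.
Context d (Omega : measurableType d) (R : realType) (P : probability Omega R).

Definition gaussian_moments (Y : Omega -> R) (v : R) : Prop :=
  [/\ has_int P setT (fun w => Y w ^+ 2) v,
      has_int P setT (fun w => Y w ^+ 4) (3 * v ^+ 2)
    & has_int P setT (fun w => Y w ^+ 8) (105 * v ^+ 4)].

Lemma centered_gaussian_moments (Y : Omega -> R) : measurable_fun setT Y ->
  centered_gaussian P Y -> exists v, gaussian_moments Y v.
Proof.
move=> mY [s hs]; exists (s ^+ 2).
have law n : ~~ odd n -> (\int[P]_w (Y w ^+ n)%:E =
    \int[pushforward P (Y : Omega -> measurableTypeR R)]_x (x ^+ n)%:E)%E.
  move=> en; rewrite ge0_integral_pushforward //.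
    by apply/measurable_EFinP; exact: measurable_funX.
  by move=> y _; rewrite lee_fin exprn_even_ge0.
have mYn n : measurable_fun setT (fun w => Y w ^+ n) by exact: measurable_funX.
have h n v : ~~ odd n -> (\int[pushforward P (Y : Omega -> measurableTypeR R)]_x (x ^+ n)%:E = v%:E)%E ->
    has_int P setT (fun w => Y w ^+ n) v.
  move=> en hv; apply: ge0_has_int => //.
    by move=> w _; rewrite exprn_even_ge0.
  by rewrite law.
have mX n : measurable_fun [set: R] (fun x : R => (x ^+ n)%:E).
  by apply/measurable_EFinP; exact: measurable_funX.
have [s0|s0] := eqVneq s 0.
  have dir n : ~~ odd n -> (0 < n)%N -> has_int P setT (fun w => Y w ^+ n) 0.
    move=> en n0; apply: h => //; transitivity (\int[\d_(0%R : measurableTypeR R)]_x (x ^+ n)%:E)%E.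
      apply: eq_measure_integral => A mA _.
      by rewrite [LHS]hs // /centered_gaussian_law s0 eqxx.
    rewrite integral_dirac //; last exact: mX.
    by rewrite /dirac indicE in_setT mul1e expr0n gtn_eqF.
  by rewrite /gaussian_moments s0 !expr0n /= !mulr0; split; exact: dir.
have dens n v : ~~ odd n ->
    has_int (@lebesgue_measure R) setT (fun x => x ^+ n * normal_pdf 0 s x) v ->
    has_int P setT (fun w => Y w ^+ n) v.
  move=> en [_ hv]; apply: h => //; rewrite -hv.
  transitivity (\int[normal_prob 0 s]_x (x ^+ n)%:E)%E.
    apply: eq_measure_integral => A mA _.
    by rewrite [LHS]hs // /centered_gaussian_law (negbTE s0).
  rewrite (integral_density (nu := normal_prob 0 s) (mu := @lebesgue_measure R) (rho := normal_pdf 0 s)) //.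
  - exact: measurable_normal_pdf.
  - exact: normal_pdf_ge0.
  - exact: mX.
  - by move=> x; rewrite lee_fin exprn_even_ge0.
have [m2 m4 m8] := normal_moments s0; rewrite /gaussian_moments -!exprM.
by split; exact: dens.
Qed.

End gaussian_moments.

(** The Borel structure on [R * R] comes from two syntactically distinct
    structures on [R]; the identity map transfers integrals between them. *)
Lemma integral_lebesgue2 (R : realType) (D : set (R * R)) (f : R * R -> \bar R) :
  measurable D -> measurable_fun D f -> (forall z, D z -> 0 <= f z)%E ->
  (\int[@lebesgue2 R]_(z in D) f z =
   \int[(@lebesgue_measure R \x @lebesgue_measure R)%E]_(z in D) f z)%E.
Proof.
move=> mD mf f0.
pose j (z : measurableTypeR R * measurableTypeR R) : R * R := z.
have mj : measurable_fun setT j by move=> _ A mA; rewrite setTI; exact: mA.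
by rewrite -[RHS](ge0_integral_pushforward mj) // => z /[!inE]; exact: f0.
Qed.

Section simple_pairs.
Context d (Omega : measurableType d) (R : realType) (P : probability Omega R).
Variables (T : R) (W : set (R * R) -> {RV P >-> R}).
Hypothesis hW : white_noise T W.
Local Notation RR := (measurableTypeR R).
Local Notation D := (spacetime T).
Local Notation lam := (product_measure1 (@lebesgue_measure R) (@lebesgue_measure R)).

Definition simple_pair (phi : R * R -> R) (Y : Omega -> R) : Prop :=
  exists (n : nat) (c : 'I_n -> R) (A : 'I_n -> set (R * R)),
    [/\ forall i, measurable (A i) /\ A i `<=` D,
        phi = (fun z => \sum_(i < n) c i * \1_(A i) z)
      & Y = (fun w => \sum_(i < n) c i * W (A i) w)].

Lemma measurable_spacetime : @measurable _ (RR * RR)%type D.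
Proof. by apply: measurableX; exact: measurable_itv. Qed.
Local Notation mD := measurable_spacetime.

Lemma simple_pair_measurable phi Y : simple_pair phi Y ->
  measurable_fun setT phi /\ measurable_fun setT Y.
Proof.
move=> [n [c [A [hA -> ->]]]]; split.
  apply: measurable_sum => i; apply: measurable_funM => //.
  by apply: measurable_indic; have [] := hA i.
by apply: measurable_sum => i; apply: measurable_funM.
Qed.

Lemma simple_pair_lin a b phi Y psi Z : simple_pair phi Y -> simple_pair psi Z ->
  simple_pair (fun z => a * phi z + b * psi z) (fun w => a * Y w + b * Z w).
Proof.
move=> [n [c [A [hA -> ->]]]] [m [e [B [hB -> ->]]]].
exists (n + m)%N.
exists (fun k : 'I_(n + m) => match fintype.split k with inl i => a * c i | inr j => b * e j end).
exists (fun k : 'I_(n + m) => match fintype.split k with inl i => A i | inr j => B j end).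
split.
- by move=> k; case: (fintype.split k) => i; [exact: hA|exact: hB].
- apply/funext => z; rewrite big_split_ord /= !mulr_sumr; congr (_ + _); apply: eq_bigr => i _.
    by have := unsplitK (inl i : 'I_n + 'I_m) => /= ->; rewrite mulrA.
  by have := unsplitK (inr i : 'I_n + 'I_m) => /= ->; rewrite mulrA.
- apply/funext => z; rewrite big_split_ord /= !mulr_sumr; congr (_ + _); apply: eq_bigr => i _.
    by have := unsplitK (inl i : 'I_n + 'I_m) => /= ->; rewrite mulrA.
  by have := unsplitK (inr i : 'I_n + 'I_m) => /= ->; rewrite mulrA.
Qed.

Lemma lebesgue2_spacetime_lty : (lam D < +oo)%E.
Proof.
rewrite product_measure1E; [|exact: measurable_itv|exact: measurable_itv].
rewrite /= /torus !lebesgue_measure_itv /=.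
by do 2!case: ifP => _; rewrite ?mule0 ?mul0e ?ltry // -!EFinB -EFinM ltry.
Qed.

(** The Gaussian law of [W A] provides the integrability, which the prescribed
    value of the covariance does not. *)
Lemma simple_noise_isometry A B : measurable A -> A `<=` D -> measurable B -> B `<=` D ->
  exists q, has_int P setT (fun w => W A w * W B w) q /\
            has_int lam D (fun z => \1_A z * \1_B z) q.
Proof.
move=> mA AD mB BD.
have fAB : lam (A `&` B) \is a fin_num.
  rewrite ge0_fin_numE // (le_lt_trans _ lebesgue2_spacetime_lty) //.
  by apply: le_measure; rewrite ?inE //; [exact: measurableI|exact: mD|move=> z [/AD]].
have one C : measurable C -> C `<=` D -> exists v, has_int P setT (fun w => W C w ^+ 2) v.
  move=> mC CD; have [||v [h _ _]] := @centered_gaussian_moments _ _ _ P (W C).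
  - exact: measurable_funPT.
  - have [hg _] := hW; have := hg 1%N (fun=> 1) (fun=> C) (fun=> conj mC CD).
    by congr centered_gaussian; apply/funext => w; rewrite big_ord1 mul1r.
  - by exists v.
have [a ha] := one A mA AD; have [b hb] := one B mB BD.
exists (fine (lam (A `&` B))); split.
  have mWW : measurable_fun setT (fun w => W A w * W B w) by exact: measurable_funM.
  have [|v [hv _]] := has_int_dom measurableT mWW _ (has_intD measurableT ha hb).
    move=> w _; rewrite normrM -[W A w ^+ 2]real_normK ?num_real // -[W B w ^+ 2]real_normK ?num_real //.
    have := normr_ge0 (W A w); have := normr_ge0 (W B w).
    move: `|W A w| `|W B w| => x y; nra.
  suff <- : v = fine (lam (A `&` B)) by [].
  have [_ hc] := hW; have := hc A B mA AD mB BD; rewrite unlock.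
  by have [_ ->] := hv; move=> /(congr1 fine).
apply: ge0_has_int.
- by apply: measurable_funTS; apply: measurable_funM; apply: measurable_indic.
- by move=> z _; rewrite mulr_ge0.
rewrite fineK // (eq_integral (fun z : RR * RR => (\1_(A `&` B) z)%:E)); last first.
  by move=> z _; rewrite indicI.
rewrite integral_indic //; [|exact: mD|exact: measurableI].
by congr (lam _); apply/setIidl => z [/AD].
Qed.

Lemma simple_pair_moments phi Y : simple_pair phi Y ->
  exists v, gaussian_moments P Y v /\ has_int lam D (fun z => phi z ^+ 2) v.
Proof.
move=> hs; have [_ mY] := simple_pair_measurable hs.
have [n [c [A [hA ephi eY]]]] := hs.
have [|v hv] := centered_gaussian_moments mY (P := P).
  by rewrite eY; have [hg _] := hW; exact: hg.
exists v; split=> //.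
have /choice[q hq] : forall ij : 'I_n * 'I_n, exists q,
    has_int P setT (fun w => W (A ij.1) w * W (A ij.2) w) q /\
    has_int lam D (fun z => \1_(A ij.1) z * \1_(A ij.2) z) q.
  move=> [i j] /=; have [mi si] := hA i; have [mj sj] := hA j.
  exact: simple_noise_isometry.
have sq (x : 'I_n -> R) : (\sum_(i < n) c i * x i) ^+ 2 =
    \sum_(i < n) \sum_(j < n) (c i * c j) * (x i * x j).
  rewrite expr2 big_distrlr /=; apply: eq_bigr => i _; apply: eq_bigr => j _; ring.
have hP : has_int P setT (fun w => Y w ^+ 2)
    (\sum_(i < n) \sum_(j < n) (c i * c j) * q (i, j)).
  rewrite eY; under eq_fun do rewrite sq.
  apply: has_int_sum => // i; apply: has_int_sum => // j; apply: has_intZ => //.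
  exact: (hq (i, j)).1.
have [h2 _ _] := hv; rewrite (has_int_uniq h2 hP) ephi.
under eq_fun do rewrite sq.
apply: has_int_sum => [|i]; first exact: mD.
apply: has_int_sum => [|j]; first exact: mD.
by apply: has_intZ; [exact: mD|exact: (hq (i, j)).2].
Qed.

(** The notion of [wiener_integral] with finite real errors, in a form that is
    closed under linear combinations. *)
Definition wint (h : R * R -> R) (X : Omega -> R) : Prop :=
  [/\ measurable_fun D h, measurable_fun setT X &
  exists (phi : nat -> R * R -> R) (Y : nat -> Omega -> R) (e e' : nat -> R),
    [/\ forall m, simple_pair (phi m) (Y m),
        forall m, has_int lam D (fun z => (h z - phi m z) ^+ 2) (e m),
        forall m, has_int P setT (fun w => (X w - Y m w) ^+ 2) (e' m),
        e @ \oo --> (0 : R) & e' @ \oo --> (0 : R)]].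

Lemma cvge0_shift_fin (a : nat -> \bar R) : a @ \oo --> (0 : \bar R)%E ->
  exists N, (forall m, a (m + N)%N \is a fin_num) /\
    (fun m => fine (a (m + N)%N)) @ \oo --> (0 : R).
Proof.
move=> /fine_cvgP[[N _ hN] hc]; exists N; split.
  by move=> m; apply: hN => /=; rewrite leq_addl.
by have := hc; rewrite -(cvg_shiftn N).
Qed.

Lemma wiener_integral_wint (h : R * R -> R) (X : {RV P >-> R}) :
  wiener_integral T W h X -> wint h X.
Proof.
move=> [mh [n [c [A [hA hh hX]]]]].
pose phi m (z : R * R) := \sum_(i < n m) c m i * \1_(A m i) z.
pose Y m w := \sum_(i < n m) c m i * W (A m i) w.
have hs m : simple_pair (phi m) (Y m).
  exists (n m), (fun i : 'I_(n m) => c m i), (fun i : 'I_(n m) => A m i).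
  by split=> // i; exact: hA.
have mX : measurable_fun setT X by exact: measurable_funPT.
split=> //.
have E1 N1 N2 m : (m + (N1 + N2) = m + N2 + N1)%N by lia.
have E2 N1 N2 m : (m + (N1 + N2) = m + N1 + N2)%N by lia.
have [N1 [fin1 cv1]] := cvge0_shift_fin hh.
have [N2 [fin2 cv2]] := cvge0_shift_fin hX.
exists (fun m => phi (m + (N1 + N2))%N), (fun m => Y (m + (N1 + N2))%N).
exists (fun m => fine (\int[@lebesgue2 R]_(z in D) ((h z - phi (m + (N1 + N2))%N z) ^+ 2)%:E)%E).
exists (fun m => fine ('E_P[fun w => ((X w - Y (m + (N1 + N2))%N w) ^+ 2)%R])%E).
split.
- by move=> m; exact: hs.
- move=> m.
  have mf : measurable_fun D (fun z => (h z - phi (m + (N1 + N2))%N z) ^+ 2).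
    apply: measurable_funX; apply: measurable_funB => //.
    by apply: measurable_funTS; exact: (simple_pair_measurable (hs _)).1.
  apply: ge0_has_int => //.
  + by move=> z _; rewrite sqr_ge0.
  + rewrite fineK ?E1; last exact: fin1.
    rewrite integral_lebesgue2 //; first exact: mD.
    * by apply/measurable_EFinP; rewrite -E1.
    * by move=> z _; rewrite lee_fin sqr_ge0.
- move=> m; apply: ge0_has_int.
  + apply: measurable_funX; apply: measurable_funB => //.
    exact: (simple_pair_measurable (hs _)).2.
  + by move=> z _; rewrite sqr_ge0.
  + by rewrite fineK; [rewrite unlock|rewrite E2; exact: fin2].
- have := cv1; rewrite -(cvg_shiftn N2) /=; apply: cvg_trans.
  by apply: near_eq_cvg; apply: nearW => m; rewrite E1.
- have := cv2; rewrite -(cvg_shiftn N1) /=; apply: cvg_trans.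
  by apply: near_eq_cvg; apply: nearW => m; rewrite E2.
Qed.

Lemma sqr_lin_le (a b x y : R) : (a * x + b * y) ^+ 2 <= 2 * a ^+ 2 * x ^+ 2 + 2 * b ^+ 2 * y ^+ 2.
Proof. by have := sqr_ge0 (a * x - b * y); nra. Qed.

Lemma wint_lin a b h X k Z : wint h X -> wint k Z ->
  wint (fun z => a * h z + b * k z) (fun w => a * X w + b * Z w).
Proof.
move=> [mh mX [phi [Y [e1 [e1' [s1 i1 i1' c1 c1']]]]]].
move=> [mk mZ [psi [V [e2 [e2' [s2 i2 i2' c2 c2']]]]]].
split.
- by apply: measurable_funD; apply: measurable_funM.
- by apply: measurable_funD; apply: measurable_funM.
have sm m := simple_pair_lin a b (s1 m) (s2 m).
have bound (x y u v : R) : `|(a * x + b * y - (a * u + b * v)) ^+ 2| <=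
    2 * a ^+ 2 * (x - u) ^+ 2 + 2 * b ^+ 2 * (y - v) ^+ 2.
  rewrite ger0_norm ?sqr_ge0 //.
  have -> : a * x + b * y - (a * u + b * v) = a * (x - u) + b * (y - v) by ring.
  exact: sqr_lin_le.
have ex m : exists f, has_int lam D (fun z => (a * h z + b * k z - (a * phi m z + b * psi m z)) ^+ 2) f
    /\ `|f| <= 2 * a ^+ 2 * e1 m + 2 * b ^+ 2 * e2 m.
  apply: (@has_int_dom _ _ R lam D mD _ (fun z => 2 * a ^+ 2 * (h z - phi m z) ^+ 2 +
    2 * b ^+ 2 * (k z - psi m z) ^+ 2)).
  - apply: measurable_funX; apply: measurable_funB.
      by apply: measurable_funD; apply: measurable_funM.
    by apply: measurable_funTS; exact: (simple_pair_measurable (sm m)).1.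
  - by move=> z _; exact: bound.
  - by apply: has_intD; [exact: mD|apply: has_intZ; [exact: mD|exact: i1]|
      apply: has_intZ; [exact: mD|exact: i2]].
have ex' m : exists f, has_int P setT (fun w => (a * X w + b * Z w - (a * Y m w + b * V m w)) ^+ 2) f
    /\ `|f| <= 2 * a ^+ 2 * e1' m + 2 * b ^+ 2 * e2' m.
  apply: (@has_int_dom _ _ R P setT measurableT _ (fun w => 2 * a ^+ 2 * (X w - Y m w) ^+ 2 +
    2 * b ^+ 2 * (Z w - V m w) ^+ 2)) => //.
  - apply: measurable_funX; apply: measurable_funB.
      by apply: measurable_funD; apply: measurable_funM.
    exact: (simple_pair_measurable (sm m)).2.
  - by apply: has_intD => //; apply: has_intZ.
have /choice[f hf] := ex; have /choice[f' hf'] := ex'.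
have cvg0 (p q r : nat -> R) : p @ \oo --> (0 : R) -> q @ \oo --> (0 : R) ->
    (forall m, `|r m| <= 2 * a ^+ 2 * p m + 2 * b ^+ 2 * q m) -> r @ \oo --> (0 : R).
  move=> cp cq hr; apply/norm_cvg0P; apply: (@squeeze_cvgr _ _ _ _ (fun=> 0)
     (fun m => 2 * a ^+ 2 * p m + 2 * b ^+ 2 * q m)).
  - by apply: nearW => m; rewrite normr_ge0 hr.
  - exact: cvg_cst.
  - rewrite -[X in _ --> X](_ : 2 * a ^+ 2 * 0 + 2 * b ^+ 2 * 0 = 0); last by ring.
    by apply: cvgD; apply: cvgM => //; exact: cvg_cst.
exists (fun m z => a * phi m z + b * psi m z), (fun m w => a * Y m w + b * V m w), f, f'.
split=> //.
- by move=> m; exact: (hf m).1.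
- by move=> m; exact: (hf' m).1.
- by apply: (cvg0 _ _ _ c1 c2) => m; exact: (hf m).2.
- by apply: (cvg0 _ _ _ c1' c2') => m; exact: (hf' m).2.
Qed.

(** Gaussian moments survive [L^2] limits: the differences of the approximants
    are Gaussian, so that they are small in every [L^n] as soon as they are small
    in [L^2]. *)
Lemma wint_even_moment (n p : nat) (c : R) h X (v : R) :
  ~~ odd n -> (0 < p)%N -> 0 <= c ->
  (forall Y v', gaussian_moments P Y v' -> has_int P setT (fun w => Y w ^+ n) (c * v' ^+ p)) ->
  wint h X -> has_int P setT (fun w => X w ^+ 2) v ->
  has_int P setT (fun w => X w ^+ n) (c * v ^+ p).
Proof.
move=> en p0 c0 hn [mh mX [phi [Y [e [e' [hs he he' ce ce']]]]]] hv.
have mY m : measurable_fun setT (Y m) := (simple_pair_measurable (hs m)).2.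
have /choice[u hu] : forall m, exists v, gaussian_moments P (Y m) v.
  by move=> m; have [v' [hv' _]] := simple_pair_moments (hs m); exists v'.
have cu : u @ \oo --> v.
  have [|v2 [hv2 cv2]] := Lp_limit measurableT (isT : ~~ odd 2) mX _ he' ce' (L_ := u).
    by move=> m; have [] := hu m.
  by rewrite (has_int_uniq hv hv2).
have e'0 m : 0 <= e' m by apply: (has_int_ge0 measurableT) (he' m) => w _; exact: sqr_ge0.
(* [Y k - Y m] has variance at most [2 * e' k + 2 * e' m], and [e' k] is
   eventually below [e' m + 1 / (m + 1)]; the second term makes room for
   [e' m = 0]. *)
pose B m := c * (4 * e' m + 2 * m.+1%:R^-1) ^+ p.
have cB : B @ \oo --> (0 : R).
  have -> : 0 = c * (4 * 0 + 2 * 0) ^+ p :> R by rewrite !mulr0 addr0 expr0n gtn_eqF // mulr0.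
  apply: cvgM; first exact: cvg_cst.
  apply: (cvg_comp (fun m => 4 * e' m + 2 * m.+1%:R^-1) (fun x => x ^+ p)); last exact: exprn_continuous.
  apply: cvgD; apply: cvgM; try exact: cvg_cst; [exact: ce'|exact: cvg_harmonic].
have /choice[g hg] : forall m, exists g, has_int P setT (fun w => (X w - Y m w) ^+ n) g /\
    0 <= g <= B m.
  move=> m; apply: ge0_has_int_ub => //.
  - by apply: measurable_funX; exact: measurable_funB.
  - by move=> w _; rewrite exprn_even_ge0.
  have B0 : 0 <= 4 * e' m + 2 * m.+1%:R^-1.
    by apply: addr_ge0; apply: mulr_ge0; rewrite ?invr_ge0.
  have ltm : 0 < e' m + m.+1%:R^-1 by rewrite ltr_wpDl // invr_gt0 ltr0n.
  have [K _ hK] := cvgr_lt _ ce' _ ltm.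
  apply: (fatou_L2 measurableT (f_ := fun k w => Y (k + K)%N w - Y m w) (e_ := fun k => e' (k + K)%N)) => //.
  - exact: measurable_funB.
  - by move=> k; exact: measurable_funB.
  - move=> k; apply: (has_int_eq measurableT) (he' (k + K)%N) => w _; ring.
  - by rewrite (cvg_shiftn K).
  move=> k; have [v' [hv' _]] := simple_pair_moments (simple_pair_lin 1 (-1) (hs (k + K)%N) (hs m)).
  have [h2 _ _] := hv'.
  have v'0 : 0 <= v' by apply: (has_int_ge0 measurableT) h2 => w _; exact: sqr_ge0.
  have v'le : v' <= 2 * e' (k + K)%N + 2 * e' m.
    apply: (has_int_le measurableT) h2 (has_intD measurableT (has_intZ measurableT 2 (he' (k + K)%N))
       (has_intZ measurableT 2 (he' m))) => w _.
    by have := sqr_ge0 ((X w - Y (k + K)%N w) + (X w - Y m w)); nra.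
  have [_] := hn _ _ hv'.
  rewrite (eq_integral (fun w => ((Y (k + K)%N w - Y m w) ^+ n)%:E)); last first.
    by move=> w _; rewrite mul1r mulN1r.
  move=> ->; rewrite lee_fin /B; apply: ler_wpM2l; first exact: c0.
  apply: lerXn2r; rewrite ?nnegrE; [exact: v'0|exact: B0|].
  have : e' (k + K)%N < e' m + m.+1%:R^-1 by apply: hK => /=; rewrite leq_addl.
  by move: v'le; move: (m.+1%:R^-1) => q; lra.
have cg : g @ \oo --> (0 : R).
  apply: (@squeeze_cvgr _ _ _ _ (fun=> 0) B) => //; last exact: cvg_cst.
  by apply: nearW => m; have [] := hg m.
have hY m : has_int P setT (fun w => Y m w ^+ n) (c * u m ^+ p) := hn _ _ (hu m).
have hXY m : has_int P setT (fun w => (X w - Y m w) ^+ n) (g m) := (hg m).1.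
have [L [hL cL]] := Lp_limit measurableT en mX hY hXY cg.
suff <- : L = c * v ^+ p by [].
apply: (cvg_unique _ cL) => //; apply: cvgM; first exact: cvg_cst.
by apply: (cvg_comp u (fun x => x ^+ p)) cu _; exact: exprn_continuous.
Qed.

Lemma wint_moments h X : wint h X ->
  exists v, has_int lam D (fun z => h z ^+ 2) v /\ gaussian_moments P X v.
Proof.
move=> hw; have [mh mX [phi [Y [e [e' [hs he he' ce ce']]]]]] := hw.
have /choice[u hu] : forall m, exists v,
    gaussian_moments P (Y m) v /\ has_int lam D (fun z => phi m z ^+ 2) v.
  by move=> m; exact: simple_pair_moments (hs m).
have [|v [hv cv]] := Lp_limit mD (isT : ~~ odd 2) mh _ he ce (L_ := u).
  by move=> m; have [] := hu m.
have [|v2 [hv2 cv2]] := Lp_limit measurableT (isT : ~~ odd 2) mX _ he' ce' (L_ := u).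
  by move=> m; have [[]] := hu m.
have vv : v2 = v by apply: (cvg_unique _ cv2 cv).
rewrite vv in hv2; exists v; split=> //; split=> //.
- by apply: wint_even_moment hw hv2 => // Z w [].
- by apply: wint_even_moment hw hv2 => // Z w [].
Qed.

(** The mixed fourth moment is the coefficient of [b ^+ 4] in the eighth moment
    of [X + b * Z]; it is extracted by evaluating at [b = 1, -1, 2, -2, 3, -3]. *)
Lemma wint_mixed_moment h X k Z a b q : wint h X -> wint k Z ->
  has_int lam D (fun z => h z ^+ 2) a -> has_int lam D (fun z => k z ^+ 2) b ->
  has_int lam D (fun z => h z * k z) q ->
  has_int P setT (fun w => X w ^+ 4 * Z w ^+ 4)
    (9 * a ^+ 2 * b ^+ 2 + 72 * (a * b) * q ^+ 2 + 24 * q ^+ 4).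
Proof.
move=> hX hZ ha hb hq.
have m8 s t : has_int P setT (fun w => (s * X w + t * Z w) ^+ 8)
    (105 * (s ^+ 2 * a + t ^+ 2 * b + 2 * s * t * q) ^+ 4).
  have [v [hv [_ _ h8]]] := wint_moments (wint_lin s t hX hZ).
  suff <- : v = s ^+ 2 * a + t ^+ 2 * b + 2 * s * t * q by [].
  apply: (has_int_uniq hv).
  apply: (has_int_eq mD) (has_intD mD (has_intD mD (has_intZ mD (s ^+ 2) ha)
    (has_intZ mD (t ^+ 2) hb)) (has_intZ mD (2 * s * t) hq)) => z _.
  by ring.
(* The sums over [t] and [- t] keep the even powers of [t].  The weights solve the
   linear system that cancels those of order 0, 2, 6 and 8, with
   [140 = 2 * 'C(8, 4)]. *)
pose S t := has_intD measurableT (m8 1 t) (m8 1 (- t)).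
have H := has_intD measurableT (has_intD measurableT
    (has_intD measurableT (has_intZ measurableT (- (39 / 72 / 140)) (S 1))
       (has_intZ measurableT (12 / 72 / 140) (S 2)))
    (has_intZ measurableT (- (1 / 72 / 140)) (S 3)))
  (has_intD measurableT (has_intZ measurableT (56 / 72 / 140) (m8 1 0))
    (has_intZ measurableT (98 / 140) (m8 0 1))).
have coerce_val f v v' : has_int P setT f v -> v = v' -> has_int P setT f v' by move=> ? <-.
apply: coerce_val; first by apply: (has_int_eq measurableT) H => w _; field.
by field.
Qed.

End simple_pairs.

(** * Unfolding integrals over the torus *)

Section real_measurability.
Context (R : realType).

Lemma measurable_inv : measurable_fun [set: R] (@GRing.inv R).
Proof.
have mN0 : measurable [set~ (0 : R)] by apply: measurableC; exact: measurable_set1.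
rewrite -(setvU [set (0 : R)]); apply/measurable_funU => //.
split; last first.
  apply: (eq_measurable_fun (cst (0 : R))).
    by move=> x; rewrite inE /= => ->; rewrite invr0.
  exact: measurable_cst.
apply: open_continuous_measurable_fun.
  by apply: closed_openC; exact: closed_eq.
by move=> x; rewrite inE /= => /eqP x0; exact: inv_continuous.
Qed.

Lemma measurable_sqrt : measurable_fun [set: R] (@Num.sqrt R).
Proof. by apply: continuous_measurable_fun; exact: sqrt_continuous. Qed.

Lemma measurable_funV d (T : measurableType d) (f : T -> R) :
  measurable_fun setT f -> measurable_fun setT (fun x => (f x)^-1).
Proof. by move=> mf; exact: (measurableT_comp measurable_inv mf). Qed.

Lemma measurable_fun_sqrt d (T : measurableType d) (f : T -> R) :
  measurable_fun setT f -> measurable_fun setT (fun x => Num.sqrt (f x)).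
Proof. by move=> mf; exact: (measurableT_comp measurable_sqrt mf). Qed.

End real_measurability.

Section integer_sums.
Context (R : realType).
Implicit Types a : int -> \bar R.

Lemma esum_int a : (forall k, 0 <= a k)%E ->
  (\esum_(k in [set: int]) a k =
   \sum_(n <oo) a (Posz n) + \sum_(n <oo) a (Negz n))%E.
Proof.
move=> a0; rewrite (esumID [set k | (0 <= k)%R]) //; congr (_ + _)%E.
  rewrite nneseries_esumT //; apply: reindex_esum; split => [n _ | n m _ _ [->] // | k /=].
    by split.
  by case: k => [n _|n [_ //]]; exists n.
rewrite nneseries_esumT //; apply: reindex_esum; split => [n _ | n m _ _ [->] // | k /=].
  by split.
by case: k => [n [_ /(_ isT)] | n _] //; exists n.
Qed.

Lemma esum_int_shift a (m : int) :
  (\esum_(k in [set: int]) a (m + k)%R = \esum_(k in [set: int]) a k)%E.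
Proof.
by apply/esym; apply: (@reindex_esum _ _ _ setT setT (fun k => m + k)); split => //=.
Qed.

Lemma esum_intZl a (c : R) : 0 <= c -> (forall k, 0 <= a k)%E ->
  (\esum_(k in [set: int]) (c%:E * a k) = c%:E * \esum_(k in [set: int]) a k)%E.
Proof.
move=> c0 a0; rewrite !esum_int //; last by move=> k; rewrite mule_ge0 // lee_fin.
by rewrite !nneseriesZl // muleDr // ge0_adde_def // inE nneseries_ge0.
Qed.

Context d (T : measurableType d) (mu : {measure set T -> \bar R}) (D : set T).
Hypothesis mD : measurable D.
Variable f : int -> T -> \bar R.
Hypotheses (mf : forall k, measurable_fun D (f k)) (f0 : forall k x, D x -> (0 <= f k x)%E).

Lemma eq_esum_int x : D x -> (\esum_(k in [set: int]) f k x =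
   \sum_(n <oo) f (Posz n) x + \sum_(n <oo) f (Negz n) x)%E.
Proof. by move=> Dx; rewrite esum_int // => k; exact: f0. Qed.

Lemma measurable_esum_int : measurable_fun D (fun x => \esum_(k in [set: int]) f k x)%E.
Proof.
apply: (eq_measurable_fun (fun x => \sum_(n <oo) f (Posz n) x + \sum_(n <oo) f (Negz n) x)%E).
  by move=> x /[!inE] Dx; rewrite eq_esum_int.
by apply: emeasurable_funD; apply: emeasurable_nneseries => // k x Dx; exact: f0.
Qed.

Lemma integral_esum_int : (\int[mu]_(x in D) (\esum_(k in [set: int]) f k x) =
  \esum_(k in [set: int]) \int[mu]_(x in D) f k x)%E.
Proof.
rewrite (eq_integral (fun x => \sum_(n <oo) f (Posz n) x + \sum_(n <oo) f (Negz n) x)%E); last first.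
  by move=> x /[!inE] Dx; rewrite eq_esum_int.
rewrite ge0_integralD //; last 4 first.
- by move=> x Dx; apply: nneseries_ge0 => n _ _; exact: f0.
- by apply: emeasurable_nneseries => // k x Dx; exact: f0.
- by move=> x Dx; apply: nneseries_ge0 => n _ _; exact: f0.
- by apply: emeasurable_nneseries => // k x Dx; exact: f0.
rewrite !integral_nneseries //; [|by move=> n x Dx; exact: f0|by move=> n x Dx; exact: f0].
by rewrite esum_int // => k; apply: integral_ge0 => x Dx; exact: f0.
Qed.

End integer_sums.

Section affine_change_of_variables.
Context (R : realType).
Local Notation mu := (@lebesgue_measure R).
Local Notation RR := (measurableTypeR R).

Definition affine_map (a b : R) (x : RR) : RR := a * x + b.

Lemma measurable_affine_map a b : measurable_fun setT (affine_map a b).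
Proof. by apply: measurable_funD => //; exact: measurable_funM. Qed.

Lemma lebesgue_measure_affine (a b : R) (A : set R) : a != 0 -> measurable A ->
  mu A = (`|a|%:E * mu (affine_map a b @^-1` A))%E.
Proof.
move=> a0 mA; pose m := measure_function_pushforward__canonical__measure_function_Measure mu (measurable_affine_map a b).
apply: (lebesgue_measure_unique (mu := mscale (`|a|%:nng) m)) => // _ [[u v]] _ <-.
change (mu `]u, v]%classic = `|a|%:E * mu (affine_map a b @^-1` `]u, v]%classic))%E.
have [ap|an] : 0 < a \/ a < 0 by move: a0; rewrite neq_lt => /orP[]; [right|left].
  have -> : affine_map a b @^-1` `]u, v]%classic = `](u - b) / a, (v - b) / a]%classic.
    apply/seteqP; split => x /=; rewrite /affine_map !in_itv /= ltr_pdivrMr // ler_pdivlMr //;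
      by move=> /andP[h1 h2]; apply/andP; split; lra.
  rewrite !lebesgue_measure_itv /= !lte_fin gtr0_norm // ltr_pM2r ?invr_gt0 // ltrD2r.
  case: ifP => _; last by rewrite mule0.
  by rewrite -!EFinB -EFinM; congr EFin; field.
have -> : affine_map a b @^-1` `]u, v]%classic = `[(v - b) / a, (u - b) / a[%classic.
  apply/seteqP; split => x /=; rewrite /affine_map !in_itv /= ltr_ndivlMr // ler_ndivrMr //;
    by move=> /andP[h1 h2]; apply/andP; split; lra.
rewrite !lebesgue_measure_itv /= !lte_fin ltr0_norm // ltr_nM2r ?invr_lt0 // ltrD2r.
case: ifP => _; last by rewrite mule0.
by rewrite -!EFinB -EFinM; congr EFin; field.
Qed.

Lemma ge0_integral_affine (a b : R) (f : R -> \bar R) : a != 0 ->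
  measurable_fun setT f -> (forall x, 0 <= f x)%E ->
  (\int[mu]_x f x = `|a|%:E * \int[mu]_x f (a * x + b)%R)%E.
Proof.
move=> a0 mf f0.
pose m := measure_function_pushforward__canonical__measure_function_Measure mu (measurable_affine_map a b).
pose c := NngNum (normr_ge0 a).
transitivity (\int[mscale c m]_x f x)%E.
  by apply: eq_measure_integral => A mA _; exact: lebesgue_measure_affine.
rewrite ge0_integral_mscale //=; congr (_ * _)%E.
by rewrite ge0_integral_pushforward //; exact: measurable_affine_map.
Qed.

End affine_change_of_variables.

Section unfolding.
Context (R : realType).
Local Notation mu := (@lebesgue_measure R).

(** Unfolding: the integer translates of the torus tile the line. *)
Lemma integral_torus_esum (f : R -> \bar R) : measurable_fun setT f ->
  (forall x, 0 <= f x)%E ->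
  (\int[mu]_(y in torus (R := R)) (\esum_(k in [set: int]) f (y + k%:~R)%R)
    = \int[mu]_y f y)%E.
Proof.
move=> mf f0.
have mt : measurable (torus (R := R)) by exact: measurable_itv.
have mshift (a : R) : measurable_fun setT (fun y : R => f (y + a)).
  by apply: measurableT_comp => //; exact: measurable_funD.
have mind (a : R) : measurable_fun [set: R] (fun y : R => (\1_(torus (R := R)) (y + a) : R)%:E).
  apply/measurable_EFinP; apply: (@measurableT_comp _ _ _ _ _ _ (\1_(torus (R := R)) : R -> R) _ (fun y : R => y + a)).
    exact: measurable_indic.
  exact: measurable_funD.
rewrite integral_esum_int //; last first.
  by move=> k; exact: (measurable_funTS (mshift _)).
transitivity (\esum_(k in [set: int]) \int[mu]_y (f y * (\1_(torus (R := R)) (y - k%:~R)%R)%:E))%E.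
  apply: eq_esum => k _.
  rewrite [RHS](ge0_integral_affine k%:~R (oner_neq0 R)) //; last 2 first.
  - by apply: emeasurable_funM => //.
  - by move=> y; rewrite mule_ge0 // lee_fin.
  rewrite normr1 mul1e integral_mkcond; apply: eq_integral => y _.
  rewrite mul1r addrK patchE indicE; case: ifP => _; by rewrite ?mule1 ?mule0.
rewrite -integral_esum_int //; last 2 first.
- by move=> k; apply: emeasurable_funM; [exact: mf|exact: mind].
- by move=> k y _; rewrite mule_ge0 // lee_fin.
apply: eq_integral => y _.
pose m := Num.floor y.
rewrite (esumID [set m]) //; last by move=> k _; rewrite mule_ge0 // lee_fin.
rewrite setTI esum_set1; last by rewrite mule_ge0 // lee_fin.
rewrite esum1; last first.
  move=> k [_ km]; rewrite indicE memNset ?mule0 // /torus /= in_itv /=.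
  apply/negP; rewrite subr_ge0 ltrBlDr; apply: contra_notN km => /andP[h1 h2].
  by apply/eqP; rewrite eq_sym; apply/eqP/floor_def; rewrite h1 /= intrD addrC.
rewrite adde0 indicE mem_set ?mule1 // /torus /= in_itv /=.
by rewrite subr_ge0 floor_le ltrBlDr addrC -[1]/(1%:~R) -intrD floorD1_gt.
Qed.

End unfolding.

(** * The heat kernel on the torus *)

Section gauss_kernel.
Context (R : realType).
Local Notation mu := (@lebesgue_measure R).
Implicit Types a b t x y z : R.

Definition gauss_kernel t x : R := expR (- x ^+ 2 / (4 * t)) / Num.sqrt (4 * pi * t).
Local Notation g := gauss_kernel.

Lemma gauss_kernel_ge0 t x : 0 <= g t x.
Proof. by rewrite divr_ge0 ?expR_ge0. Qed.

Lemma gauss_kernel_le0 t x : t <= 0 -> g t x = 0.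
Proof.
move=> t0; rewrite /g ler0_sqrtr ?invr0 ?mulr0 //.
by rewrite mulr_ge0_le0 // mulr_ge0 // pi_ge0.
Qed.

Lemma gauss_kernelN t x : g t (- x) = g t x.
Proof. by rewrite /g sqrrN. Qed.

Lemma gauss_kernel_normal t x y : 0 < t -> g t (x - y) = normal_pdf x (Num.sqrt (2 * t)) y.
Proof.
move=> t0; have t2 : 0 <= 2 * t by lra.
rewrite normal_pdfE; last by rewrite sqrtr_eq0 -ltNge; lra.
rewrite /normal_peak /normal_fun /g sqr_sqrtr // mulrC -sqrrN opprB.
congr ((Num.sqrt _)^-1 * expR (_ / _)); rewrite -[_ *+ 2]mulr_natr; ring.
Qed.

Lemma measurable_gauss_kernel : measurable_fun setT (fun p : R * R => g p.1 p.2).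
Proof.
apply: measurable_funM.
  apply: measurableT_comp => //; apply: measurable_funM.
    by apply: measurableT_comp => //; apply: measurable_funX; exact: measurable_snd.
  apply: measurable_funV.
  by apply: measurable_funM => //; exact: measurable_fst.
apply: measurable_funV; apply: measurable_fun_sqrt.
by apply: measurable_funM => //; exact: measurable_fst.
Qed.

Lemma measurable_gauss_kernel_sub d (T : measurableType d) (u v : T -> R) :
  measurable_fun setT u -> measurable_fun setT v ->
  measurable_fun setT (fun p => g (u p) (v p)).
Proof.
move=> mu' mv; apply: (measurableT_comp measurable_gauss_kernel (g := fun p => (u p, v p))).
exact: measurable_fun_pair.
Qed.

Lemma integral_gauss_kernel t x : 0 < t -> (\int[mu]_y (g t (x - y))%:E = 1)%E.
Proof.
move=> t0; under eq_integral do rewrite gauss_kernel_normal //.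
exact: integral_normal_pdf.
Qed.

(** Completing the square. *)
Lemma gauss_kernelM a b z l : 0 < a -> 0 < b ->
  g a z * g b (z - l) = g (a + b) l * g (a * b / (a + b)) (z - l * a / (a + b)).
Proof.
move=> a0 b0; have ab0 : 0 < a + b by rewrite addr_gt0.
have [an bn abn] : [/\ a != 0, b != 0 & a + b != 0] by rewrite !gt_eqF.
have p4 : 0 <= 4 * pi :> R by rewrite mulr_ge0 // pi_ge0.
rewrite /g mulrACA [RHS]mulrACA -!expRD -!invfM; congr (expR _ * _^-1).
  by field; rewrite an bn abn.
rewrite -!sqrtrM; last 2 first.
- by rewrite mulr_ge0 // ltW.
- by rewrite mulr_ge0 // ltW.
by congr Num.sqrt; field.
Qed.

(** From [exp (- y) <= 1 / y]. *)
Lemma gauss_kernel_tail t n : 0 < t ->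
  g t n.+1%:R <= Num.sqrt (4 * pi * t) / pi * (n.+1%:R ^+ 2)^-1.
Proof.
move=> t0; have pi0 := pi_gt0 R.
have q0 : 0 < 4 * pi * t by rewrite !mulr_gt0.
have s0 : 0 < Num.sqrt (4 * pi * t) by rewrite sqrtr_gt0.
have n2 : 0 < n.+1%:R ^+ 2 :> R by rewrite exprn_gt0.
have h : expR (- n.+1%:R ^+ 2 / (4 * t)) <= 4 * t / n.+1%:R ^+ 2.
  rewrite mulNr expRN -[leRHS]invrK lef_pV2 ?posrE ?expR_gt0 ?invr_gt0 ?divr_gt0 ?mulr_gt0 //.
  by rewrite invf_div; apply: le_trans (expR_ge1Dx _); rewrite lerDr.
rewrite /g ler_pdivrMr //; apply: (le_trans h).
have s2 := sqr_sqrtr (ltW q0); move: (Num.sqrt (4 * pi * t)) s0 s2 => S S0 S2.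
have -> : S / pi * (n.+1%:R ^+ 2)^-1 * S = S ^+ 2 / pi * (n.+1%:R ^+ 2)^-1 by ring.
rewrite S2 le_eqVlt; apply/orP; left; apply/eqP.
by rewrite -[4 * pi * t]mulrA [pi * t]mulrC mulrA mulfK // gt_eqF.
Qed.

Lemma sum_inv_sqr N : \sum_(0 <= n < N) (n.+1%:R ^+ 2)^-1 <= 2 :> R.
Proof.
suff : \sum_(0 <= n < N.+1) (n.+1%:R ^+ 2)^-1 <= 2 - N.+1%:R^-1 :> R.
  move=> h; apply: (@le_trans _ _ (\sum_(0 <= n < N.+1) (n.+1%:R ^+ 2)^-1)).
    by rewrite big_nat_recr //= lerDl invr_ge0 sqr_ge0.
  by apply: (le_trans h); rewrite lerBlDr lerDl invr_ge0.
elim: N => [|N ih]; first by rewrite big_nat1 expr1n invr1; lra.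
rewrite big_nat_recr //=; apply: (le_trans (lerD ih (lexx _))).
have n0 : 0 < N.+1%:R :> R by rewrite ltr0n.
have -> : N.+2%:R = N.+1%:R + 1 :> R by rewrite natr1.
move: (N.+1%:R) n0 => m n0.
have m1 : m + 1 != 0 by rewrite gt_eqF // addr_gt0.
suff : m^-1 - (m + 1)^-1 - ((m + 1) ^+ 2)^-1 >= 0 by lra.
have -> : m^-1 - (m + 1)^-1 - ((m + 1) ^+ 2)^-1 = (m * (m + 1) ^+ 2)^-1.
  by field; rewrite m1 gt_eqF.
by rewrite invr_ge0 mulr_ge0 ?sqr_ge0 // ltW.
Qed.

End gauss_kernel.

Section periodic_heat_kernel.
Context (R : realType).
Local Notation mu := (@lebesgue_measure R).
Local Notation g := (@gauss_kernel R).
Implicit Types a b t x y z : R.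

(** The heat kernel before it is truncated to a real number: a sum in [\bar R],
    to which Tonelli's theorem applies. *)
Definition ekernel t x : \bar R := (\esum_(k in [set: int]) (g t (x - k%:~R))%:E)%E.

Lemma heat_kernel_ekernel t x : heat_kernel t x = fine (ekernel t x).
Proof. by []. Qed.

Lemma ekernel_ge0 t x : (0 <= ekernel t x)%E.
Proof. by apply: esum_ge0 => k _; rewrite lee_fin gauss_kernel_ge0. Qed.

Lemma ekernel_shift t x (m : int) : ekernel t (x - m%:~R) = ekernel t x.
Proof.
rewrite /ekernel -[RHS](esum_int_shift _ m); apply: eq_esum => k _.
by rewrite intrD opprD addrA.
Qed.

(** The winding number zero term is singular as [t] goes to [0]; all the others
    together are [O(sqrt t)]. *)
Definition winding t : \bar R :=
  (\sum_(n <oo) (g t n.+1%:R)%:E + \sum_(n <oo) (g t n.+1%:R)%:E)%E.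

Lemma winding_ge0 t : (0 <= winding t)%E.
Proof.
by apply: adde_ge0; apply: nneseries_ge0 => n _ _; rewrite lee_fin gauss_kernel_ge0.
Qed.

Lemma ekernel0 t : ekernel t 0 = ((g t 0)%:E + winding t)%E.
Proof.
have g0 x : (0 <= (g t x)%:E)%E by rewrite lee_fin gauss_kernel_ge0.
rewrite /ekernel esum_int //.
under eq_eseriesr do rewrite sub0r gauss_kernelN.
under [X in (_ + X)%E]eq_eseriesr do rewrite sub0r NegzE intrN opprK.
rewrite nneseries_recl //= /winding addeA; congr (_ + _ + _)%E.
by rewrite -(nneseries_addn (f := fun k => (g t k%:~R)%:E) 1) //; apply: eq_eseriesr => n _; rewrite addn1.
Qed.

Lemma winding_le t : 0 < t -> (winding t <= (4 * Num.sqrt (4 * pi * t) / pi)%:E)%E.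
Proof.
move=> t0; have s0 : 0 <= Num.sqrt (4 * pi * t) / pi by rewrite divr_ge0 ?sqrtr_ge0 ?pi_ge0.
suff h : (\sum_(n <oo) (g t n.+1%:R)%:E <= (2 * (Num.sqrt (4 * pi * t) / pi))%:E)%E.
  apply: (le_trans (leeD h h)); rewrite -EFinD lee_fin le_eqVlt; apply/orP; left; apply/eqP; ring.
apply: lime_le.
  by apply: is_cvg_nneseries => n _ _; rewrite lee_fin gauss_kernel_ge0.
apply: nearW => N; rewrite sumEFin lee_fin.
apply: (@le_trans _ _ (\sum_(0 <= n < N) Num.sqrt (4 * pi * t) / pi * (n.+1%:R ^+ 2)^-1)).
  by apply: ler_sum => n _; exact: gauss_kernel_tail.
by rewrite -mulr_sumr [leRHS]mulrC ler_wpM2l // sum_inv_sqr.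
Qed.

Lemma ekernel_fin t x : ekernel t x \is a fin_num.
Proof.
have [t0|t0] := leP t 0.
  rewrite /ekernel esum1 // => k _; by rewrite gauss_kernel_le0.
(* Since [(x - k)^2 >= k^2 / 2 - x^2], the kernel at time [t] is dominated by the
   one at time [2 * t] and at the origin. *)
pose C := expR (x ^+ 2 / (4 * t)) * (Num.sqrt (4 * pi * (2 * t)) / Num.sqrt (4 * pi * t)).
have pi0 := pi_gt0 R.
have st : 0 < Num.sqrt (4 * pi * t) by rewrite sqrtr_gt0 !mulr_gt0.
have s2t : 0 < Num.sqrt (4 * pi * (2 * t)) by rewrite sqrtr_gt0 !mulr_gt0.
have C0 : 0 <= C by rewrite mulr_ge0 ?expR_ge0 // divr_ge0 // ltW.
have h k : g t (x - k%:~R) <= C * g (2 * t) (0 - k%:~R).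
  rewrite /C /gauss_kernel sub0r sqrrN.
  rewrite mulrACA -expRD [X in _ <= _ * X](_ : _ = (Num.sqrt (4 * pi * t))^-1); last first.
    by field; rewrite !gt_eqF.
  rewrite ler_pM2r ?invr_gt0 // ler_expR -subr_ge0.
  have -> : x ^+ 2 / (4 * t) + - k%:~R ^+ 2 / (4 * (2 * t)) - - (x - k%:~R) ^+ 2 / (4 * t) =
      (2 * x - k%:~R) ^+ 2 / (8 * t) by field; rewrite gt_eqF.
  by rewrite divr_ge0 ?sqr_ge0 // mulr_ge0 // ltW.
rewrite ge0_fin_numE ?ekernel_ge0 //.
apply: (@le_lt_trans _ _ (C%:E * ekernel (2 * t) 0)%E).
  rewrite /ekernel -esum_intZl //; last by move=> k; rewrite lee_fin gauss_kernel_ge0.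
  by apply: le_esum => k _; rewrite -EFinM lee_fin.
have t20 : 0 < 2 * t by lra.
rewrite ekernel0 lte_mul_pinfty ?lee_fin //.
apply: (@le_lt_trans _ _ ((g (2 * t) 0)%:E + (4 * Num.sqrt (4 * pi * (2 * t)) / pi)%:E)%E).
  by rewrite leeD2l // winding_le.
by rewrite -EFinD ltry.
Qed.

Lemma heat_kernelE t x : (heat_kernel t x)%:E = ekernel t x.
Proof. by rewrite heat_kernel_ekernel fineK // ekernel_fin. Qed.

Lemma heat_kernel_ge0 t x : 0 <= heat_kernel t x.
Proof. by rewrite fine_ge0 // ekernel_ge0. Qed.

Lemma heat_kernel0 x : heat_kernel 0 x = 0.
Proof.
rewrite heat_kernel_ekernel /ekernel esum1 // => k _; by rewrite gauss_kernel_le0.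
Qed.

Lemma measurable_heat_kernel d (T : measurableType d) (u v : T -> R) :
  measurable_fun setT u -> measurable_fun setT v ->
  measurable_fun setT (fun p => heat_kernel (u p) (v p)).
Proof.
move=> mu' mv; apply/measurable_EFinP.
apply: (eq_measurable_fun (fun p => \esum_(k in [set: int]) (g (u p) (v p - k%:~R))%:E)%E).
  by move=> p _ /=; rewrite heat_kernelE.
apply: measurable_esum_int => // [k|k p _]; last by rewrite lee_fin gauss_kernel_ge0.
apply/measurable_EFinP; apply: measurable_gauss_kernel_sub => //.
exact: measurable_funB.
Qed.

Lemma integral_heat_kernel t x : 0 < t ->
  (\int[mu]_(y in torus (R := R)) (heat_kernel t (x - y))%:E = 1)%E.
Proof.
move=> t0; rewrite -(integral_gauss_kernel x t0) -integral_torus_esum //; last 2 first.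
- by apply/measurable_EFinP; apply: measurable_gauss_kernel_sub => //; exact: measurable_funB.
- by move=> y; rewrite lee_fin gauss_kernel_ge0.
apply: eq_integral => y _; rewrite heat_kernelE; apply: eq_esum => k _.
by rewrite opprD addrA.
Qed.

(** The semigroup property: unfold one factor, then complete the square in each
    term of the other. *)
Lemma integral_heat_kernelM a b x : 0 < a -> 0 < b ->
  (\int[mu]_(y in torus (R := R)) (heat_kernel a (x - y) * heat_kernel b (x - y))%:E
     = ekernel (a + b) 0)%E.
Proof.
move=> a0 b0; have ab0 : 0 < a + b by rewrite addr_gt0.
have c0 : 0 < a * b / (a + b) by rewrite divr_gt0 // mulr_gt0.
have mg t z : measurable_fun setT (fun y => g t (z - y)).
  by apply: measurable_gauss_kernel_sub => //; exact: measurable_funB.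
have mh t : measurable_fun setT (fun y => heat_kernel t (x - y)).
  by apply: measurable_heat_kernel => //; exact: measurable_funB.
transitivity (\int[mu]_y (g a (x - y) * heat_kernel b (x - y))%:E)%E.
  rewrite -integral_torus_esum //; last 2 first.
  - by apply/measurable_EFinP; exact: measurable_funM.
  - by move=> y; rewrite lee_fin mulr_ge0 ?gauss_kernel_ge0 ?heat_kernel_ge0.
  apply: eq_integral => y _.
  transitivity (\esum_(k in [set: int]) ((heat_kernel b (x - y))%:E * (g a (x - y - k%:~R))%:E))%E.
    rewrite esum_intZl ?heat_kernel_ge0 //; last by move=> k; rewrite lee_fin gauss_kernel_ge0.
    by rewrite EFinM muleC (heat_kernelE a (x - y)).
  apply: eq_esum => k _; rewrite [RHS]EFinM [RHS]muleC opprD addrA; congr (_ * _)%E.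
  by rewrite !heat_kernelE ekernel_shift.
transitivity (\int[mu]_y \esum_(l in [set: int]) (g a (x - y) * g b (x - y - l%:~R))%:E)%E.
  apply: eq_integral => y _; rewrite EFinM heat_kernelE /ekernel -esum_intZl ?gauss_kernel_ge0 //.
  by move=> k; rewrite lee_fin gauss_kernel_ge0.
rewrite integral_esum_int //; last 2 first.
- move=> l; apply/measurable_EFinP; apply: measurable_funM; first exact: mg.
  apply: (eq_measurable_fun (fun y => g b (x - l%:~R - y))); last exact: mg.
  by move=> y _; rewrite addrAC.
- by move=> l y _; rewrite lee_fin mulr_ge0 ?gauss_kernel_ge0.
apply: eq_esum => l _; rewrite sub0r gauss_kernelN.
transitivity (\int[mu]_y ((g (a + b) l%:~R)%:E *
    (g (a * b / (a + b)) (x - l%:~R * a / (a + b) - y))%:E))%E.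
  apply: eq_integral => y _; rewrite -EFinM gauss_kernelM //.
  by congr (_ * g _ _)%:E; rewrite addrAC.
rewrite ge0_integralZl //; last 3 first.
- by apply/measurable_EFinP; exact: mg.
- by move=> y _; rewrite lee_fin gauss_kernel_ge0.
- by rewrite lee_fin gauss_kernel_ge0.
by rewrite integral_gauss_kernel // mule1.
Qed.

(** Each exponential increases with the time; only the normalising factor
    decreases. *)
Lemma heat_kernel_le a b x : 0 < a <= b ->
  Num.sqrt (a / b) * heat_kernel a x <= heat_kernel b x.
Proof.
move=> /andP[a0 ab]; have b0 : 0 < b := lt_le_trans a0 ab.
rewrite -lee_fin EFinM !heat_kernelE /ekernel -esum_intZl ?sqrtr_ge0 //; last first.
  by move=> k; rewrite lee_fin gauss_kernel_ge0.
apply: le_esum => k _; rewrite -EFinM lee_fin /gauss_kernel; set z := x - _.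
have p4 : 0 <= 4 * pi :> R by rewrite mulr_ge0 // pi_ge0.
have sb : 0 < Num.sqrt (4 * pi * b) by rewrite sqrtr_gt0 !mulr_gt0 ?pi_gt0.
have sa : 0 < Num.sqrt (4 * pi * a) by rewrite sqrtr_gt0 !mulr_gt0 ?pi_gt0.
have <- : Num.sqrt (4 * pi * a) / Num.sqrt (4 * pi * b) = Num.sqrt (a / b).
  rewrite -sqrtrV; last by rewrite mulr_ge0 // ltW.
  rewrite -sqrtrM; last by rewrite mulr_ge0 // ltW.
  by rewrite -mulf_div divff ?mul1r // gt_eqF // mulr_gt0 // pi_gt0.
have -> : Num.sqrt (4 * pi * a) / Num.sqrt (4 * pi * b) *
    (expR (- z ^+ 2 / (4 * a)) / Num.sqrt (4 * pi * a)) =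
    expR (- z ^+ 2 / (4 * a)) / Num.sqrt (4 * pi * b) by field; rewrite !gt_eqF.
rewrite ler_pM2r ?invr_gt0 // ler_expR !mulNr lerN2 ler_wpM2l ?sqr_ge0 //.
by rewrite lef_pV2 ?posrE ?mulr_gt0 // ler_pM2l.
Qed.

End periodic_heat_kernel.

(** * Covariance of the stochastic convolution *)

Section inverse_sqrt_integral.
Context (R : realType).
Local Notation mu := (@lebesgue_measure R).

Let measurable_inv_sqrt (A : set R) :
  measurable_fun A (fun x : R => ((Num.sqrt x)^-1)%:E).
Proof.
apply/measurable_EFinP; apply: measurable_funTS.
by apply: measurable_funV; exact: measurable_sqrt.
Qed.

Let integral_inv_sqrt_pos (u v : R) : 0 < u -> u < v ->
  (\int[mu]_(x in `]u, v]) ((Num.sqrt x)^-1)%:E = (2 * (Num.sqrt v - Num.sqrt u))%:E)%E.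
Proof.
move=> u0 uv; rewrite integral_itv_obnd_cbnd; last exact: measurable_inv_sqrt.
rewrite mulrBr.
apply: (@FTC_is_derive R (fun x => 2 * Num.sqrt x) (fun x => (Num.sqrt x)^-1)) => //.
- move=> x /andP[ux _]; have x0 : 0 < x := lt_le_trans u0 ux.
  have := is_derive1_sqrt x0 => ds.
  have -> : (fun x => 2 * Num.sqrt x) = (2 : R) \*: (@Num.sqrt R) by [].
  have scE (a b : R) : a *: (b : R^o) = a * b by [].
  by apply: (is_derive_eq (is_deriveZ _ ds)); rewrite scE invfM mulrA divff ?mul1r.
- apply: continuous_in_subspaceT => x; rewrite inE /= in_itv /= => /andP[ux _].
  apply: continuous_comp; first exact: sqrt_continuous.
  by apply: inv_continuous; rewrite gt_eqF // sqrtr_gt0 (lt_le_trans u0).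
Qed.

Lemma integral_inv_sqrt (u v : R) : 0 <= u -> u <= v ->
  (\int[mu]_(x in `]u, v]) ((Num.sqrt x)^-1)%:E = (2 * (Num.sqrt v - Num.sqrt u))%:E)%E.
Proof.
rewrite le_eqVlt => /orP[/eqP <-|u0]; rewrite le_eqVlt => /orP[/eqP <-|uv];
  rewrite ?set_itvoc0 ?integral_set0 ?subrr ?mulr0 //; last exact: integral_inv_sqrt_pos.
rename uv into v0; rewrite sqrtr0 subr0.
pose E (n : nat) : set R := `](v / n.+2%:R), v]%classic.
have vn n : 0 < v / n.+2%:R < v.
  by rewrite divr_gt0 ?ltr0n //= ltr_pdivrMr ?ltr0n // ltr_pMr // ltr1n.
have UE : \bigcup_n E n = `]0, v]%classic.
  apply/seteqP; split => x /=.
    move=> [n _]; rewrite /E /= !in_itv /= => /andP[h ->]; rewrite andbT.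
    by have /andP[h1 _] := vn n; exact: lt_trans h.
  rewrite in_itv /= => /andP[x0 xv].
  have [n hn] : exists n : nat, v / x < n%:R.
    by exists (Num.bound (v / x)); apply: archi_boundP; rewrite divr_ge0 // ltW.
  exists n => //; rewrite /E /= in_itv /= xv andbT ltr_pdivrMr ?ltr0n //.
  rewrite mulrC -ltr_pdivrMr //; apply: (lt_le_trans hn); rewrite ler_nat; lia.
have ndE : nondecreasing_seq E.
  move=> n m nm; apply/subsetPset => x; rewrite /E /= !in_itv /= => /andP[h ->]; rewrite andbT.
  apply: le_lt_trans h; rewrite ler_pM2l // lef_pV2 ?posrE ?ltr0n // ler_nat; lia.
have lim1 : (fun n => \int[mu]_(x in E n) ((Num.sqrt x)^-1)%:E)%E @ \oo -->
    (\int[mu]_(x in `]0%R, v]) ((Num.sqrt x)^-1)%:E)%E.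
  rewrite -UE; apply: ge0_nondecreasing_set_cvg_integral => //.
  - by move=> n; exact: measurable_itv.
  - by move=> n; exact: measurable_inv_sqrt.
apply: (cvg_unique _ lim1) => //.
apply: (@cvg_trans _ ((fun n => (2 * (Num.sqrt v - Num.sqrt (v / n.+2%:R)))%:E) @ \oo)).
  apply: near_eq_cvg; apply: nearW => n.
  by have /andP[h1 h2] := vn n; rewrite integral_inv_sqrt_pos.
apply: cvg_EFin; first by apply: nearW.
have c0 : (fun n : nat => v / n.+2%:R) @ \oo --> (0 : R).
  rewrite -[X in _ --> X](mulr0 v); apply: cvgM; first exact: cvg_cst.
  have := @cvg_harmonic R; rewrite -(cvg_shiftn 1) /=; apply: cvg_trans.
  by apply: near_eq_cvg; apply: nearW => n /=; rewrite addn1.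
have : (fun n => 2 * (Num.sqrt v - Num.sqrt (v / n.+2%:R))) @ \oo -->
    2 * (Num.sqrt v - Num.sqrt 0).
  apply: cvgM; first exact: cvg_cst.
  apply: cvgB; first exact: cvg_cst.
  by apply: (cvg_comp (fun n : nat => v / n.+2%:R) (@Num.sqrt R)) c0 _; exact: sqrt_continuous.
by rewrite sqrtr0 subr0.
Qed.

End inverse_sqrt_integral.

Section torus_tonelli.
Context (R : realType).
Local Notation mu := (@lebesgue_measure R).
Local Notation lam := (product_measure1 (@lebesgue_measure R) (@lebesgue_measure R)).
Local Notation RR := (measurableTypeR R).

Lemma tonelli_rect (A B : set R) (f : R * R -> \bar R) :
  measurable A -> measurable B ->
  measurable_fun setT f -> (forall z, 0 <= f z)%E ->
  (\int[lam]_(z in A `*` B) f z = \int[mu]_(r in A) \int[mu]_(y in B) f (r, y))%E.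
Proof.
move=> mA mB mf f0.
have mAB : @measurable _ (RR * RR)%type (A `*` B) by exact: measurableX.
rewrite integral_mkcond.
transitivity (\int[mu]_r \int[mu]_y (f \_ (A `*` B)) (r, y))%E.
  apply: fubini_tonelli1.
  - by apply/(measurable_restrictT f) => //; exact: measurable_funTS.
  - by move=> z; rewrite patchE; case: ifP.
rewrite [RHS]integral_mkcond; apply: eq_integral => r _.
rewrite [RHS]patchE; case: ifPn => [rA|rA].
  rewrite [RHS]integral_mkcond; apply: eq_integral => y _.
  rewrite !patchE; congr (if _ then _ else _).
  by rewrite in_setX rA.
rewrite integral0_eq // => y _; rewrite patchE; case: ifPn => //.
by rewrite in_setX (negbTE rA).
Qed.

End torus_tonelli.

Section covariance.
Context (R : realType).
Local Notation mu := (@lebesgue_measure R).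
Local Notation lam := (product_measure1 (@lebesgue_measure R) (@lebesgue_measure R)).
Variables (T eps x : R).
Hypothesis eps0 : 0 < eps.
Local Notation D := (spacetime T).
Local Notation mD := (@measurable_spacetime R T).

(** The integrand whose Wiener integral is the stochastic convolution at
    time [t]. *)
Definition noise_kernel (t : R) (z : R * R) : R :=
  if z.1 < t then heat_kernel (eps * (t - z.1)) (x - z.2) else 0.
Local Notation h := noise_kernel.

Lemma noise_kernel_ge0 t z : 0 <= h t z.
Proof. by rewrite /h; case: ifP => // _; exact: heat_kernel_ge0. Qed.

Lemma measurable_noise_kernel t : measurable_fun setT (h t).
Proof.
apply: measurable_fun_ifT.
- by apply: measurable_fun_ltr => //; exact: measurable_fst.
- apply: measurable_heat_kernel.
    apply: measurable_funM => //; apply: measurable_funB => //; exact: measurable_fst.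
  by apply: measurable_funB => //; exact: measurable_snd.
- exact: measurable_cst.
Qed.

Lemma measurable_winding : measurable_fun setT (fun t : R => winding (eps * t)).
Proof.
have mS : measurable_fun setT (fun t : R => \sum_(n <oo) (gauss_kernel (eps * t) n.+1%:R)%:E)%E.
  apply: emeasurable_nneseries => [n t _|n]; first by rewrite lee_fin gauss_kernel_ge0.
  apply/measurable_EFinP; apply: measurable_gauss_kernel_sub; last exact: measurable_cst.
  by apply: measurable_funM.
by apply: emeasurable_funD.
Qed.

Let C := 4 * Num.sqrt (4 * pi * (eps * (2 * T))) / pi.

Let winding_bound t : 0 < t <= 2 * T -> (winding (eps * t) <= C%:E)%E.
Proof.
move=> /andP[t0 tT]; apply: (le_trans (winding_le _)); first exact: mulr_gt0.
rewrite lee_fin /C -!mulrA ler_pM2l // ler_wpM2r ?invr_ge0 ?pi_ge0 //.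
rewrite ler_wsqrtr // ler_pM2l // ler_pM2l ?pi_gt0 // ler_pM2l //.
Qed.

Let S (a : R) : R := fine (\int[mu]_(t in `]0%R, a]) winding (eps * t))%E / 2.

Let winding_integral (u v : R) : 0 <= u -> u <= v -> v <= 2 * T ->
  (\int[mu]_(t in `]u, v]) winding (eps * t) = ((2 * (S v - S u))%R)%:E)%E /\
  0 <= S v - S u <= C / 2 * (v - u).
Proof.
move=> u0 uv vT.
have mw (A : set R) : measurable_fun A (fun t : R => winding (eps * t)).
  by apply: measurable_funTS; exact: measurable_winding.
have C0 : 0 <= C by rewrite !mulr_ge0 ?invr_ge0 ?pi_ge0 ?sqrtr_ge0.
have bd (a b : R) : 0 <= a -> a <= b -> b <= 2 * T ->
    (0 <= \int[mu]_(t in `]a, b]) winding (eps * t) <= (C * (b - a))%R%:E)%E.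
  move=> a0 ab bT; apply/andP; split.
    by apply: integral_ge0 => t _; exact: winding_ge0.
  apply: (@le_trans _ _ (\int[mu]_(t in `]a, b]) (cst C%:E t))%E).
    apply: ge0_le_integral => //.
    - by move=> t _; exact: winding_ge0.
    - exact: mw.
    - move=> t /=; rewrite in_itv /= => /andP[at0 tb]; apply: winding_bound.
      by rewrite (le_lt_trans a0 at0) (le_trans tb bT).
  rewrite integral_cst //= lebesgue_measure_itv /= lte_fin.
  case: ifP => [_|/negbT]; first by rewrite -EFinB -EFinM.
  rewrite -leNgt => ba; have -> : a = b by apply/eqP; rewrite eq_le ab.
  by rewrite subrr mulr0 mule0.
have fin (a b : R) : 0 <= a -> a <= b -> b <= 2 * T ->
    (\int[mu]_(t in `]a, b]) winding (eps * t))%E \is a fin_num.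
  move=> a0 ab bT; have /andP[h1 h2] := bd _ _ a0 ab bT.
  by rewrite ge0_fin_numE // (le_lt_trans h2) // ltry.
have split_int : (\int[mu]_(t in `]0%R, v]) winding (eps * t) =
   \int[mu]_(t in `]0%R, u]) winding (eps * t) + \int[mu]_(t in `]u, v]) winding (eps * t))%E.
  rewrite -ge0_integral_setU //.
  - by rewrite -itv_bndbnd_setU // !bnd_simp.
  - exact: mw.
  - by move=> t _; exact: winding_ge0.
  - apply: lt_disjoint => a b; rewrite !in_itv /= => /andP[_ h1] /andP[h2 _].
    exact: le_lt_trans h1 h2.
have e : (\int[mu]_(t in `]u, v]) winding (eps * t) = ((2 * (S v - S u))%R)%:E)%E.
  rewrite /S split_int fineD; [|exact: fin u0 (le_trans uv vT)|exact: fin].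
  rewrite -[LHS]fineK; last exact: fin.
  by congr EFin; field.
split=> //; have /andP[] := bd _ _ u0 uv vT.
by rewrite e !lee_fin => h1 h2; apply/andP; split; lra.
Qed.

(** The semigroup property evaluates the integral over the torus; the
    substitution [tau = t + s - 2 r] then produces the factor one half. *)
Let overlap_integral (s t : R) : 0 <= s -> s <= t -> t <= T ->
  (\int[lam]_(z in D) (h t z * h s z)%:E =
   (2^-1)%:E * \int[mu]_(tau in `](t - s)%R, (t + s)%R]) ekernel (eps * tau) 0)%E.
Proof.
move=> s0 st tT.
have mek : measurable_fun [set: R] (fun tau : R => ekernel (eps * tau) 0).
  apply: (eq_measurable_fun (fun tau : R => (heat_kernel (eps * tau) 0)%:E)).
    by move=> tau _; rewrite heat_kernelE.
  by apply/measurable_EFinP; apply: measurable_heat_kernel => //; exact: measurable_funM.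
rewrite tonelli_rect; [| exact: measurable_itv|exact: measurable_itv| |]; last 2 first.
- by apply/measurable_EFinP; apply: measurable_funM; exact: measurable_noise_kernel.
- by move=> z; rewrite lee_fin mulr_ge0 ?noise_kernel_ge0.
transitivity (\int[mu]_(r in `[0%R, s[) ekernel (eps * (-2 * r + (t + s)))%R 0)%E.
  rewrite [LHS]integral_mkcond [RHS]integral_mkcond; apply: eq_integral => r _.
  rewrite !patchE; case: ifPn => [|rT]; rewrite ?mem_setE ?in_itv /=.
    move=> /andP[r0 rT]; rewrite r0 /=; case: ifPn => [rs|].
      rewrite /h /= rs (lt_le_trans rs st).
      rewrite integral_heat_kernelM ?mulr_gt0 ?subr_gt0 // ?(lt_le_trans rs st) //.
      have E (a b c : R) : eps * (a - c) + eps * (b - c) = eps * (-2 * c + (a + b)) by ring.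
      by rewrite E.
    rewrite -leNgt => sr; apply: integral0_eq => y _.
    by rewrite /h /= [r < s]ltNge sr /= mulr0.
  case: ifPn => // /andP[r0 rs]; move: rT; rewrite mem_setE in_itv /= r0 /=.
  by rewrite (ltW (lt_le_trans rs (le_trans st tT))).
have n2 : -2 != 0 :> R by rewrite oppr_eq0 pnatr_eq0.
rewrite [X in (_ = _ * X)%E]integral_mkcond.
rewrite [X in (_ = _ * X)%E](ge0_integral_affine (t + s) n2); last 2 first.
- by apply/(measurable_restrictT (fun tau : R => ekernel (eps * tau) 0)) => //; exact: measurable_funTS.
- by move=> tau; rewrite patchE; case: ifP => // _; exact: ekernel_ge0.
rewrite normrN gtr0_norm // muleA -EFinM mulVf ?mul1e //.
rewrite [LHS]integral_mkcond; apply: eq_integral => r _; rewrite !patchE.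
rewrite !mem_setE !in_itv /=.
have -> : (t - s < -2 * r + (t + s)) && (-2 * r + (t + s) <= t + s) = (0 <= r < s) by lra.
by [].
Qed.

(** The zero winding term of the on-diagonal kernel integrates to the square
    roots; the others are bounded and contribute the Lipschitz function [S]. *)
Lemma overlap : exists (S : R -> R) (L : R),
  [/\ 0 <= L,
      forall u v, 0 <= u -> u <= v -> v <= 2 * T -> 0 <= S v - S u <= L * (v - u) &
      forall s t, 0 <= s -> s <= t -> t <= T ->
        has_int lam D (fun z => h t z * h s z)
          ((Num.sqrt (t + s) - Num.sqrt (t - s)) / Num.sqrt (4 * pi * eps)
            + (S (t + s) - S (t - s)))].
Proof.
exists S, (C / 2); split.
- by rewrite !mulr_ge0 ?invr_ge0 ?pi_ge0 ?sqrtr_ge0.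
- by move=> u v u0 uv vT; have [_] := winding_integral u0 uv vT.
move=> s t s0 st tT; apply: ge0_has_int.
- by apply: measurable_funTS; apply: measurable_funM; exact: measurable_noise_kernel.
- by move=> z _; rewrite mulr_ge0 ?noise_kernel_ge0.
have u0 : 0 <= t - s by lra.
have uv : t - s <= t + s by lra.
have vT : t + s <= 2 * T by lra.
rewrite overlap_integral //.
rewrite (eq_integral (fun tau : measurableTypeR R => ((Num.sqrt (4 * pi * eps))^-1%:E * ((Num.sqrt tau)^-1)%:E
    + winding (eps * tau))%E)); last first.
  move=> tau; rewrite inE /= in_itv /= => /andP[t1 _].
  rewrite ekernel0; congr (_ + _)%E; rewrite -EFinM -invfM; congr EFin.
  rewrite /gauss_kernel expr0n /= oppr0 mul0r expR0 mul1r mulrA sqrtrM //.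
  by rewrite !mulr_ge0 ?pi_ge0 // ltW.
have mw : measurable_fun `](t - s), (t + s)] (fun t : R => winding (eps * t)).
  by apply: measurable_funTS; exact: measurable_winding.
have mi : measurable_fun `](t - s), (t + s)] (fun x : R => ((Num.sqrt x)^-1)%:E).
  by apply/measurable_EFinP; apply: measurable_funTS; apply: measurable_funV; exact: measurable_sqrt.
rewrite ge0_integralD //; last 2 first.
- by apply: emeasurable_funM => //; exact: measurable_cst.
- by move=> tau _; exact: winding_ge0.
rewrite ge0_integralZl //.
transitivity ((2^-1 * ((Num.sqrt (4 * pi * eps))^-1 * (2 * (Num.sqrt (t + s) - Num.sqrt (t - s)))
    + 2 * (S (t + s) - S (t - s))))%R%:E).
  by rewrite integral_inv_sqrt // (winding_integral u0 uv vT).1.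
by congr EFin; field; rewrite sqrtr_eq0 -ltNge !mulr_gt0 ?pi_gt0.
Qed.

End covariance.

(** * Covariances of the increments along a uniform grid *)

Section second_difference_sqrt.
Context (R : realType).
Implicit Types z : R.

(** For a process with variogram proportional to [sqrt], minus this function at
    [i - j] is, up to scaling, the covariance of the increments [i] and [j]. *)
Definition sqrt_diff2 z : R :=
  2 * Num.sqrt `|z| - Num.sqrt `|z + 1| - Num.sqrt `|z - 1|.
Local Notation beta := sqrt_diff2.

Lemma sqrt_diff2N z : beta (- z) = beta z.
Proof.
rewrite /beta normrN; have -> : `|- z + 1| = `|z - 1| by rewrite -normrN opprD opprK.
have -> : `|- z - 1| = `|z + 1| by rewrite -opprD normrN.
by ring.
Qed.

Lemma sqrt_diff2_0 : beta 0 = - 2.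
Proof. by rewrite /beta normr0 sqrtr0 add0r sub0r normrN normr1 sqrtr1; ring. Qed.

Lemma sqrt_shift_le (a b : R) : 0 <= a -> b <= a + 1 -> Num.sqrt b <= Num.sqrt a + 1.
Proof.
move=> a0 ba; apply: (@le_trans _ _ (Num.sqrt ((Num.sqrt a + 1) ^+ 2))).
  rewrite ler_wsqrtr //; have := sqr_sqrtr a0; have := sqrtr_ge0 a.
  by move: (Num.sqrt a) => r; nra.
by rewrite sqrtr_sqr ger0_norm // addr_ge0 // sqrtr_ge0.
Qed.

Lemma sqrt_diff2_le2 z : `|beta z| <= 2.
Proof.
have h1 : `|z + 1| <= `|z| + 1 by rewrite (le_trans (ler_normD _ _)) // normr1.
have h2 : `|z - 1| <= `|z| + 1 by rewrite (le_trans (ler_normB _ _)) // normr1.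
have h3 : `|z| <= `|z + 1| + 1.
  by rewrite -{1}[z](addrK 1) (le_trans (ler_normB _ _)) // normr1.
have h4 : `|z| <= `|z - 1| + 1.
  by rewrite -{1}[z](subrK 1) (le_trans (ler_normD _ _)) // normr1.
have := sqrt_shift_le (normr_ge0 z) h1; have := sqrt_shift_le (normr_ge0 z) h2.
have := sqrt_shift_le (normr_ge0 _) h3; have := sqrt_shift_le (normr_ge0 _) h4.
by rewrite /beta ler_norml => ? ? ? ?; apply/andP; split; lra.
Qed.

Lemma sqrt_diff2_nat (k : nat) :
  beta k.+1%:R = 2 * Num.sqrt k.+1%:R - Num.sqrt k.+2%:R - Num.sqrt k%:R.
Proof.
by rewrite /beta natr1 -[in `|_ - 1|]natr1 addrK !ger0_norm.
Qed.

Lemma sqrt_diff2_nat_ge0 (k : nat) : 0 <= beta k.+1%:R.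
Proof.
rewrite sqrt_diff2_nat -[k.+2%:R]natr1 -[k.+1%:R]natr1.
have := ler0n R k; move: (k%:R : R) => a a0.
have := sqr_sqrtr a0; have := @sqr_sqrtr _ (a + 1); have := @sqr_sqrtr _ (a + 1 + 1).
have := sqrtr_ge0 a; have := sqrtr_ge0 (a + 1); have := sqrtr_ge0 (a + 1 + 1).
move: (Num.sqrt a) (Num.sqrt (a + 1)) (Num.sqrt (a + 1 + 1)) => r p q q0 p0 r0 hq hp hr.
have {}hp : p ^+ 2 = a + 1 by apply: hp; lra.
have {}hq : q ^+ 2 = a + 1 + 1 by apply: hq; lra.
have : (q + r) ^+ 2 <= (2 * p) ^+ 2 by have := sqr_ge0 (q - r); nra.
rewrite ler_pXn2r ?nnegrE //; [lra|lra|lra].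
Qed.

Lemma sum_sqrt_diff2 (N : nat) : \sum_(0 <= k < N) `|beta k.+1%:R| <= 1.
Proof.
rewrite (eq_bigr (fun k : nat => beta k.+1%:R)); last first.
  by move=> k _; rewrite ger0_norm // sqrt_diff2_nat_ge0.
have -> : \sum_(0 <= k < N) beta k.+1%:R = 1 + Num.sqrt N%:R - Num.sqrt N.+1%:R.
  elim: N => [|N ih]; first by rewrite big_nil sqrtr0 sqrtr1; ring.
  by rewrite big_nat_recr //= ih sqrt_diff2_nat; ring.
suff : Num.sqrt N%:R <= Num.sqrt N.+1%:R :> R by lra.
by rewrite ler_wsqrtr // ler_nat.
Qed.

(** The correlations are summable because the second differences telescope. *)
Lemma sum2_sqrt_diff2 (N : nat) :
  \sum_(0 <= i < N) \sum_(0 <= j < N) `|beta (i%:R - j%:R)| <= 4 * N%:R.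
Proof.
elim: N => [|N ih]; first by rewrite big_nil mulr0.
have row (M : nat) : \sum_(0 <= i < M) `|beta (M%:R - i%:R)| <= 1.
  apply: le_trans (sum_sqrt_diff2 M); rewrite big_nat_rev /=.
  rewrite [leRHS]big_nat [leLHS]big_nat; apply: ler_sum => k /= kM.
  rewrite le_eqVlt; apply/orP; left; apply/eqP; congr `|beta _|.
  by rewrite -natrB; [congr (_%:R); lia|lia].
rewrite big_nat_recr //=.
rewrite (eq_bigr (fun i : nat => \sum_(0 <= j < N) `|beta (i%:R - j%:R)| + `|beta (i%:R - N%:R)|)); last first.
  by move=> i _; rewrite big_nat_recr.
rewrite big_split /= big_nat_recr //= subrr sqrt_diff2_0 normrN ger0_norm //.
have r1 := row N; have r2 : \sum_(0 <= i < N) `|beta (i%:R - N%:R)| <= 1.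
  apply: le_trans r1; rewrite le_eqVlt; apply/orP; left; apply/eqP; apply: eq_bigr => i _.
  by rewrite -sqrt_diff2N opprB.
rewrite -[N.+1%:R]natr1; lra.
Qed.

End second_difference_sqrt.

Section grid.
Context (R : realType).
Variables (kappa L T A1 A2 : R) (S : R -> R).
Hypotheses (kappa0 : 0 < kappa) (L0 : 0 <= L) (hA1 : 0 < A1) (hA12 : A1 < A2) (hA2 : A2 <= T).
Hypothesis hS : forall u v, 0 <= u -> u <= v -> v <= 2 * T -> 0 <= S v - S u <= L * (v - u).

Definition variogram a := Num.sqrt a / kappa + S a.
Local Notation G := variogram.

Definition cov_fun t s := G (t + s) - G `|t - s|.

Definition cov_incr N i j :=
  let t := time_grid A1 A2 N in
  cov_fun (t i.+1) (t j.+1) - cov_fun (t i.+1) (t j)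
  - cov_fun (t i) (t j.+1) + cov_fun (t i) (t j).

Definition mesh (N : nat) := (A2 - A1) / N%:R.

Let M := 2 * (L + (kappa * Num.sqrt (2 * A1))^-1) + 2 * L.

Lemma S_lip u v : 0 <= u <= 2 * T -> 0 <= v <= 2 * T -> `|S u - S v| <= L * `|u - v|.
Proof.
move=> /andP[u0 uT] /andP[v0 vT]; have [uv|vu] := leP u v.
  have /andP[h1 h2] := hS u0 uv vT.
  by rewrite distrC [`|u - v|]distrC !ger0_norm // subr_ge0.
have /andP[h1 h2] := hS v0 (ltW vu) uT.
by rewrite !ger0_norm // subr_ge0 ltW.
Qed.

Lemma variogram_lip u v : 2 * A1 <= u -> u <= v -> v <= 2 * T ->
  `|G v - G u| <= (L + (kappa * Num.sqrt (2 * A1))^-1) * (v - u).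
Proof.
move=> uA uv vT; have a0 : 0 < 2 * A1 by rewrite mulr_gt0.
have /andP[h1 h2] := hS (le_trans (ltW a0) uA) uv vT.
have sv : Num.sqrt u <= Num.sqrt v by rewrite ler_wsqrtr.
have sA : 0 < Num.sqrt (2 * A1) by rewrite sqrtr_gt0.
have su : Num.sqrt (2 * A1) <= Num.sqrt u by rewrite ler_wsqrtr.
have u0 : 0 <= u by lra.
have v0 : 0 <= v by lra.
have hd : Num.sqrt v - Num.sqrt u <= (v - u) / Num.sqrt (2 * A1).
  rewrite ler_pdivlMr // -[in leRHS](sqr_sqrtr u0) -[in leRHS](sqr_sqrtr v0).
  by move: sv sA su; move: (Num.sqrt u) (Num.sqrt v) (Num.sqrt (2 * A1)) => p q r; nra.
have -> : G v - G u = (Num.sqrt v - Num.sqrt u) / kappa + (S v - S u).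
  by rewrite /G; ring.
rewrite ger0_norm; last by rewrite addr_ge0 // divr_ge0 ?subr_ge0 // ltW.
have h3 : (Num.sqrt v - Num.sqrt u) / kappa <= (v - u) / Num.sqrt (2 * A1) / kappa.
  by rewrite ler_wpM2r // invr_ge0 ltW.
have -> : (L + (kappa * Num.sqrt (2 * A1))^-1) * (v - u) =
    (v - u) / Num.sqrt (2 * A1) / kappa + L * (v - u).
  by rewrite invfM; ring.
exact: lerD.
Qed.

Lemma mesh_gt0 N : (0 < N)%N -> 0 < mesh N.
Proof. by move=> N0; rewrite divr_gt0 ?subr_gt0 ?ltr0n. Qed.

Lemma time_gridE N i : time_grid A1 A2 N i = A1 + i%:R * mesh N.
Proof. by []. Qed.

Lemma time_grid_bounds N i : (i <= N)%N -> A1 <= time_grid A1 A2 N i <= T.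
Proof.
case: N => [|N]; first by rewrite leqn0 => /eqP ->; rewrite time_gridE mul0r addr0 lexx (le_trans (ltW hA12)).
move=> iN; rewrite time_gridE; have d0 := ltW (mesh_gt0 (ltn0Sn N)).
have : i%:R * mesh N.+1 <= N.+1%:R * mesh N.+1 by rewrite ler_wpM2r // ler_nat.
have -> : N.+1%:R * mesh N.+1 = A2 - A1 by rewrite /mesh mulrC divfK ?pnatr_eq0.
move=> h.
have : 0 <= i%:R * mesh N.+1 by rewrite mulr_ge0.
by move: h hA12 hA2; move: (i%:R * mesh N.+1) => e h12 h2; lra.
Qed.

(** The terms of [G (t + s)] are increments of a Lipschitz function, as [t + s] is
    at least [2 * A1 > 0]; in [G |t - s|] the square root contributes its second
    difference and [S] an error of order [mesh]. *)
Lemma cov_incr_approx N i j : (i < N)%N -> (j < N)%N ->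
  `|cov_incr N i j + Num.sqrt (mesh N) / kappa * sqrt_diff2 (i%:R - j%:R)| <= M * mesh N.
Proof.
move=> iN jN; have N0 : (0 < N)%N by lia.
have d0 := mesh_gt0 N0; have := mesh_gt0 N0; rewrite /cov_incr.
have /andP[bi1 bi2] := time_grid_bounds iN; have /andP[bj1 bj2] := time_grid_bounds jN.
have /andP[ci1 ci2] := time_grid_bounds (ltnW iN); have /andP[cj1 cj2] := time_grid_bounds (ltnW jN).
have e k : time_grid A1 A2 N k.+1 = time_grid A1 A2 N k + mesh N.
  by rewrite !time_gridE -natr1; ring.
have ez : time_grid A1 A2 N i - time_grid A1 A2 N j = (i%:R - j%:R) * mesh N.
  by rewrite !time_gridE; ring.
rewrite /= !e in bi1 bi2 bj1 bj2 *.
move: ez; move: (i%:R - j%:R) => z.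
move: (time_grid A1 A2 N i) (time_grid A1 A2 N j) (mesh N) bi1 bi2 bj1 bj2 ci1 ci2 cj1 cj2 d0.
move=> a b e' bi1 bi2 bj1 bj2 ci1 ci2 cj1 cj2 d0 ez _.
pose B1 := (G (a + b + e' + e') - G (a + b + e')) - (G (a + b + e') - G (a + b)).
have hB1 : `|B1| <= 2 * (L + (kappa * Num.sqrt (2 * A1))^-1) * e'.
  apply: (le_trans (ler_normB _ _)).
  have h1 : `|G (a + b + e') - G (a + b)| <= (L + (kappa * Num.sqrt (2 * A1))^-1) * e'.
    by have := @variogram_lip (a + b) (a + b + e'); rewrite [_ + e' - _]addrAC subrr add0r; apply; lra.
  have h2 : `|G (a + b + e' + e') - G (a + b + e')| <= (L + (kappa * Num.sqrt (2 * A1))^-1) * e'.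
    by have := @variogram_lip (a + b + e') (a + b + e' + e'); rewrite [_ + e' - _]addrAC subrr add0r; apply; lra.
  by move: h1 h2; set Q := L + _; lra.
have T0 : 0 < T := lt_le_trans hA1 (le_trans (ltW hA12) hA2).
have sp (p q : R) : A1 <= p -> p <= T -> A1 <= q -> q <= T -> 0 <= `|p - q| <= 2 * T.
  by move: hA1 T0 => k1 k2 k3 k4 k5 k6; rewrite normr_ge0 ler_norml; apply/andP; split; lra.
have hS1 : `|S `|a - b| - S `|a + e' - b| | <= L * e'.
  apply: (le_trans (S_lip _ _)); [exact: sp|exact: sp|].
  rewrite ler_wpM2l // (le_trans (ler_dist_dist _ _)) //.
  have e0 : a - b - (a + e' - b) = - e' by ring.
  by rewrite e0 normrN gtr0_norm ?lexx.
have hS2 : `|S `|a - b| - S `|a - (b + e')| | <= L * e'.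
  apply: (le_trans (S_lip _ _)); [exact: sp|exact: sp|].
  rewrite ler_wpM2l // (le_trans (ler_dist_dist _ _)) //.
  have e0 : a - b - (a - (b + e')) = e' by ring.
  by rewrite e0 gtr0_norm ?lexx.
have sqz y : Num.sqrt `|y * e'| = Num.sqrt `|y| * Num.sqrt e'.
  by rewrite normrM (gtr0_norm d0) sqrtrM.
have -> : cov_fun (a + e') (b + e') - cov_fun (a + e') b - cov_fun a (b + e') + cov_fun a b
    + Num.sqrt e' / kappa * sqrt_diff2 z =
    B1 - (S `|a - b| - S `|a + e' - b|) - (S `|a - b| - S `|a - (b + e')|).
  have e1 : a + e' - (b + e') = z * e' by rewrite -ez; ring.
  have e2 : a + e' - b = (z + 1) * e' by rewrite mulrDl mul1r -ez; ring.
  have e3 : a - (b + e') = (z - 1) * e' by rewrite mulrBl mul1r -ez; ring.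
  rewrite /cov_fun e1 e2 e3 ez /B1.
  have -> : a + e' + (b + e') = a + b + e' + e' by ring.
  have -> : a + e' + b = a + b + e' by ring.
  have -> : a + (b + e') = a + b + e' by ring.
  rewrite /G !sqz /sqrt_diff2; ring.
apply: (le_trans (ler_normB _ _)); rewrite /M mulrDl.
have : `|B1 - (S `|a - b| - S `|a + e' - b|)| <= 2 * (L + (kappa * Num.sqrt (2 * A1))^-1) * e' + L * e'.
  by apply: (le_trans (ler_normB _ _)); exact: lerD.
move=> h; apply: (le_trans (lerD h hS2)); rewrite le_eqVlt; apply/orP; left; apply/eqP; ring.
Qed.

Let Q := 2 / kappa + M.

Let M_ge0 : 0 <= M.
Proof. have h : 0 <= (kappa * Num.sqrt (2 * A1))^-1.
  by rewrite invr_ge0 mulr_ge0 ?sqrtr_ge0 // ltW.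
by rewrite /M; move: L0 h; move: (_^-1) => e; lra.
Qed.

Let Q_ge0 : 0 <= Q.
Proof. by apply: addr_ge0 => //; apply: divr_ge0 => //; exact: ltW. Qed.

Let mesh_sqrt N : (0 < N)%N -> mesh N <= 1 -> mesh N <= Num.sqrt (mesh N) <= 1.
Proof.
move=> N0 d1; have d0 := ltW (mesh_gt0 N0).
have := sqr_sqrtr d0; have := sqrtr_ge0 (mesh N).
have : Num.sqrt (mesh N) <= 1 by rewrite -sqrtr1 ler_wsqrtr.
by move: (mesh N) (Num.sqrt (mesh N)) => d r r1 r0 e; apply/andP; split; nra.
Qed.

Lemma cov_incr_le N i j : (i < N)%N -> (j < N)%N -> mesh N <= 1 ->
  `|cov_incr N i j| <= Q * Num.sqrt (mesh N).
Proof.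
move=> iN jN d1; have N0 : (0 < N)%N by lia.
have := cov_incr_approx iN jN; have /andP[e1 e2] := mesh_sqrt N0 d1.
have := sqrt_diff2_le2 (i%:R - j%:R : R); move: (sqrt_diff2 _) => b b2.
have k0 : 0 <= kappa^-1 by rewrite invr_ge0 ltW.
have r0 := sqrtr_ge0 (mesh N); have M0 := M_ge0.
rewrite /Q; move: (cov_incr N i j) e1 r0; move: (mesh N) (Num.sqrt (mesh N)) => d r q e1 r0 h.
have -> : q = (q + r / kappa * b) - r / kappa * b by rewrite addrK.
apply: (le_trans (ler_normB _ _)); rewrite mulrDl addrC lerD //.
  rewrite normrM ger0_norm; last by rewrite mulr_ge0.
  have -> : 2 / kappa * r = r / kappa * 2 by ring.
  by rewrite ler_wpM2l // mulr_ge0.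
by apply: (le_trans h); rewrite ler_wpM2l.
Qed.

Lemma cov_incr_diag N i : (i < N)%N ->
  `|cov_incr N i i - 2 / kappa * Num.sqrt (mesh N)| <= M * mesh N.
Proof.
move=> iN; have := cov_incr_approx iN iN; rewrite subrr sqrt_diff2_0.
by apply: le_trans; rewrite le_eqVlt; apply/orP; left; apply/eqP; congr `|_|; ring.
Qed.

Lemma sum_cov_incr N : (0 < N)%N -> mesh N <= 1 ->
  mesh N * (\sum_(0 <= i < N) \sum_(0 <= j < N) `|cov_incr N i j|)
    <= 4 * (A2 - A1) / kappa + M * (A2 - A1) ^+ 2.
Proof.
move=> N0 d1; have d0 := ltW (mesh_gt0 N0); have /andP[_ r1] := mesh_sqrt N0 d1.
have r0 := sqrtr_ge0 (mesh N).
have Nd : N%:R * mesh N = A2 - A1 by rewrite /mesh mulrC divfK // pnatr_eq0 -lt0n.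
have k0 : 0 <= kappa^-1 by rewrite invr_ge0 ltW.
have L0' : 0 <= A2 - A1 by rewrite subr_ge0 ltW.
have h : \sum_(0 <= i < N) \sum_(0 <= j < N) `|cov_incr N i j| <=
    Num.sqrt (mesh N) / kappa * (4 * N%:R) + M * mesh N * N%:R ^+ 2.
  apply: (@le_trans _ _ (\sum_(0 <= i < N) \sum_(0 <= j < N)
      (Num.sqrt (mesh N) / kappa * `|sqrt_diff2 (i%:R - j%:R)| + M * mesh N))).
    rewrite [leLHS]big_nat [leRHS]big_nat; apply: ler_sum => i /= iN.
    rewrite [leLHS]big_nat [leRHS]big_nat; apply: ler_sum => j /= jN.
    have := cov_incr_approx iN jN.
    have -> : Num.sqrt (mesh N) / kappa * `|sqrt_diff2 (i%:R - j%:R)| =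
       `|Num.sqrt (mesh N) / kappa * sqrt_diff2 (i%:R - j%:R)|.
      by rewrite normrM [X in _ = X * _]ger0_norm // mulr_ge0.
    move: (cov_incr N i j) (_ * sqrt_diff2 _) (M * mesh N) => a b c hc.
    rewrite -{1}[a](addrK b) (le_trans (ler_normB _ _)) // addrC lerD2l //.
  rewrite (eq_bigr (fun i : nat => Num.sqrt (mesh N) / kappa *
      (\sum_(0 <= j < N) `|sqrt_diff2 (i%:R - j%:R)|) + M * mesh N * N%:R)); last first.
    move=> i _; rewrite big_split /= -mulr_sumr; congr (_ + _).
    by rewrite sumr_const_nat subn0 mulr_natr.
  rewrite big_split /= -mulr_sumr sumr_const_nat subn0.
  rewrite -[(M * mesh N * N%:R) *+ N]mulr_natr -[M * mesh N * N%:R * N%:R]mulrA -expr2 lerD2r.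
  by rewrite ler_wpM2l ?mulr_ge0 // sum2_sqrt_diff2.
apply: (le_trans (ler_wpM2l d0 h)).
have -> : mesh N * (Num.sqrt (mesh N) / kappa * (4 * N%:R) + M * mesh N * N%:R ^+ 2) =
   4 * (N%:R * mesh N) / kappa * Num.sqrt (mesh N) + M * (N%:R * mesh N) ^+ 2 by ring.
rewrite Nd lerD2r ler_piMr // !mulr_ge0 //.
Qed.

(** Each term of the variance is at most [|q i j|] times the cube of a quantity
    of order [sqrt mesh], and the sum of the [|q i j|] is of order [1 / mesh].  The
    mean is a sum of squares of [2 / kappa * sqrt mesh + O(mesh)]. *)
Lemma grid_sums : exists K : R, 0 <= K /\ forall N, (0 < N)%N -> mesh N <= 1 ->
  let q := cov_incr N in
  \sum_(0 <= i < N) \sum_(0 <= j < N)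
     (72 * (q i i * q j j) * q i j ^+ 2 + 24 * q i j ^+ 4) <= K * Num.sqrt (mesh N) /\
  `|\sum_(0 <= i < N) 3 * q i i ^+ 2 - 12 * (A2 - A1) / kappa ^+ 2| <= K * Num.sqrt (mesh N).
Proof.
pose K1 := 96 * Q ^+ 3 * (4 * (A2 - A1) / kappa + M * (A2 - A1) ^+ 2).
pose K2 := 6 * Q * M * (A2 - A1).
have L0' : 0 <= A2 - A1 by rewrite subr_ge0 ltW.
have k0 : 0 <= kappa^-1 by rewrite invr_ge0 ltW.
have K10 : 0 <= K1 by rewrite !mulr_ge0 ?exprn_ge0 // addr_ge0 // !mulr_ge0 // ?exprn_ge0.
have K20 : 0 <= K2 by rewrite !mulr_ge0.
exists (K1 + K2); split; first exact: addr_ge0.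
move=> N N0 d1 q; have d0 := ltW (mesh_gt0 N0); have r0 := sqrtr_ge0 (mesh N).
have rr := sqr_sqrtr d0; have /andP[dr r1] := mesh_sqrt N0 d1.
have Nd : N%:R * mesh N = A2 - A1 by rewrite /mesh mulrC divfK // pnatr_eq0 -lt0n.
split.
  apply: (@le_trans _ _ (K1 * Num.sqrt (mesh N))); last by rewrite ler_wpM2r // lerDl.
  apply: (@le_trans _ _ (\sum_(0 <= i < N) \sum_(0 <= j < N)
      96 * (Q * Num.sqrt (mesh N)) ^+ 3 * `|q i j|)).
    rewrite [leLHS]big_nat [leRHS]big_nat; apply: ler_sum => i /= iN.
    rewrite [leLHS]big_nat [leRHS]big_nat; apply: ler_sum => j /= jN.
    have := cov_incr_le iN iN d1; have := cov_incr_le jN jN d1; have := cov_incr_le iN jN d1.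
    rewrite -/q; have := mulr_ge0 Q_ge0 r0; move: (Q * _) (q i i) (q j j) (q i j) => B a b c B0 hc hb ha.
    have h1 : a * b <= B ^+ 2.
      by apply: (le_trans (ler_norm _)); rewrite normrM expr2 ler_pM.
    have h2 : a * b * c ^+ 2 <= B ^+ 3 * `|c|.
      apply: (@le_trans _ _ (B ^+ 2 * c ^+ 2)); first by rewrite ler_wpM2r // sqr_ge0.
      have -> : B ^+ 3 * `|c| = B ^+ 2 * (B * `|c|) by ring.
      rewrite ler_wpM2l ?exprn_ge0 //.
      by rewrite -[c ^+ 2](real_normK (num_real c)) expr2 ler_wpM2r.
    have h3 : c ^+ 4 <= B ^+ 3 * `|c|.
      have -> : c ^+ 4 = `|c| ^+ 3 * `|c|.
        rewrite -exprSr -[c ^+ 4]/(c ^+ (2 * 2)) exprM -[`|c| ^+ 4]/(`|c| ^+ (2 * 2)) exprM.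
        by rewrite real_normK ?num_real.
      by rewrite ler_wpM2r // ler_pXn2r ?nnegrE.
    have -> : 72 * (a * b) * c ^+ 2 = 72 * (a * b * c ^+ 2) by ring.
    rewrite -[_ * B ^+ 3 * _]mulrA.
    have ge1 : 72 * (a * b * c ^+ 2) <= 72 * (B ^+ 3 * `|c|) by rewrite ler_wpM2l.
    have ge2 : 24 * c ^+ 4 <= 24 * (B ^+ 3 * `|c|) by rewrite ler_wpM2l.
    apply: (le_trans (lerD ge1 ge2)); rewrite -mulrDl.
    by rewrite le_eqVlt; apply/orP; left; apply/eqP; ring.
  rewrite (eq_bigr (fun i => 96 * (Q * Num.sqrt (mesh N)) ^+ 3 * \sum_(0 <= j < N) `|q i j|)); last first.
    by move=> i _; rewrite mulr_sumr.
  rewrite -mulr_sumr.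
  have -> : 96 * (Q * Num.sqrt (mesh N)) ^+ 3 = 96 * Q ^+ 3 * Num.sqrt (mesh N) * mesh N.
    by move: rr; move: (mesh N) (Num.sqrt (mesh N)) => d r <-; ring.
  rewrite /K1 -mulrA [leRHS]mulrAC ler_wpM2l //; last exact: sum_cov_incr.
  by rewrite !mulr_ge0 ?exprn_ge0.
apply: (@le_trans _ _ (K2 * Num.sqrt (mesh N))); last by rewrite ler_wpM2r // lerDr.
have -> : 12 * (A2 - A1) / kappa ^+ 2 = \sum_(0 <= i < N) 3 * (2 / kappa * Num.sqrt (mesh N)) ^+ 2.
  rewrite sumr_const_nat subn0 -mulr_natl -Nd.
  move: rr; move: (mesh N) (Num.sqrt (mesh N)) => d r <-; field.
  by rewrite gt_eqF.
rewrite -sumrB; apply: (le_trans (ler_norm_sum _ _ _)).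
apply: (@le_trans _ _ (\sum_(0 <= i < N) (6 * Q * M * (mesh N * Num.sqrt (mesh N))))); last first.
  by rewrite sumr_const_nat subn0 -mulr_natl /K2 -Nd le_eqVlt; apply/orP; left; apply/eqP; ring.
rewrite [leLHS]big_nat [leRHS]big_nat; apply: ler_sum => i /= iN.
have h1 := cov_incr_le iN iN d1; have h2 := cov_incr_diag iN; rewrite -/q in h1 h2 *.
have h3 : 2 / kappa * Num.sqrt (mesh N) <= Q * Num.sqrt (mesh N).
  by rewrite ler_wpM2r // lerDl.
have h4 : 0 <= 2 / kappa * Num.sqrt (mesh N) by rewrite !mulr_ge0.
move: h1 h2 h3 h4; set p := 2 / kappa * _; move: (q i i) => a h1 h2 h3 h4.
rewrite -mulrBr subr_sqr normrM (ger0_norm (_ : 0 <= 3)) // normrM.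
have h5 : `|a + p| <= 2 * (Q * Num.sqrt (mesh N)).
  by apply: (le_trans (ler_normD _ _)); rewrite (ger0_norm h4); lra.
have h6 := ler_pM (normr_ge0 _) (normr_ge0 _) h2 h5.
apply: (le_trans (ler_wpM2l (ler0n _ 3) h6)).
by rewrite le_eqVlt; apply/orP; left; apply/eqP; ring.
Qed.

End grid.

(** * Quartic variation of the stochastic convolution *)

Section gaussian_quartic.
Context (d : measure_display) (Omega : measurableType d) (R : realType)
  (P : probability Omega R).
Local Notation lam := (product_measure1 (@lebesgue_measure R) (@lebesgue_measure R)).
Variables (T A1 A2 eps x : R) (W : set (R * R) -> {RV P >-> R}).
Hypotheses (hA1 : 0 < A1) (hA12 : A1 < A2) (hA2 : A2 <= T) (eps0 : 0 < eps).
Hypothesis hW : white_noise T W.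
Variable X : R -> Omega -> R.
Hypothesis hX : forall t, 0 <= t <= T -> wint T W (noise_kernel eps x t) (X t).
Local Notation D := (spacetime T).
Local Notation mD := (@measurable_spacetime R T).
Local Notation h := (noise_kernel eps x).
Local Notation kappa := (Num.sqrt (4 * pi * eps)).
Local Notation PT := (@measurableT _ Omega).

Lemma has_int_cst (c : R) : has_int P setT (fun=> c) c.
Proof.
split; first exact: finite_measure_integrable_cst.
by rewrite integral_cst //= probability_setT mule1.
Qed.

Section covariance_structure.
Variables (S : R -> R) (N : nat).
Hypothesis hcov : forall s t, 0 <= s <= T -> 0 <= t <= T ->
  has_int lam D (fun z => h t z * h s z) (cov_fun kappa S t s).

Let tg := time_grid A1 A2 N.
Let incr i w := X (tg i.+1) w - X (tg i) w.
Let g i z := h (tg i.+1) z - h (tg i) z.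
Let q := cov_incr kappa A1 A2 S N.

Let tgP i : (i <= N)%N -> 0 <= tg i <= T.
Proof.
move=> iN; have /andP[h1 h2] := time_grid_bounds hA12 hA2 iN.
by rewrite h2 andbT (le_trans (ltW hA1)).
Qed.

Let wint_incr i : (i < N)%N -> wint T W (g i) (incr i).
Proof.
move=> iN; have := wint_lin 1 (- 1) (hX (tgP iN)) (hX (tgP (ltnW iN))).
by congr (wint _ _ _ _); apply/funext => z; rewrite mul1r mulN1r.
Qed.

Let has_int_incr i j : (i < N)%N -> (j < N)%N ->
  has_int lam D (fun z => g i z * g j z) (q i j).
Proof.
move=> iN jN.
have := has_intD mD (has_intB mD (has_intB mD (hcov (tgP jN) (tgP iN)) (hcov (tgP (ltnW jN)) (tgP iN)))
  (hcov (tgP jN) (tgP (ltnW iN)))) (hcov (tgP (ltnW jN)) (tgP (ltnW iN))).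
by apply: (has_int_eq mD) => z _; rewrite /g; ring.
Qed.

Let moments_incr i : (i < N)%N -> gaussian_moments P (incr i) (q i i).
Proof.
move=> iN; have [v [hv mv]] := wint_moments hW (wint_incr iN).
suff -> : q i i = v by [].
apply: (has_int_uniq (has_int_incr iN iN)).
by apply: (has_int_eq mD _ hv) => z _; rewrite expr2.
Qed.

Let F i w := incr i w ^+ 4 - 3 * q i i ^+ 2.

Let has_int_F i : (i < N)%N -> has_int P setT (F i) 0.
Proof.
move=> iN; have [_ m4 _] := moments_incr iN.
by have := has_intB PT m4 (has_int_cst (3 * q i i ^+ 2)); rewrite subrr.
Qed.

Let has_int_FF i j : (i < N)%N -> (j < N)%N ->
  has_int P setT (fun w => F i w * F j w)
    (72 * (q i i * q j j) * q i j ^+ 2 + 24 * q i j ^+ 4).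
Proof.
move=> iN jN; have [_ mi _] := moments_incr iN; have [_ mj _] := moments_incr jN.
have sq k : (k < N)%N -> has_int lam D (fun z => g k z ^+ 2) (q k k).
  by move=> kN; apply: (has_int_eq mD _ (has_int_incr kN kN)) => z _; rewrite expr2.
have mij := wint_mixed_moment hW (wint_incr iN) (wint_incr jN) (sq _ iN) (sq _ jN) (has_int_incr iN jN).
have := has_intD PT (has_intB PT (has_intB PT mij (has_intZ PT (3 * q j j ^+ 2) mi))
  (has_intZ PT (3 * q i i ^+ 2) mj)) (has_int_cst (9 * q i i ^+ 2 * q j j ^+ 2)).
set v := (X in has_int _ _ _ X); have -> : v = 72 * (q i i * q j j) * q i j ^+ 2 + 24 * q i j ^+ 4.
  by rewrite /v; move: (q i i) (q j j) (q i j) => a b c; ring.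
apply: (has_int_eq PT) => w _; rewrite /F.
by move: (incr i w) (incr j w) (q i i) (q j j) => a b c e; ring.
Qed.

(** The centred fourth powers of the increments have the covariances
    [72 q_ii q_jj q_ij^2 + 24 q_ij^4], where [q] is the covariance matrix of the
    increments. *)
Lemma quartic_moments (c : R) :
  let m := \sum_(0 <= i < N) 3 * q i i ^+ 2 in
  has_int P setT (fun w => \sum_(0 <= i < N) incr i w ^+ 4) m /\
  has_int P setT (fun w => (\sum_(0 <= i < N) incr i w ^+ 4 - c) ^+ 2)
    (\sum_(0 <= i < N) \sum_(0 <= j < N)
       (72 * (q i i * q j j) * q i j ^+ 2 + 24 * q i j ^+ 4) + (m - c) ^+ 2).
Proof.
move=> m.
have sumN (G : nat -> Omega -> R) (v : nat -> R) :
    (forall i, (i < N)%N -> has_int P setT (G i) (v i)) ->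
    has_int P setT (fun w => \sum_(0 <= i < N) G i w) (\sum_(0 <= i < N) v i).
  move=> hG; have := @has_int_sum _ _ _ P setT PT _ (index_iota 0 N)
    (fun i w => if (i < N)%N then G i w else 0) (fun i => if (i < N)%N then v i else 0).
  have e : \sum_(0 <= i < N) (if (i < N)%N then v i else 0) = \sum_(0 <= i < N) v i.
    by rewrite [LHS]big_nat [RHS]big_nat; apply: eq_bigr => i /= ->.
  rewrite e => hs; apply: (has_int_eq PT _ (hs _)) => [w _|i].
    by rewrite [LHS]big_nat [RHS]big_nat; apply: eq_bigr => i /= ->.
  by case: ifPn => [iN|_]; [exact: hG|exact: has_int0].
have hm : has_int P setT (fun w => \sum_(0 <= i < N) incr i w ^+ 4) m.
  by apply: sumN => i iN; have [] := moments_incr iN.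
split=> //.
have h1 := sumN _ _ (fun i iN => sumN _ _ (fun j jN => has_int_FF iN jN)).
have h2 := has_intZ PT (2 * (m - c)) (sumN _ _ has_int_F).
have := has_intD PT (has_intD PT h1 h2) (has_int_cst ((m - c) ^+ 2)).
rewrite [X in 2 * (m - c) * X]big1 // mulr0 addr0; apply: (has_int_eq PT) => w _.
have -> : \sum_(0 <= i < N) \sum_(0 <= j < N) F i w * F j w = (\sum_(0 <= i < N) F i w) ^+ 2.
  by rewrite expr2 mulr_suml; apply: eq_bigr => i _; rewrite mulr_sumr.
have -> : \sum_(0 <= i < N) F i w = \sum_(0 <= i < N) incr i w ^+ 4 - m.
  by rewrite -sumrB.
move: (\sum_(0 <= i < N) incr i w ^+ 4) => a.
by clear; move: (m : R) => b; ring.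
Qed.

End covariance_structure.

Lemma noise_quartic_variation : exists K : R, 0 <= K /\
  forall N, (0 < N)%N -> mesh A1 A2 N <= 1 ->
  let Y w := quartic_variation A1 A2 N x (fun t _ => X t) w in
  let c := 12 * (A2 - A1) / kappa ^+ 2 in
  exists m v, [/\ has_int P setT Y m, m <= K,
    has_int P setT (fun w => (Y w - c) ^+ 2) v & v <= K * Num.sqrt (mesh A1 A2 N)].
Proof.
have [S [L [L0 hS hov]]] := overlap T x eps0.
have k0 : 0 < kappa by rewrite sqrtr_gt0 !mulr_gt0 ?pi_gt0.
have hcov s t : 0 <= s <= T -> 0 <= t <= T ->
    has_int lam D (fun z => h t z * h s z) (cov_fun kappa S t s).
  move=> /andP[s0 sT] /andP[t0 tT]; rewrite /cov_fun /variogram.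
  have [st|ts] := leP s t.
    rewrite ger0_norm ?subr_ge0 //; have := hov _ _ s0 st tT.
    by congr (has_int _ _ _ _); field; rewrite gt_eqF.
  rewrite ltr0_norm ?subr_lt0 // opprB; have := hov _ _ t0 (ltW ts) sT.
  set v := (X in has_int _ _ _ X).
  have -> : Num.sqrt (t + s) / kappa + S (t + s) - (Num.sqrt (s - t) / kappa + S (s - t)) = v.
    by rewrite /v [s + t]addrC; field; rewrite gt_eqF.
  by apply: (has_int_eq mD) => z _; rewrite mulrC.
have [K [K0 hK]] := grid_sums k0 L0 hA1 hA12 hA2 hS.
pose c := 12 * (A2 - A1) / kappa ^+ 2.
have c0 : 0 <= c.
  by rewrite !mulr_ge0 ?invr_ge0 ?exprn_ge0 ?subr_ge0 // ltW.
exists (K + K ^+ 2 + c); split; first by rewrite !addr_ge0 // exprn_ge0.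
move=> N N0 d1 Y c'; rewrite -/c in c' *.
have [hv hm] := hK N N0 d1; have [hY hY2] := quartic_moments N hcov c.
have d0 := ltW (mesh_gt0 hA12 N0).
have r0 := sqrtr_ge0 (mesh A1 A2 N).
have r1 : Num.sqrt (mesh A1 A2 N) <= 1 by rewrite -sqrtr1 ler_wsqrtr.
set q := cov_incr _ _ _ _ _ in hv hm hY hY2.
set m := \sum_(0 <= i < N) 3 * q i i ^+ 2 in hm hY hY2.
set v := \sum_(0 <= i < N) \sum_(0 <= j < N) _ in hv hY2.
exists m, (v + (m - c) ^+ 2); split => //.
  move: hm; rewrite -/c ler_norml => /andP[_ hm].
  have := ler_wpM2l K0 r1; have := sqr_ge0 K; move: hm.
  by move: (K * _) (K ^+ 2) => e f; lra.
have : (m - c) ^+ 2 <= K ^+ 2 * Num.sqrt (mesh A1 A2 N).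
  rewrite -[(m - c) ^+ 2](real_normK (num_real _)).
  apply: (@le_trans _ _ ((K * Num.sqrt (mesh A1 A2 N)) ^+ 2)).
    by rewrite ler_pXn2r ?nnegrE // ?mulr_ge0.
  by rewrite exprMn ler_wpM2l ?exprn_ge0 // expr2 ler_piMl.
have := mulr_ge0 c0 r0; rewrite !mulrDl; move: hv.
by move: (c * _) ((m - c) ^+ 2) => e f; lra.
Qed.

End gaussian_quartic.

(** * Time regularity of the drift *)

Section kernel_modulus.
Context (R : realType).
Local Notation mu := (@lebesgue_measure R).
Local Notation lam := (product_measure1 (@lebesgue_measure R) (@lebesgue_measure R)).
Variables (T eps x : R).
Hypothesis eps0 : 0 < eps.
Local Notation D := (spacetime T).
Local Notation mD := (@measurable_spacetime R T).
Local Notation h := (noise_kernel eps x).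

Lemma noise_kernel_mass (a t : R) : 0 <= a -> a <= t -> t <= T ->
  has_int lam D (fun z => if a <= z.1 then h t z else 0) (t - a).
Proof.
move=> a0 at_ tT.
have mf : measurable_fun setT (fun z : R * R => if a <= z.1 then h t z else 0).
  apply: measurable_fun_ifT; last exact: measurable_cst.
    by apply: measurable_fun_ler => //; exact: measurable_fst.
  exact: measurable_noise_kernel.
apply: ge0_has_int.
- exact: measurable_funTS.
- by move=> z _; case: ifP => // _; exact: noise_kernel_ge0.
rewrite tonelli_rect; [| exact: measurable_itv|exact: measurable_itv| |]; last 2 first.
- exact/measurable_EFinP.
- by move=> z; rewrite lee_fin; case: ifP => // _; exact: noise_kernel_ge0.
transitivity (\int[mu]_(r in `[a, t[) (cst 1%E r : \bar R))%E; last first.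
  rewrite integral_cst //= lebesgue_measure_itv /= lte_fin mul1e; case: ifPn => //.
  rewrite -leNgt => ta; have -> : a = t by apply/eqP; rewrite eq_le at_.
  by rewrite subrr.
rewrite [LHS]integral_mkcond [RHS]integral_mkcond; apply: eq_integral => r _.
rewrite !patchE !mem_setE !in_itv /=.
case: ifPn => [/andP[r0 rT]|rT]; last first.
  case: ifPn => // /andP[ar rt]; move: rT.
  by rewrite (le_trans a0 ar) (ltW (lt_le_trans rt tT)).
case: ifPn => [/andP[ar rt]|nr].
  rewrite ar /noise_kernel /= rt.
  by rewrite -[RHS](@integral_heat_kernel R (eps * (t - r)) x) // mulr_gt0 // subr_gt0.
apply: integral0_eq => y _; rewrite /noise_kernel /=.
by move: nr; case: (a <= r) => //= /negbTE ->.
Qed.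

Lemma noise_kernel_mass0 (t : R) : 0 <= t -> t <= T -> has_int lam D (h t) t.
Proof.
move=> t0 tT; have := noise_kernel_mass (lexx 0) t0 tT; rewrite subr0.
by apply: (has_int_eq mD) => z [/=]; rewrite in_itv /= => /andP[-> _].
Qed.

(** [|h t - h s|] is [h t - h s], whose integral is [t - s], plus twice the
    negative part.  The latter is controlled by [sqrt (a / b) * p_a <= p_b] away
    from [s], and by [h s] on a window of length [sqrt (t - s)] before [s]. *)
Lemma noise_kernel_modulus (s t : R) : 0 <= s -> s < t -> t <= T -> t - s <= 1 ->
  exists2 k, has_int lam D (fun z => `|h t z - h s z|) k &
    k <= (2 * T + 3) * Num.sqrt (t - s).
Proof.
move=> s0 st tT d1; have t0 : 0 <= t := le_trans s0 (ltW st).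
have sT : s <= T := le_trans (ltW st) tT.
pose e := Num.sqrt (t - s).
have d0 : 0 < t - s by rewrite subr_gt0.
have e0 : 0 < e by rewrite sqrtr_gt0.
have ee : e ^+ 2 = t - s by rewrite sqr_sqrtr // ltW.
have e1 : e <= 1 by rewrite -sqrtr1 ler_wsqrtr.
(* [a] is the beginning of the window. *)
pose a := Num.max 0 (s - e).
have a0 : 0 <= a by rewrite le_max lexx.
have as_ : a <= s by rewrite ge_max s0 gerBl ltW.
have ae : s - a <= e by rewrite lerBlDl -lerBlDr le_max lexx orbT.
have ht := noise_kernel_mass0 t0 tT; have hs := noise_kernel_mass0 s0 sT.
have ha := noise_kernel_mass a0 as_ sT.
have hg := has_intD mD (has_intB mD ht hs) (has_intZ mD 2 (has_intD mD (has_intZ mD e hs) ha)).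
have [k [hk hk']] : exists k, has_int lam D (fun z => `|h t z - h s z|) k /\
    `|k| <= (t - s) + 2 * (e * s + (s - a)).
  apply: (@has_int_dom _ _ R lam D mD _ _ _ _ _ hg).
    apply: measurable_funTS; apply: measurableT_comp => //.
    by apply: measurable_funB; exact: measurable_noise_kernel.
  move=> z Dz; rewrite normr_id.
  have q0 : 0 <= (if a <= z.1 then h s z else 0).
    by case: ifP => // _; exact: noise_kernel_ge0.
  have p0 := noise_kernel_ge0 eps x s z; have p1 := noise_kernel_ge0 eps x t z.
  have key : h s z - h t z <= e * h s z + (if a <= z.1 then h s z else 0).
    case: ifPn => [_|]; first by have := mulr_ge0 (ltW e0) p0; lra.
    rewrite -ltNge => za; rewrite addr0.
    have zs : z.1 < s - e.
      move: za; rewrite lt_max => /orP[|//]; case: Dz => /=; rewrite in_itv /= => /andP[z0 _] _.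
      by rewrite ltNge z0.
    have zs' : z.1 < s by rewrite (lt_le_trans zs) // gerBl ltW.
    have zt : z.1 < t := lt_trans zs' st.
    move: p0 p1; rewrite /noise_kernel zs' zt.
    have := @heat_kernel_le R (eps * (s - z.1)) (eps * (t - z.1)) (x - z.2).
    rewrite mulr_gt0 ?subr_gt0 // ler_pM2l // lerD2r (ltW st) => /(_ isT).
    have -> : eps * (s - z.1) / (eps * (t - z.1)) = (s - z.1) / (t - z.1).
      by rewrite invfM mulrACA divff ?mul1r // gt_eqF.
    move: (heat_kernel _ _) (heat_kernel _ _) => p q hpq q0' p0'.
    have b0 : 0 < t - z.1 by rewrite subr_gt0.
    pose b := (s - z.1) / (t - z.1).
    have b1 : 1 - e <= b.
      rewrite ler_pdivlMr //.
      have : e * e <= e * (t - z.1) by rewrite ler_wpM2l ?ltW //; lra.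
      by rewrite -expr2 ee; lra.
    have b2 : b <= 1 by rewrite ler_pdivrMr // mul1r; lra.
    have b3 : 0 <= b by rewrite divr_ge0 ?subr_ge0 ?ltW.
    have b4 : b <= Num.sqrt b.
      by rewrite -{1}(sqr_sqrtr b3) expr2 ler_piMl ?sqrtr_ge0 // -sqrtr1 ler_wsqrtr.
    rewrite -/b in hpq.
    have : (1 - e) * q <= Num.sqrt b * q by rewrite ler_wpM2r // (le_trans b1).
    by rewrite mulrBl mul1r; move: hpq; move: (_ * q) (_ * q) => u v; lra.
  rewrite ler_norml; apply/andP; split; move: key q0 p0 p1 (mulr_ge0 (ltW e0) p0);
    move: (h t z) (h s z) (e * _) (if _ then _ else _) => A B C E'; lra.
exists k => //; apply: (le_trans (ler_norm _)); apply: (le_trans hk').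
rewrite -/e.
have : e * s <= e * T by rewrite ler_wpM2l // ltW.
have : t - s <= e by rewrite -ee expr2 ler_piMl // ltW.
have -> : (2 * T + 3) * e = 2 * (e * T) + 3 * e by ring.
move: ae; move: (e * s) (e * T) => u v; lra.
Qed.

End kernel_modulus.

Section random_tonelli.
Context (R : realType).
Local Notation RR := (measurableTypeR R).

(** An alias of the Lebesgue measure of the plane, on which its
    [sigma_finite_measure] structure can be inferred. *)
Definition plane_measure : set (RR * RR) -> \bar R :=
  product_measure1 (@lebesgue_measure R) (@lebesgue_measure R).

HB.instance Definition _ := Measure.on plane_measure.

Let plane_measure_sigma_finite : sigma_finite setT plane_measure.
Proof.
have /sigma_finiteP[F [TF ndF Foo]] := sigma_finiteT (@lebesgue_measure R).
exists (fun n => F n `*` F n).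
  apply/seteqP; split=> [[a b] _|//]; have [n _ Fa] : (\bigcup_n F n) a by rewrite -TF.
  have [m _ Fb] : (\bigcup_n F n) b by rewrite -TF.
  exists (maxn n m) => //; split => /=.
    by move: a Fa; apply/subsetPset/ndF/leq_maxl.
  by move: b Fb; apply/subsetPset/ndF/leq_maxr.
move=> k; have [mFk Fk] := Foo k; split; first exact: measurableX.
by rewrite /plane_measure product_measure1E // lte_mul_pinfty // ge0_fin_numE.
Qed.

HB.instance Definition _ := Measure_isSigmaFinite.Build _ _ _ plane_measure
  plane_measure_sigma_finite.

End random_tonelli.

Section weighted_moments.
Context (d : measure_display) (Omega : measurableType d) (R : realType)
  (P : probability Omega R).
Local Notation lam := (product_measure1 (@lebesgue_measure R) (@lebesgue_measure R)).
Local Notation RR := (measurableTypeR R).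
Variables (T M : R) (F : Omega * (RR * RR) -> R).
Local Notation D := (spacetime T).
Local Notation mD := (@measurable_spacetime R T).
Hypothesis mF : measurable_fun setT F.
Hypothesis hF : forall z, D z -> (\int[P]_w (F (w, z) ^+ 4)%:E <= M%:E)%E.
Variables (k : RR * RR -> R) (c : R).
Hypotheses (mk : measurable_fun setT k) (k0 : forall z, 0 <= k z).
Hypothesis hk : has_int lam D k c.

Let G (p : Omega * (RR * RR)) : \bar R := (\1_D p.2 * (k p.2 * F p ^+ 4))%:E.

Let mG : measurable_fun setT G.
Proof.
apply/measurable_EFinP; apply: measurable_funM.
  apply: (@measurableT_comp _ _ _ _ _ _ (\1_D : RR * RR -> R)) => //.
  by apply: measurable_indic; exact: mD.
apply: measurable_funM; last exact: measurable_funX.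
by apply: measurableT_comp.
Qed.

Let G0 p : (0 <= G p)%E.
Proof. rewrite lee_fin; apply: mulr_ge0; first by rewrite indicE.
by apply: mulr_ge0 => //; rewrite exprn_even_ge0. Qed.

Let integral_G w : (\int[lam]_z G (w, z) = \int[lam]_(z in D) (k z * F (w, z) ^+ 4)%:E)%E.
Proof.
rewrite [RHS]integral_mkcond; apply: eq_integral => z _; rewrite /G patchE indicE /=.
by case: (z \in D); rewrite ?mul1r ?mul0r.
Qed.

(** Tonelli's theorem exchanges the expectation and the integral over
    space-time. *)
Lemma weighted_fourth_moment :
  measurable_fun setT (fun w => \int[lam]_(z in D) (k z * F (w, z) ^+ 4)%:E)%E /\
  (\int[P]_w \int[lam]_(z in D) (k z * F (w, z) ^+ 4)%:E <= (M * c)%:E)%E.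
Proof.
have mFG := @measurable_fun_fubini_tonelli_F _ _ _ _ _ (@plane_measure R) _ mG G0.
have mGG := @measurable_fun_fubini_tonelli_G _ _ _ _ _ P _ mG G0.
have e : (fun w => \int[lam]_(z in D) (k z * F (w, z) ^+ 4)%:E)%E = (fun w => \int[lam]_z G (w, z))%E.
  by apply/funext => w; rewrite integral_G.
rewrite e; split; first exact: mFG.
have -> : (\int[P]_w \int[lam]_z G (w, z) = \int[lam]_z \int[P]_w G (w, z))%E.
  exact: (@fubini_tonelli _ _ _ _ _ P (@plane_measure R) _ mG G0).
have -> : (M * c)%:E = (\int[lam]_(z in D) (M * k z)%:E)%E by have [_ ->] := has_intZ mD M hk.
rewrite [leRHS]integral_mkcond; apply: ge0_le_integral => //.
- by move=> z _; apply: integral_ge0 => w _; exact: G0.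
- apply/(measurable_restrictT (fun z => (M * k z)%:E)); first exact: mD.
  by apply/measurable_EFinP; apply: measurable_funTS; apply: measurable_funM.
move=> z _; rewrite patchE; case: ifPn => zD; last first.
  by rewrite integral0_eq // => w _; rewrite /G /= indicE (negbTE zD) mul0r.
have Dz := set_mem zD.
rewrite (eq_integral (fun w => (k z)%:E * (F (w, z) ^+ 4)%:E)%E); last first.
  by move=> w _; rewrite /G /= indicE zD mul1r EFinM.
rewrite ge0_integralZl //.
- by rewrite mulrC EFinM; apply: lee_wpmul2l; [rewrite lee_fin|exact: hF].
- apply/measurable_EFinP; apply: measurable_funX.
  by apply: (measurableT_comp mF).
- by move=> w _; rewrite lee_fin exprn_even_ge0.
- by rewrite lee_fin.
Qed.

Lemma ae_weighted : {ae P, forall w, exists2 I, has_int lam D (fun z => k z * F (w, z) ^+ 4) I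
  & (\int[lam]_(z in D) (k z * F (w, z) ^+ 4)%:E)%E = I%:E}.
Proof.
have [mPhi hPhi] := weighted_fourth_moment.
set Phi := (X in measurable_fun _ X) in mPhi.
have Phi0 w : (0 <= Phi w)%E.
  by apply: integral_ge0 => z _; rewrite lee_fin mulr_ge0 // exprn_even_ge0.
have iPhi : P.-integrable setT Phi.
  apply/integrableP; split => //; apply: le_lt_trans (ltry (M * c)).
  by under eq_integral => w _ do rewrite gee0_abs //.
have := integrable_ae measurableT iPhi; apply: filterS => w /(_ I) fin.
exists (fine (Phi w)); last by rewrite fineK.
apply: ge0_has_int.
- apply: measurable_funTS; apply: measurable_funM => //; apply: measurable_funX.
  by apply: (measurableT_comp mF).
- by move=> z _; rewrite mulr_ge0 // exprn_even_ge0.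
- by rewrite fineK.
Qed.

(** Jensen's inequality for the weight [k], from the pointwise inequality
    [4 a^3 |f| <= 3 a^4 + f^4] at the optimal [a]. *)
Lemma weighted_jensen (K I : R) w : c <= K -> 0 < K ->
  has_int lam D (fun z => k z * F (w, z) ^+ 4) I ->
  exists2 J, has_int lam D (fun z => k z * `|F (w, z)|) J & J ^+ 4 <= K ^+ 3 * I.
Proof.
move=> cK K0 hI.
have mFw : measurable_fun setT (fun z => F (w, z)) by apply: (measurableT_comp mF).
have young (a y : R) : 0 <= a -> 0 <= y -> 4 * a ^+ 3 * y <= 3 * a ^+ 4 + y ^+ 4.
  move=> a0 y0; have -> : 3 * a ^+ 4 + y ^+ 4 =
    4 * a ^+ 3 * y + (a - y) ^+ 2 * (3 * a ^+ 2 + 2 * a * y + y ^+ 2) by ring.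
  by rewrite lerDl mulr_ge0 ?sqr_ge0 // !addr_ge0 ?mulr_ge0 ?sqr_ge0.
have f4 y : `|y| ^+ 4 = y ^+ 4 :> R.
  by rewrite -[4%N]/(2 * 2)%N !exprM real_normK ?num_real.
have [J [hJ hJ']] : exists J, has_int lam D (fun z => k z * `|F (w, z)|) J /\ `|J| <= 3 * c + I.
  apply: (@has_int_dom _ _ R lam D mD _ _ _ _ _ (has_intD mD (has_intZ mD 3 hk) hI)).
    by apply: measurable_funTS; apply: measurable_funM => //; apply: measurableT_comp.
  move=> z _; rewrite ger0_norm ?mulr_ge0 //.
  have -> : 3 * k z + k z * F (w, z) ^+ 4 = k z * (3 + F (w, z) ^+ 4) by ring.
  rewrite ler_wpM2l // -f4; have := young 1 `|F (w, z)| ler01 (normr_ge0 _).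
  by rewrite !expr1n !mulr1; have := normr_ge0 (F (w, z)); move: (`|F (w, z)| ^+ 4) (`|F (w, z)|) => u v; lra.
exists J => //.
have J0 : 0 <= J by apply: (has_int_ge0 mD _ hJ) => z _; rewrite mulr_ge0.
pose a := J / K; have a0 : 0 <= a by rewrite divr_ge0 // ltW.
have : 4 * a ^+ 3 * J <= 3 * a ^+ 4 * c + I.
  apply: (has_int_le mD _ (has_intZ mD (4 * a ^+ 3) hJ) (has_intD mD (has_intZ mD (3 * a ^+ 4) hk) hI)).
  move=> z _; have -> : 3 * a ^+ 4 * k z + k z * F (w, z) ^+ 4 = k z * (3 * a ^+ 4 + F (w, z) ^+ 4) by ring.
  have -> : 4 * a ^+ 3 * (k z * `|F (w, z)|) = k z * (4 * a ^+ 3 * `|F (w, z)|) by ring.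
  by rewrite ler_wpM2l // -(f4 (F (w, z))) young.
have eJ : J = a * K by rewrite /a divfK // gt_eqF.
have : 3 * a ^+ 4 * c <= 3 * a ^+ 4 * K by rewrite ler_wpM2l // mulr_ge0 // exprn_ge0.
clearbody a; rewrite eJ => h1 h2.
have -> : (a * K) ^+ 4 = K ^+ 3 * (a ^+ 4 * K) by ring.
apply: ler_wpM2l; first by rewrite exprn_ge0 // ltW.
have e1 : 4 * a ^+ 3 * (a * K) = 4 * (a ^+ 4 * K) by ring.
have e2 : 3 * a ^+ 4 * K = 3 * (a ^+ 4 * K) by ring.
move: h1 h2; rewrite e1 e2; move: (a ^+ 4 * K) (3 * a ^+ 4 * c) => u v h1 h2; lra.
Qed.

End weighted_moments.

Section reaction_term.
Context (d : measure_display) (Omega : measurableType d) (R : realType)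
  (P : probability Omega R).
Local Notation lam := (product_measure1 (@lebesgue_measure R) (@lebesgue_measure R)).
Local Notation mu := (@lebesgue_measure R).
Local Notation RR := (measurableTypeR R).
Variables (T eps x : R) (W : set (R * R) -> {RV P >-> R}) (u : R -> R -> Omega -> R).
Hypotheses (T0 : 0 < T) (eps0 : 0 < eps) (hx : torus x).
Hypothesis hu : mild_solution T eps W u.
Hypothesis hmom : bounded_moments P T u.
Local Notation D := (spacetime T).
Local Notation mD := (@measurable_spacetime R T).
Local Notation h := (noise_kernel eps x).

Let U : (RR * RR) * Omega -> R :=
  (fun z : (R * R) * Omega => u z.1.1 z.1.2 z.2) \_ (D `*` setT).

Let measurable_U : measurable_fun setT U.
Proof.
have mDT : measurable (D `*` [set: Omega] : set ((RR * RR) * Omega)).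
  by apply: measurableX => //; exact: mD.
by apply/(measurable_restrictT _ mDT); case: hu.
Qed.

(** The patch outside the space-time domain makes the field jointly measurable on
    the whole product. *)
Definition reaction (p : Omega * (RR * RR)) : R := allen_cahn (U (p.2, p.1)).

Lemma reactionE w z : D z -> reaction (w, z) = allen_cahn (u z.1 z.2 w).
Proof. by move=> Dz; rewrite /reaction /U patchE /= mem_set. Qed.

Lemma measurable_reaction : measurable_fun setT reaction.
Proof.
have mU : measurable_fun setT (fun p : Omega * (RR * RR) => U (p.2, p.1)).
  by apply: (measurableT_comp measurable_U); apply: measurable_fun_pair.
apply: measurable_funB => //; exact: measurable_funX.
Qed.

Lemma measurable_solution z : D z -> measurable_fun setT (u z.1 z.2).
Proof.
move=> Dz; have : measurable_fun setT (fun w => U (z, w)).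
  by apply: (measurableT_comp measurable_U); exact: pair1_measurable.
apply: eq_measurable_fun => w _.
by rewrite /U patchE /= mem_set.
Qed.

Let solution_moment (n : nat) : (2 <= n)%N -> exists2 B : R, 0 <= B &
  forall z, D z -> (\int[P]_w (`|u z.1 z.2 w| ^+ n)%:E <= B%:E)%E.
Proof.
move=> n2; have := hmom (_ : 2 <= n%:R).
rewrite ler_nat => /(_ n2).
set E := ereal_sup _ => Eoo.
have hE z : D z -> (\int[P]_w (`|u z.1 z.2 w| ^+ n)%:E <= E)%E.
  move=> Dz; apply: ereal_sup_ubound; exists z => //; rewrite unlock.
  by apply: eq_integral => w _; rewrite powR_mulrn.
have [B EB] : exists B : R, (E <= B%:E)%E.
  case: E Eoo {hE} => [r _|//|_]; first by exists r.
  by exists 0; rewrite leNye.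
exists `|B| => // z Dz; apply: (le_trans (hE _ Dz)); apply: (le_trans EB).
by rewrite lee_fin ler_norm.
Qed.

(** From [(y - b)^4 <= 8 (y^4 + b^4)] with [b = y^3], moments of order 4 and 12
    suffice. *)
Lemma reaction_moment : exists2 M : R, 0 <= M &
  forall z, D z -> (\int[P]_w (reaction (w, z) ^+ 4)%:E <= M%:E)%E.
Proof.
have [B4 B40 h4] := @solution_moment 4 isT.
have [B12 B120 h12] := @solution_moment 12 isT.
exists (8 * (B4 + B12)); first by rewrite mulr_ge0 // addr_ge0.
move=> z Dz; have mz := measurable_solution Dz.
have mn n : measurable_fun setT (fun w => (`|u z.1 z.2 w| ^+ n)%:E).
  by apply/measurable_EFinP; apply: measurable_funX; apply: measurableT_comp.
apply: (@le_trans _ _ (\int[P]_w (8%:E * ((`|u z.1 z.2 w| ^+ 4)%:E + (`|u z.1 z.2 w| ^+ 12)%:E)))%E).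
  apply: ge0_le_integral => //.
  - by move=> w _; rewrite lee_fin exprn_even_ge0.
  - apply/measurable_EFinP; apply: measurable_funX.
    by apply: (measurableT_comp measurable_reaction); apply: measurable_fun_pair.
  - by apply: emeasurable_funM => //; exact: emeasurable_funD.
  move=> w _; rewrite reactionE // /allen_cahn -EFinD -EFinM lee_fin.
  move: (u z.1 z.2 w) => y.
  have f4 (a : R) : `|a| ^+ 4 = a ^+ 4.
    by rewrite -[4%N]/(2 * 2)%N !exprM real_normK ?num_real.
  have -> : `|y| ^+ 12 = (y ^+ 3) ^+ 4.
    by rewrite -[12%N]/(3 * 4)%N exprM -normrX f4.
  rewrite f4; move: (y ^+ 3) => b.
  have -> : 8 * (y ^+ 4 + b ^+ 4) = (y - b) ^+ 4 + (y + b) ^+ 2 * (7 * y ^+ 2 - 10 * y * b + 7 * b ^+ 2).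
    by ring.
  rewrite lerDl mulr_ge0 ?sqr_ge0 //.
  have -> : 7 * y ^+ 2 - 10 * y * b + 7 * b ^+ 2 = 5 * (y - b) ^+ 2 + 2 * y ^+ 2 + 2 * b ^+ 2 by ring.
  by rewrite !addr_ge0 // mulr_ge0 // sqr_ge0.
rewrite ge0_integralZl //; last 2 first.
- exact: emeasurable_funD.
- by move=> w _; rewrite adde_ge0 // lee_fin exprn_ge0.
rewrite ge0_integralD //.
by rewrite EFinM; apply: lee_wpmul2l => //; rewrite EFinD; apply: leeD; [exact: h4|exact: h12].
Qed.

(** The finite expectation of the weighted fourth moment makes the space-time
    integral absolutely convergent almost surely, as Fubini's theorem requires. *)
Lemma mild_drift (t : R) (X : Omega -> R) : 0 <= t <= T ->
  {ae P, forall w, (u t x w)%:E =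
    ((\int[mu]_(s in `[0%R, t]) \int[mu]_(y in @torus R)
       (heat_kernel (eps * (t - s)) (x - y) * allen_cahn (u s y w))%:E) + (X w)%:E)%E} ->
  {ae P, forall w, has_int lam D (fun z => h t z * reaction (w, z)) (u t x w - X w)}.
Proof.
move=> /andP[t0 tT] huX; have [M M0 hM] := reaction_moment.
have mh : @measurable_fun _ _ (RR * RR)%type R setT (h t) by exact: measurable_noise_kernel.
have h0 z : 0 <= h t z by exact: noise_kernel_ge0.
have hh := noise_kernel_mass0 x eps0 t0 tT.
have hF := ae_weighted measurable_reaction hM mh h0 hh.
apply: filterS2 huX hF => w hw [I hI _].
have K0 : 0 < t + 1 by rewrite ltr_wpDl.
have tK : t <= t + 1 by rewrite lerDl.
have [J hJ _] := weighted_jensen measurable_reaction mh h0 hh tK K0 hI.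
have mRw : measurable_fun setT (fun z : RR * RR => reaction (w, z)).
  by apply: (measurableT_comp measurable_reaction); exact: pair1_measurable.
have [v [hv _]] : exists v, has_int lam D (fun z => h t z * reaction (w, z)) v /\ `|v| <= J.
  apply: (@has_int_dom _ _ R lam D mD _ _ _ _ _ hJ).
    by apply: measurable_funTS; exact: measurable_funM.
  by move=> z _; rewrite normrM ger0_norm.
suff -> : u t x w - X w = v by [].
have [iv ev] := hv.
suff e : (\int[mu]_(s in `[0%R, t]) \int[mu]_(y in @torus R)
    (heat_kernel (eps * (t - s)) (x - y) * allen_cahn (u s y w))%:E = v%:E)%E.
  by move: hw; rewrite e -EFinD => -[->]; rewrite addrK.
have iT : lam.-integrable setT ((EFin \o (fun z => h t z * reaction (w, z))) \_ D).
  exact: (integrable_mkcond _ mD).1 iv.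
rewrite -ev [RHS]integral_mkcond -(integral12_prod_meas1 iT).
rewrite [LHS]integral_mkcond; apply: eq_integral => s _; rewrite patchE /fubini_F.
case: ifPn => [st|st]; last first.
  rewrite integral0_eq // => y _; rewrite patchE; case: ifPn => // /set_mem [/= sT _].
  rewrite /noise_kernel /=; case: ifPn => [lt_st|]; last by rewrite mul0r.
  move: st sT; rewrite notin_setE /= !in_itv /= => nst /andP[s0 _].
  by case: nst; rewrite s0 ltW.
move: st; rewrite mem_setE in_itv /= => /andP[s0 st].
rewrite [LHS]integral_mkcond; apply: eq_integral => y _; rewrite !patchE.
have -> : ((s, y) \in D) = (y \in @torus R).
  by rewrite in_setX mem_setE /= in_itv /= s0 (le_trans st tT).
case: ifPn => // yT.
have Dsy : D (s, y).
  by split=> /=; [rewrite in_itv /= s0 (le_trans st)|exact: set_mem].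
rewrite /= reactionE // /noise_kernel /=; case: ifPn => // .
rewrite -leNgt => ts; have -> : s = t by apply/eqP; rewrite eq_le st.
by rewrite subrr mulr0 heat_kernel0.
Qed.

(** The increment is the integral of the reaction term against the weight
    [h t - h s], of mass at most [K = O(sqrt (t - s))]: Jensen's inequality bounds its
    fourth moment by [K^3] times the weighted fourth moment, that is by [M * K^4]. *)
Lemma drift_increment : exists2 C : R, 0 <= C & forall (s t : R) (X Y : Omega -> R),
  0 <= s -> s < t -> t <= T -> t - s <= 1 ->
  measurable_fun setT X -> measurable_fun setT Y ->
  {ae P, forall w, has_int lam D (fun z => h s z * reaction (w, z)) (u s x w - X w)} ->
  {ae P, forall w, has_int lam D (fun z => h t z * reaction (w, z)) (u t x w - Y w)} ->
  exists2 v, has_int P setT (fun w => ((u t x w - Y w) - (u s x w - X w)) ^+ 4) v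
    & v <= C * (t - s) ^+ 2.
Proof.
have [M M0 hM] := reaction_moment.
exists (M * (2 * T + 3) ^+ 4); first by rewrite mulr_ge0 // exprn_ge0 // addr_ge0 // mulr_ge0 // ltW.
move=> s t X Y s0 st tT d1 mX mY hs ht.
pose k z := `|h t z - h s z|.
have [c hc cK] := noise_kernel_modulus x eps0 s0 st tT d1.
pose K := (2 * T + 3) * Num.sqrt (t - s); rewrite -/K in cK.
have K0 : 0 < K.
  by rewrite mulr_gt0 ?sqrtr_gt0 ?subr_gt0 // ltr_wpDl // mulr_ge0 // ltW.
have mk : @measurable_fun _ _ (RR * RR)%type R setT k.
  by apply: measurableT_comp => //; apply: measurable_funB; exact: measurable_noise_kernel.
have k0 z : 0 <= k z by exact: normr_ge0.
have [mPhi hPhi] := weighted_fourth_moment measurable_reaction hM mk k0 hc.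
have aePhi := ae_weighted measurable_reaction hM mk k0 hc.
set Phi := (fun w => \int[lam]_(z in D) (k z * reaction (w, z) ^+ 4)%:E)%E in mPhi.
have Phi0 w : (0 <= Phi w)%E.
  by apply: integral_ge0 => z _; rewrite lee_fin mulr_ge0 // exprn_even_ge0.
have Dx r : 0 <= r -> r <= T -> D (r, x) by move=> r0 rT; split => //=; rewrite in_itv /= r0.
have mV : measurable_fun setT (fun w => (u t x w - Y w) - (u s x w - X w)).
  apply: measurable_funB; apply: measurable_funB => //.
    exact: (measurable_solution (Dx _ (le_trans s0 (ltW st)) tT)).
  exact: (measurable_solution (Dx _ s0 (le_trans (ltW st) tT))).
have bd : (\int[P]_w (((u t x w - Y w) - (u s x w - X w)) ^+ 4)%:E <= (K ^+ 3 * (M * K))%:E)%E.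
  apply: (@le_trans _ _ (\int[P]_w ((K ^+ 3)%:E * Phi w))%E).
    apply: ae_ge0_le_integral => //.
    - by move=> w _; rewrite lee_fin exprn_even_ge0.
    - by apply/measurable_EFinP; exact: measurable_funX.
    - by move=> w _; rewrite mule_ge0 // lee_fin exprn_ge0 // ltW.
    - by apply: emeasurable_funM => //; exact: measurable_cst.
    apply: filterS3 hs ht aePhi => w hsw htw [I hI eI] _.
    have [J hJ JI] := weighted_jensen measurable_reaction mk k0 hc cK K0 hI.
    rewrite /Phi eI -EFinM lee_fin; apply: le_trans JI.
    have hd := has_intB mD htw hsw.
    have [v [hv vJ]] : exists v, has_int lam D (fun z => h t z * reaction (w, z) - h s z * reaction (w, z)) v /\ `|v| <= J.
      apply: (@has_int_dom _ _ R lam D mD _ _ _ _ _ hJ).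
        exact: has_int_measurable hd.
      by move=> z _; rewrite -mulrBl normrM.
    have -> : u t x w - Y w - (u s x w - X w) = v by exact: has_int_uniq hd hv.
    have f4 (a : R) : `|a| ^+ 4 = a ^+ 4.
      by rewrite -[4%N]/(2 * 2)%N !exprM real_normK ?num_real.
    by rewrite -f4 ler_pXn2r ?nnegrE // (le_trans _ vJ).
  rewrite ge0_integralZl //; last by rewrite lee_fin exprn_ge0 // ltW.
  rewrite (EFinM (K ^+ 3) (M * K)); apply: lee_wpmul2l; first by rewrite lee_fin exprn_ge0 // ltW.
  by apply: (le_trans hPhi); rewrite lee_fin ler_wpM2l.
have [v [hv /andP[_ vb]]] := ge0_has_int_ub (measurable_funX 4 mV) (fun w _ => @exprn_even_ge0 R 4 _ isT) bd.
exists v => //; apply: (le_trans vb).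
have -> : K ^+ 3 * (M * K) = M * K ^+ 4 by ring.
rewrite /K exprMn mulrA.
have -> : Num.sqrt (t - s) ^+ 4 = (t - s) ^+ 2.
  by rewrite -[4%N]/(2 * 2)%N exprM sqr_sqrtr // subr_ge0 ltW.
by [].
Qed.

End reaction_term.

(** * Convergence of the quartic variation *)

Section L1_convergence.
Context (d : measure_display) (Omega : measurableType d) (R : realType)
  (P : probability Omega R).

Lemma cvg_L1_le (Y_ : nat -> Omega -> R) (Y : Omega -> R) :
  (forall e, 0 < e -> \forall N \near \oo,
    (\int[P]_w (`|Y_ N w - Y w|)%:E <= e%:E)%E) -> cvg_L1 P Y_ Y.
Proof.
move=> h; rewrite /cvg_L1 unlock.
have f0 N : (0 <= \int[P]_w (`|Y_ N w - Y w|)%:E)%E by exact: integral_ge0.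
apply/fine_cvgP; split.
  have := h 1 ltr01; apply: filterS => N hN.
  by rewrite ge0_fin_numE // (le_lt_trans hN) // ltry.
apply/cvgrPdist_le => e e0; have := h e e0; apply: filterS => N hN /=.
rewrite sub0r normrN ger0_norm ?fine_ge0 //.
by rewrite -lee_fin fineK // ge0_fin_numE // (le_lt_trans hN) // ltry.
Qed.

(** The inequality [|y| <= e + y^2 / e] turns the mean square estimate of the
    unperturbed sum into an estimate in the mean; the perturbation inequality,
    applied term by term, accounts for the other two terms. *)
Lemma perturbed_quartic_sum (N : nat) (X V : 'I_N -> Omega -> R) (c m q b e C : R) (v : 'I_N -> R) :
  0 < e -> 0 <= C -> (forall y z : R, `|(y + z) ^+ 4 - y ^+ 4| <= e * `|y| ^+ 4 + C * `|z| ^+ 4) ->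
  (forall i, measurable_fun setT (X i)) -> (forall i, measurable_fun setT (V i)) ->
  has_int P setT (fun w => \sum_i X i w ^+ 4) m ->
  has_int P setT (fun w => (\sum_i X i w ^+ 4 - c) ^+ 2) q ->
  (forall i, has_int P setT (fun w => V i w ^+ 4) (v i)) -> (forall i, v i <= b) ->
  (\int[P]_w (`|\sum_i (X i w + V i w) ^+ 4 - c|)%:E <=
    (e + q / e + e * m + C * (N%:R * b))%:E)%E.
Proof.
move=> e0 C0 pert mX mV hm hq hv vb.
have PT := @measurableT _ Omega.
have hV := has_int_sum PT (index_enum 'I_N) hv.
have hg := has_intD PT (has_intD PT (has_intD PT (has_int_cst P e) (has_intZ PT e^-1 hq))
  (has_intZ PT e hm)) (has_intZ PT C hV).
have f4 (a : R) : `|a| ^+ 4 = a ^+ 4.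
  by rewrite -[4%N]/(2 * 2)%N !exprM real_normK ?num_real.
have [k [[_ hk] kb]] : exists k,
    has_int P setT (fun w => `|\sum_i (X i w + V i w) ^+ 4 - c|) k /\
    `|k| <= e + e^-1 * q + e * m + C * \sum_i v i.
  apply: (@has_int_dom _ _ R P setT PT _ _ _ _ _ hg).
    apply: measurableT_comp => //; apply: measurable_funB => //.
    apply: measurable_sum => i; apply: measurable_funX; exact: measurable_funD.
  move=> w _; rewrite normr_id.
  have h1 : `|\sum_i (X i w + V i w) ^+ 4 - \sum_i X i w ^+ 4| <=
      e * \sum_i X i w ^+ 4 + C * \sum_i V i w ^+ 4.
    rewrite -sumrB; apply: (le_trans (ler_norm_sum _ _ _)).
    rewrite !mulr_sumr -big_split /=; apply: ler_sum => i _.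
    by apply: (le_trans (pert _ _)); rewrite !f4.
  have h2 : `|\sum_i X i w ^+ 4 - c| <= e + e^-1 * (\sum_i X i w ^+ 4 - c) ^+ 2.
    move: (\sum_i X i w ^+ 4 - c) => y.
    rewrite -[y ^+ 2](real_normK (num_real y)) -subr_ge0.
    have -> : e + e^-1 * `|y| ^+ 2 - `|y| = e^-1 * ((e - `|y| / 2) ^+ 2 + 3 / 4 * `|y| ^+ 2).
      by field; rewrite gt_eqF.
    apply: mulr_ge0; first by rewrite invr_ge0 ltW.
    by rewrite addr_ge0 ?sqr_ge0 // mulr_ge0 ?sqr_ge0.
  have := lerD h2 h1; rewrite addrA; apply: le_trans.
  apply: le_trans (ler_normD _ _); rewrite le_eqVlt; apply/orP; left; apply/eqP.
  by congr `|_|; ring.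
rewrite hk lee_fin; apply: (le_trans (ler_norm _)); apply: (le_trans kb).
rewrite [e^-1 * q]mulrC lerD2l ler_wpM2l //.
apply: (@le_trans _ _ (\sum_(i < N) b)); first exact: ler_sum.
by rewrite sumr_const card_ord mulr_natl.
Qed.

End L1_convergence.

Theorem proposition4p7 (R : realType) (d : measure_display)
    (Omega : measurableType d) (P : probability Omega R)
    (T A1 A2 eps : R) (W : set (R * R) -> {RV P >-> R})
    (u : R -> R -> Omega -> R)
    (hT : 0 < T) (hA1 : 0 < A1) (hA12 : A1 < A2) (hA2 : A2 <= T)
    (heps : 0 < eps)
    (hW : white_noise T W)
    (hu : mild_solution T eps W u)
    (hmom : bounded_moments P T u)
    (x : R) (hx : torus x) :
  cvg_L1 P (fun N => quartic_variation A1 A2 N x u)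
           (fun=> 3 / pi * eps^-1 * (A2 - A1)).
Proof.
have PT := @measurableT _ Omega.
have /choice[X hX] : forall t : R, exists X : {RV P >-> R}, 0 <= t <= T ->
    wint T W (noise_kernel eps x t) X /\
    {ae P, forall w, (u t x w)%:E =
      ((\int[@lebesgue_measure R]_(s in `[0%R, t]) \int[@lebesgue_measure R]_(y in @torus R)
         (heat_kernel (eps * (t - s)) (x - y) * allen_cahn (u s y w))%:E) + (X w)%:E)%E}.
  move=> t; case: (boolP (0 <= t <= T)) => [tT|]; last by exists (W set0).
  have Dt : spacetime T (t, x) by split; rewrite //= in_itv.
  have [_ /(_ t x Dt) [X hX huX]] := hu.
  by exists X => _; split => //; exact: wiener_integral_wint hX.
have [K [K0 hK]] := noise_quartic_variation hA1 hA12 hA2 heps hW (fun t tT => (hX t tT).1).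
have [C C0 hC] := drift_increment hT heps hx hu hmom.
set c := 3 / pi * eps^-1 * (A2 - A1).
have cE : 12 * (A2 - A1) / Num.sqrt (4 * pi * eps) ^+ 2 = c.
  rewrite sqr_sqrtr ?mulr_ge0 ?pi_ge0 ?ltW // /c.
  have := pi_gt0 R; move: (pi : R) => p p0; field.
  by rewrite !gt_eqF.
have L0 : 0 <= A2 - A1 by rewrite subr_ge0 ltW.
apply: cvg_L1_le => e e0.
(* [eta * (1 + K)] is half of [e]; the remaining terms are at most
   [B * sqrt mesh], and [r] bounds [sqrt mesh] for large [N]. *)
pose eta := e / (2 * (1 + K)).
have eta0 : 0 < eta by rewrite divr_gt0 // mulr_gt0 // ltr_pwDl.
have [C' [C'0 pert]] := @pow_perturb R 4 eta eta0.
pose B := K / eta + C' * C * (A2 - A1) + 1.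
have B0 : 0 < B.
  apply: ltr_wpDl => //; apply: addr_ge0; first by rewrite divr_ge0 // ltW.
  by rewrite mulr_ge0 // mulr_ge0.
pose r := Num.min 1 (e / (2 * B)).
have r0 : 0 < r by rewrite lt_min ltr01 divr_gt0 // mulr_gt0.
near=> N.
have N0 : (0 < N)%N by near: N; exists 1%N.
have dr : mesh A1 A2 N <= r ^+ 2.
  rewrite /mesh ler_pdivrMr ?ltr0n // mulrC -ler_pdivrMr ?exprn_gt0 //.
  by near: N; exact: nbhs_infty_ger.
have d0 := mesh_gt0 hA12 N0.
have r1 : r <= 1 by rewrite ge_min lexx.
have d1 : mesh A1 A2 N <= 1 by apply: (le_trans dr); rewrite expr_le1 // ltW.
have sr : Num.sqrt (mesh A1 A2 N) <= r.
  have -> : r = Num.sqrt (r ^+ 2) by rewrite sqrtr_sqr gtr0_norm.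
  by rewrite ler_wsqrtr.
have [m [q [hm mK hq qK]]] := hK N N0 d1.
pose tg := time_grid A1 A2 N.
have tgT i : (i <= N)%N -> 0 <= tg i <= T.
  move=> iN; have /andP[h1 h2] := time_grid_bounds hA12 hA2 iN.
  by rewrite h2 andbT (le_trans (ltW hA1)).
have tgS i : tg i.+1 - tg i = mesh A1 A2 N.
  by rewrite /tg !time_gridE -natr1; ring.
pose D (i : 'I_N) w := X (tg i.+1) w - X (tg i) w.
pose V (i : 'I_N) w := (u (tg i.+1) x w - X (tg i.+1) w) - (u (tg i) x w - X (tg i) w).
have Dx t : 0 <= t <= T -> spacetime T (t, x) by move=> tT; split; rewrite //= in_itv.
have mu_ t : 0 <= t <= T -> measurable_fun setT (u t x).
  by move=> tT; exact: (measurable_solution hu (Dx t tT)).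
have mX t : measurable_fun setT (X t) by [].
have hv (i : 'I_N) : exists v, has_int P setT (fun w => V i w ^+ 4) v /\ v <= C * mesh A1 A2 N ^+ 2.
  have ti := tgT _ (ltnW (ltn_ord i)); have tSi := tgT _ (ltn_ord i).
  have md t (tT : 0 <= t <= T) := mild_drift heps hu hmom tT (hX t tT).2.
  have lt_i : tg i < tg i.+1 by rewrite -subr_gt0 tgS.
  have le_1 : tg i.+1 - tg i <= 1 by rewrite tgS.
  have [v hv vC] := hC _ _ _ _ (andP ti).1 lt_i (andP tSi).2 le_1 (mX _) (mX _) (md _ ti) (md _ tSi).
  by exists v; split => //; rewrite -(tgS i).
have /choice[v hv'] := hv.
have mD i : measurable_fun setT (D i) by exact: measurable_funB.
have mV i : measurable_fun setT (V i).
  apply: measurable_funB; apply: measurable_funB => //; apply: mu_; apply: tgT => //.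
  exact: ltnW.
have qD w : quartic_variation A1 A2 N x (fun t _ => X t) w = \sum_i D i w ^+ 4.
  by rewrite /quartic_variation big_mkord.
have hm' : has_int P setT (fun w => \sum_i D i w ^+ 4) m.
  by apply: (has_int_eq PT _ hm) => w _; rewrite qD.
have hq' : has_int P setT (fun w => (\sum_i D i w ^+ 4 - c) ^+ 2) q.
  by apply: (has_int_eq PT _ hq) => w _; rewrite qD cE.
have := perturbed_quartic_sum eta0 C'0 pert mD mV hm' hq' (fun i => (hv' i).1) (fun i => (hv' i).2).
under eq_integral => w _.
  have -> : \sum_i (D i w + V i w) ^+ 4 = quartic_variation A1 A2 N x u w.
    rewrite /quartic_variation big_mkord; apply: eq_bigr => i _; congr (_ ^+ 4).
    by rewrite /D /V -/tg; ring.
  over.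
move=> h; apply: (le_trans h); rewrite lee_fin.
have NC : N%:R * (C * mesh A1 A2 N ^+ 2) = C * (A2 - A1) * mesh A1 A2 N.
  by rewrite /mesh; field; rewrite pnatr_eq0 -lt0n.
rewrite NC.
have dr' : mesh A1 A2 N <= r by apply: (le_trans dr); rewrite expr2 ler_piMl // ltW.
have h1 : q / eta <= K / eta * r.
  rewrite [leRHS]mulrAC ler_pM2r ?invr_gt0 //; apply: (le_trans qK); exact: ler_wpM2l.
have h2 : eta * m <= eta * K by rewrite ler_wpM2l // ltW.
have h3 : C' * (C * (A2 - A1) * mesh A1 A2 N) <= C' * C * (A2 - A1) * r.
  rewrite [leLHS]mulrA [C' * (C * _)]mulrA; apply: ler_wpM2l => //.
  by rewrite mulr_ge0 // mulr_ge0.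
have h4 : eta + eta * K = e / 2.
  by rewrite /eta; field; rewrite gt_eqF // ltr_pwDl.
have h5 : B * r <= e / 2.
  apply: (@le_trans _ _ (B * (e / (2 * B)))); first by rewrite ler_pM2l // ge_min lexx orbT.
  by rewrite le_eqVlt; apply/orP; left; apply/eqP; field; rewrite gt_eqF.
move: h5; rewrite /B 2!mulrDl mul1r => h5.
move: h1 h2 h3 h4 h5 r0; move: (K / eta * r) (C' * C * _ * r) (C' * _) (q / eta) (eta * m) (eta * K).
by clear; move=> *; lra.
Unshelve. all: by end_near.
Qed.
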